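(* Assume that conditions (A1)–(A5) listed in the context hold. Let $z\in\mathcal{X}$, and let $L\ge1$ and $k\ge0$ be integers. Then $H_2^{k,L}(X,Y)=SE^L_k+BC^L_k$ is an unbiased estimator for $\gamma'(\theta_0)$, i.e. $\mathbb{E}^{\theta_0}_{\mu_0}[H_2^{k,L}(X,Y)]=\gamma'(\theta_0)$, with finite second moment and finite expected computation time. Furthermore, $$\mathbb{E}^{\theta_0}_{\mu_0}\big[(BC^L_k)^2\big]\to0\qquad\text{and}\qquad\Big|\mathbb{E}^{\theta_0}_{\mu_0}\big[(SE^L_k)^2\big]-\pi(\theta_0)\Gamma^L_1\Big|\to0$$ as $k\to\infty$, where $\Gamma^L_1(x):=\mathbb{E}^{\theta_0}_x\big[H(\{X_i\}_{i=0}^L)^2\big]$.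
   Context: Setting. $\mathcal{X}$ is a general state space, $\Theta\subseteq\mathbb{R}$ a parameter set, and $(P(\theta):\theta\in\Theta)$ a family of Markov transition kernels $P(\theta,x,dy)$ on $\mathcal{X}$; $P(\theta)$ has a unique invariant distribution $\pi(\theta)$. $f:\mathcal{X}\to\mathbb{R}$ is integrable under $\pi(\theta)$, $\gamma(\theta):=\mathbb{E}_{\pi(\theta)}[f(X)]$, and $\gamma'(\theta)$ is its derivative in $\theta$. $\theta_0\in\Theta$ is fixed. $\mathbb{E}^{\theta}_{\mu}$ (resp. $\mathbb{E}^{\theta}_x$) denotes expectation for the chain(s) with parameter $\theta$ and initial distribution $\mu$ (resp. initial state $x$). $Ph(x):=\int h(y)P(x,dy)$, $\mu h:=\int h\,d\mu$, and $|h|_V:=\sup_{x}|h(x)|/V(x)$. Coupling. $\bar P(\theta)$ is a kernel on $\mathcal{X}\times\mathcal{X}$ with marginals $\bar P(\theta,(x,y),\mathcal{A}\times\mathcal{X})=P(\theta,x,\mathcal{A})$, $\bar P(\theta,(x,y),\mathcal{X}\times\mathcal{A})=P(\theta,y,\mathcal{A})$, and such that $\bar P(\theta,(x,x),\cdot)$ is supported on the diagonal. For $x,z\in\mathcal{X}$, $\tau_{x,z}:=\inf\{t\ge0:X_t=Z_t\}$, where $(X_t,Z_t)_{t\ge0}$ starts at $(x,z)$ and evolves according to $\bar P(\theta_0)$. $L$-lagged pair $(X,Y)$. $X_0,Y_0\sim\mu_0$; $X_i\sim P(\theta_0,X_{i-1},\cdot)$ for $1\le i\le L$; and for $i\ge1$,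 $(X_{i+L},Y_i)\sim\bar P(\theta_0,(X_{i+L-1},Y_{i-1}),\cdot)$. Let $\tau^L:=\inf\{i\ge L:X_i=Y_{i-L}\}$. The functional $H$. For a fixed reference state $z$, let $G^L_z(x):=\sum_{i=0}^{\lfloor\tau_{x,z}/L\rfloor}\big(f(X_{iL})-f(Z_{iL})\big)$, with $(X_t,Z_t)$ the coupled pair started at $(x,z)$ under $\bar P(\theta_0)$ (so $G_z^L(x)$ is random). Define $H(\{x_i\}_{i=0}^L):=\Big(\sum_{i=0}^{L-1}p'(\theta_0,x_i,x_{i+1})\Big)G^L_z(x_L)$, and correspondingly for other blocks $\{x_i\}_{i=j}^{j+L}$. Each time $H$ is evaluated along a path, the coupled pair used for $G^L_z$ is freshly simulated, independent of everything else given its starting state; expectations of $H$ include this randomness. The estimator. $$SE^L_k:=H\big(\{X_i\}_{i=k}^{k+L}\big),\qquad BC^L_k:=\sum_{t=1}^{\lfloor(\tau^L-k)/L\rfloor}\Big(H\big(\{X_i\}_{i=k+tL}^{k+(t+1)L}\big)-H\big(\{Y_i\}_{i=k+(t-1)L}^{k+tL}\big)\Big),$$ the sum being empty if its upper limit is less than $1$. The computation time is the total number of Markov transitions simulated to produce one copy of $H_2^{k,L}(X,Y)$: those of the pair $(X,Y)$ and, for each evaluation of $H$, those of the auxiliary coupled pair run until it meets. Assumptions. (A1) There is a density $p(\theta,x,y)$ with $P(\theta,x,dy)=p(\theta,x,y)P(\theta_0,x,dy)$ for all $x,y\in\mathcal{X}$, $\theta\in\Theta$. There is $\epsilon>0$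 such that $p(\cdot,x,y)$ is continuously differentiable on $[\theta_0-\epsilon,\theta_0+\epsilon]$ for each $x,y$; $p'(\theta,x,y)$ denotes the derivative in $\theta$, and $\omega_\epsilon(x,y):=\sup_{|\theta-\theta_0|<\epsilon}|p'(\theta,x,y)|$. There are a subset $A\subseteq\mathcal{X}$, an integer $n\ge1$, $\beta>0$ and a probability measure $\varphi$ with $P^n(\theta,x,dy)\ge\beta\varphi(dy)$ for $x\in A$, $y\in\mathcal{X}$, $|\theta-\theta_0|<\epsilon$. (A2) For a small set $K$ there are a measurable $V:\mathcal{X}\to[1,\infty)$ and constants $0<\lambda<1$, $b<\infty$ with $P(\theta)V(x)\le\lambda V(x)+b\,\mathbf{1}(x\in K)$, and the chains induced by $P(\theta)$ are irreducible and aperiodic, for $|\theta-\theta_0|<\epsilon$. Consequently there are constants $R<\infty$, $r<1$ such that for all $x\in\mathcal{X}$, $n\ge1$: $|\mathbb{E}^{\theta_0}_x[g(X_n)]-\pi(\theta_0)g|\le RV(x)r^n$ whenever $|g|\le V$, and $|\mathbb{E}^{\theta_0}_x[h(X_n)]-\pi(\theta_0)h|\le R\sqrt{V(x)}\,r^n$ whenever $|h|\le\sqrt V$. (A3) The starting distribution $\mu_0$ satisfies $\mu_0V<\infty$. (A4) $P(\tau_{x,z}>t)\le M(V(x)+V(z))\rho^t$ for all $x,z\in\mathcal{X}$ and $t\ge0$, for some constants $R<M<\infty$ and $r<\rho<1$. (A5) There exist $p>1$, $\kappa>1$, $\delta>0$ such that $|f^{2\kappa p+\delta}|_V<\infty$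 and $|\Omega^{\frac{2\kappa p}{p-1}}|_V<\infty$, where for an exponent $a>0$, $f^a$ denotes the function $x\mapsto|f(x)|^a$ and $\Omega^a$ denotes the function $\Omega^a(x):=\int_{\mathcal{X}}\omega_\epsilon(x,y)^a\,P(\theta_0,x,dy)$. (The constant $p$ is unrelated to the density $p(\theta,x,y)$.) *)

(* Defs.v *)
From HB Require Import structures.
From mathcomp Require Import all_boot all_order all_algebra.
From mathcomp Require Import all_classical all_reals all_analysis.

Set Implicit Arguments.
Unset Strict Implicit.
Unset Printing Implicit Defensive.
Import Order.TTheory GRing.Theory Num.Theory.
Import numFieldNormedType.Exports.

Local Open Scope classical_set_scope.
Local Open Scope ring_scope.
Local Open Scope ereal_scope.

Section kernels.
Context (d : measure_display) (T : measurableType d) (R : realType).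
Implicit Types (Q : R.-pker T ~> T) (mu : probability T R) (K : set T).

Fixpoint kiter Q (n : nat) : R.-spker T ~> T :=
  if n is m.+1 then mkcomp_noparam Q (kiter Q m)
  else kdirac (@measurable_id _ T setT).

Definition invariant Q mu : Prop :=
  forall B, measurable B -> \int[mu]_x Q x B = mu B.

Definition unique_invariant Q mu : Prop :=
  invariant Q mu /\
  forall nu : probability T R, invariant Q nu ->
    forall B, measurable B -> nu B = mu B.

Definition minorized Q (n : nat) (beta : R) (phi : probability T R) K : Prop :=
  forall x, K x -> forall B, measurable B -> beta%:E * phi B <= kiter Q n x B.

Definition small_set Q K : Prop :=
  measurable K /\
  exists (n : nat) (beta : R) (phi : probability T R),
    [/\ (0 < n)%N, (0 < beta)%R & minorized Q n beta phi K].

Definition irreducible Q : Prop :=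
  exists phi : {measure set T -> \bar R},
    [/\ sigma_finite setT phi, 0 < phi setT &
        forall B, measurable B -> 0 < phi B ->
          forall x, exists n, 0 < kiter Q n.+1 x B].

(* Aperiodicity in the form of Roberts and Rosenthal, for a chain with
   invariant law mu: no cyclic decomposition of period at least 2 that is
   charged by mu. *)
Definition aperiodic Q mu : Prop :=
  ~ exists (m : nat) (D : nat -> set T),
      [/\ (2 <= m)%N,
          forall i, (i < m)%N -> measurable (D i),
          forall i j, (i < m)%N -> (j < m)%N -> i <> j -> D i `&` D j = set0,
          forall i x, (i < m)%N -> D i x -> Q x (D (i.+1 %% m)%N) = 1 &
          0 < mu (D 0%N)].

Definition Vnorm (V : T -> R) (h : T -> \bar R) : \bar R :=
  ereal_sup (range (fun x => `|h x| * ((V x)^-1)%:E)).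

Definition diag : set (T * T) := [set xy | xy.1 = xy.2].

(* Measurability of the diagonal is what makes meeting times measurable. *)
Definition coupling Q (Qb : R.-pker (T * T)%type ~> (T * T)%type) : Prop :=
  [/\ measurable diag,
      forall x y B, measurable B -> Qb (x, y) (B `*` setT) = Q x B,
      forall x y B, measurable B -> Qb (x, y) (setT `*` B) = Q y B &
      forall x, Qb (x, x) (~` diag) = 0].

End kernels.

(* dg is the derivative of g on I, with one-sided limits at the boundary
   points of I, and is continuous on I. *)
Definition C1_on (R : realType) (I : set R) (g dg : R -> R) : Prop :=
  (forall u, I u ->
     (fun t => (g t - g u) / (t - u))%R @ within I u^' --> dg u) /\
  {within I, continuous dg}.

Section processes.
Context (d dO d1 d2 : measure_display) (O : measurableType dO)
  (S : measurableType d) (S1 : measurableType d1) (S2 : measurableType d2)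
  (R : realType) (Pr : {measure set O -> \bar R}).

(* The sigma-algebra generated by the (Z i), i in D. *)
Definition sigma_fam (I : Type) (D : set I) (Z : I -> O -> S) : set (set O) :=
  <<s \bigcup_(i in D) preimage_set_system setT (Z i) measurable >>.

(* Given the sigma-algebra G, to which U is understood to be adapted, Z has
   the regular conditional law Q(U, .). *)
Definition cond_law (G : set (set O)) (U : O -> S1) (Q : R.-pker S1 ~> S2)
    (Z : O -> S2) : Prop :=
  forall A B, G A -> measurable B ->
    Pr (A `&` Z @^-1` B) = \int[Pr]_(w in A) Q (U w) B.

End processes.

Section chains.
Context (d dO : measure_display) (O : measurableType dO)
  (S : measurableType d) (R : realType) (Pr : {measure set O -> \bar R}).

Definition markov_chain (Q : R.-pker S ~> S) (mu : {measure set S -> \bar R})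
    (W : nat -> O -> S) : Prop :=
  [/\ forall n, measurable_fun setT (W n),
      forall B, measurable B -> Pr (W 0%N @^-1` B) = mu B &
      forall n, cond_law Pr (sigma_fam `I_n.+1 W) (W n) Q (W n.+1)].

(* A Markov run with kernel Q from the (random) state U, independent of the
   events in G given U: each step is conditioned on G and on the past of W. *)
Definition fresh_run (Q : R.-pker S ~> S) (G : set (set O)) (U : O -> S)
    (W : nat -> O -> S) : Prop :=
  [/\ forall n, measurable_fun setT (W n),
      forall w, W 0%N w = U w &
      forall n, cond_law Pr <<s G `|` sigma_fam `I_n.+1 W >> (W n) Q (W n.+1)].

End chains.

(* None stands for an infinite time. *)
Definition first_time (A : nat -> Prop) : option nat :=
  if pselect (exists n, `[< A n >]) is left h then Some (ex_minn h) else None.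

Definition time_gt (tau : option nat) (t : nat) : Prop :=
  if tau is Some s then (t < s)%N else True.

Section estimator.
Context (T : Type) (R : realType).
(* s is p'(theta0, ., .) *)
Variables (f : T -> R) (s : T -> T -> R) (L : nat).

Definition meeting (w : nat -> T * T) : option nat :=
  first_time (fun t => (w t).1 = (w t).2).

Definition lagged_meeting (x y : nat -> T) : option nat :=
  first_time (fun i => (L <= i)%N /\ x i = y (i - L)%N).

(* G^L_z along a realized path w of the coupled pair; it is set to 0 on the
   null event that the pair never meets, and likewise for BC below. *)
Definition Gval (w : nat -> T * T) : R :=
  if meeting w is Some t then
    (\sum_(0 <= i < (t %/ L).+1) (f (w (i * L)%N).1 - f (w (i * L)%N).2))%R
  else 0%R.

(* H on the block (x_j, ..., x_{j+L}), with w the coupled pair started at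
   (x_{j+L}, z) that this evaluation uses. *)
Definition Hval (x : nat -> T) (j : nat) (w : nat -> T * T) : R :=
  ((\sum_(0 <= i < L) s (x (j + i)%N) (x (j + i).+1)) * Gval w)%R.

(* u j and v j are the auxiliary coupled pairs of the blocks of x and of y
   that start at time j. *)
Definition SE (k : nat) (x : nat -> T) (u : nat -> nat -> T * T) : R :=
  Hval x k (u k).

(* The truncated subtraction agrees with floor((tau - k) / L) as far as the sum
   is concerned: if tau < k then the sum is empty either way. *)
Definition nblocks (k tau : nat) : nat := ((tau - k) %/ L)%N.

Definition BC (k : nat) (x y : nat -> T) (u v : nat -> nat -> T * T) : R :=
  if lagged_meeting x y is Some tau then
    (\sum_(1 <= t < (nblocks k tau).+1)
       (Hval x (k + t * L) (u (k + t * L)%N)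
        - Hval y (k + t.-1 * L) (v (k + t.-1 * L)%N)))%R
  else 0%R.

Definition H2 (k : nat) (x y : nat -> T) (u v : nat -> nat -> T * T) : R :=
  (SE k x u + BC k x y u v)%R.

(* A transition of a coupled pair counts as one transition of each of its two
   coordinates. *)
Definition run_cost (w : nat -> T * T) : \bar R :=
  if meeting w is Some t then (2 * t)%:R%:E else +oo.

(* With m blocks in BC, the last state of x needed is x_{k+(m+1)L}, which is
   later than tau; y runs L steps behind x. *)
Definition cost (k : nat) (x y : nat -> T) (u v : nat -> nat -> T * T) :
    \bar R :=
  if lagged_meeting x y is Some tau then
    let m := nblocks k tau in
    ((k + m.+1 * L) + (k + m * L))%N%:R%:E + run_cost (u k)
    + \sum_(1 <= t < m.+1)
        (run_cost (u (k + t * L)%N) + run_cost (v (k + t.-1 * L)%N))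
  else +oo.

End estimator.

Section assumptions.
Context (d : measure_display) (T : measurableType d) (R : realType).
Variables (Theta : set R) (theta0 : R) (P : R -> R.-pker T ~> T)
  (pi : R -> probability T R) (f : T -> R).
(* p is the density and dp its derivative in theta. *)
Variables (p dp : R -> T -> T -> R) (eps : R) (V : T -> R) (Rc r : R).

(* Under A1 the supremum is over a bounded nonempty set. *)
Definition omega (x y : T) : R :=
  sup [set `|dp theta x y|%R | theta in [set theta | `|theta - theta0| < eps]%R].

Definition Omega (a : R) (x : T) : \bar R :=
  \int[P theta0 x]_y (omega x y `^ a)%:E.

Definition A1 : Prop :=
  [/\ forall theta, Theta theta ->
        [/\ measurable_fun setT (fun xy : T * T => p theta xy.1 xy.2),
            forall x y, (0 <= p theta x y)%R &
            forall x B, measurable B ->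
              P theta x B = \int[P theta0 x]_(y in B) (p theta x y)%:E],
      (0 < eps)%R,
      [set theta | `|theta - theta0| <= eps]%R `<=` Theta,
      forall x y, C1_on [set theta | `|theta - theta0| <= eps]%R
                    (fun theta => p theta x y) (fun theta => dp theta x y) &
      exists (A : set T) (n : nat) (beta : R) (phi : probability T R),
        [/\ (0 < n)%N, (0 < beta)%R &
            forall theta, (`|theta - theta0| < eps)%R ->
              minorized (P theta) n beta phi A]].

Definition geometrically_ergodic : Prop :=
  (r < 1)%R /\
  forall (x : T) (n : nat), (0 < n)%N ->
    (forall g : T -> R, measurable_fun setT g ->
       (forall y, `|g y| <= V y)%R ->
       `| \int[kiter (P theta0) n x]_y (g y)%:E - \int[pi theta0]_y (g y)%:E |
         <= (Rc * V x * r ^+ n)%:E) /\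
    (forall h : T -> R, measurable_fun setT h ->
       (forall y, `|h y| <= Num.sqrt (V y))%R ->
       `| \int[kiter (P theta0) n x]_y (h y)%:E - \int[pi theta0]_y (h y)%:E |
         <= (Rc * Num.sqrt (V x) * r ^+ n)%:E).

Definition A2 : Prop :=
  [/\ measurable_fun setT V,
      forall x, (1 <= V x)%R,
      exists (K : set T) (lambda b : R),
        [/\ (0 < lambda < 1)%R,
            forall theta, (`|theta - theta0| < eps)%R -> small_set (P theta) K &
            forall theta, (`|theta - theta0| < eps)%R -> forall x,
              \int[P theta x]_y (V y)%:E <= (lambda * V x + b * \1_K x)%:E],
      forall theta, (`|theta - theta0| < eps)%R ->
        irreducible (P theta) /\ aperiodic (P theta) (pi theta) &
      geometrically_ergodic].

Definition A3 (mu0 : probability T R) : Prop := \int[mu0]_x (V x)%:E < +oo.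

(* C (x, z) is the law under which W is the coupled pair started at (x, z). *)
Definition A4 (dC : measure_display) (OC : measurableType dC)
    (C : R.-pker (T * T)%type ~> OC) (W : nat -> OC -> T * T) : Prop :=
  exists M rho : R,
    [/\ (Rc < M)%R, (r < rho < 1)%R &
        forall (x z : T) (t : nat),
          C (x, z) [set w | time_gt (meeting (W ^~ w)) t]
            <= (M * (V x + V z) * rho ^+ t)%:E].

Definition A5 : Prop :=
  exists q kappa delta : R,
    [/\ (1 < q)%R, (1 < kappa)%R, (0 < delta)%R,
        Vnorm V (fun x => (`|f x| `^ (2 * kappa * q + delta))%:E) < +oo &
        Vnorm V (Omega (2 * kappa * q / (q - 1))) < +oo].

End assumptions.

Section experiment.
Context (d dO : measure_display) (T : measurableType d) (O : measurableType dO)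
  (R : realType) (Pr : {measure set O -> \bar R}).
Variables (Q : R.-pker T ~> T) (Qb : R.-pker (T * T)%type ~> (T * T)%type).
Variables (z : T) (L : nat) (X Y : nat -> O -> T).

(* sigma(X_0, ..., X_n, Y_0, ..., Y_m) *)
Definition pair_hist (n m : nat) : set (set O) :=
  <<s sigma_fam `I_n.+1 X `|` sigma_fam `I_m.+1 Y >>.

(* The joint law of (X_0, Y_0) is any coupling of mu0 with itself. *)
Definition lagged_pair (mu0 : probability T R) : Prop :=
  [/\ forall n, measurable_fun setT (X n) /\ measurable_fun setT (Y n),
      forall B, measurable B -> Pr (X 0%N @^-1` B) = mu0 B,
      forall B, measurable B -> Pr (Y 0%N @^-1` B) = mu0 B,
      forall i, (i < L)%N -> cond_law Pr (pair_hist i 0) (X i) Q (X i.+1) &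
      forall i, cond_law Pr (pair_hist (i + L) i)
        (fun w => (X (i + L)%N w, Y i w)) Qb
        (fun w => (X (i + L).+1 w, Y i.+1 w))].

(* W (true, j) and W (false, j) are the coupled pairs simulated for the
   evaluation of H on the blocks of X and of Y that start at time j. Each of
   them is independent of (X, Y) and of all the others given its starting
   state. *)
Definition fresh_pairs (W : bool * nat -> nat -> O -> T * T) : Prop :=
  forall a,
    fresh_run Pr Qb
      <<s sigma_fam setT X `|` sigma_fam setT Y
          `|` sigma_fam [set bn : (bool * nat) * nat | bn.1 <> a]
                        (fun bn => W bn.1 bn.2) >>
      (fun w => ((if a.1 then X else Y) (a.2 + L)%N w, z))
      (W a).

End experiment.

Section Gamma.
Context (d dO : measure_display) (T : measurableType d) (O : measurableType dO)
  (R : realType).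
Variables (Q : R.-pker T ~> T) (Qb : R.-pker (T * T)%type ~> (T * T)%type).
Variables (z : T) (L : nat) (f : T -> R) (s : T -> T -> R).
Variables (E : R.-pker T ~> O) (X : nat -> O -> T) (W : nat -> O -> T * T).

(* Under E x, X is the chain started at x and W is the coupled pair used to
   evaluate H on (X_0, ..., X_L). *)
Definition block_family : Prop :=
  forall x, markov_chain (E x) Q \d_x X /\
    fresh_run (E x) Qb (sigma_fam setT X) (fun w => (X L w, z)) W.

Definition Gamma1 (x : T) : \bar R :=
  \int[E x]_w ((Hval f s L (X ^~ w) 0 (W ^~ w)) ^+ 2)%:E.

End Gamma.

(* Main.v *)
(* Let [G] be the functional of the coupled pair started at [(x, z)] and [g x]
   its mean. The coupling gives [g - P^L g = f - pi f], so that
   [h = \sum_(j < L) P^j g] solves the Poisson equation [h - P h = f - pi f].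
   With [D_theta] the difference quotient of [P] at [theta0], invariance gives
   [pi_theta f - pi f = (theta - theta0) pi_theta (D_theta h)]. Since [D_theta h]
   is bounded by a multiple of [sqrt V], the same identity, applied to a solution
   of the Poisson equation in the [sqrt V] norm, shows that
   [pi_theta (D_theta h) - pi (D_theta h)] tends to 0; hence
   [gamma' = pi (D_theta0 h)], which is the stationary mean of [H] on a block.

   Given the past at time [j], the mean of [H] on the block that starts at [j] is
   [Psi (X_j)] with [Psi] dominated by [V]. The chains agree once they have met,
   so [E BC_k - E BC_(k+L) = E Psi (X_(k+L)) - E Psi (X_k)]: the mean of the
   estimator does not change from [k] to [k + L], while it tends to
   [pi Psi = gamma'] along [k + n L].

   All moment bounds, of [G], [BC] and the cost, are instances of one estimate
   for sums of variables with bounded moments over events of geometrically small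
   probability, proved by Young's inequality with geometric weights. *)
From HB Require Import structures.
From mathcomp Require Import all_boot all_order all_algebra.
From mathcomp Require Import all_classical all_reals all_analysis.
From mathcomp Require Import measurable_realfun ring lra.
Require Import Defs.

Set Implicit Arguments.
Unset Strict Implicit.
Unset Printing Implicit Defensive.
Import Order.TTheory GRing.Theory Num.Theory.
Import numFieldNormedType.Exports.

Local Open Scope classical_set_scope.
Local Open Scope ring_scope.

(** * Moment inequalities *)

(** The weight [V] is spent in halves. If the m-th power of a function, m >= 2, is at most a
    multiple of [V], then so is the second moment of its product with the difference quotient, and
    the slope operator sends it below a multiple of [sqrt V]. Solving the Poisson equation in the
    [sqrt V] norm and applying the slope operator once more lands in [V], which all nearby invariant
    laws integrate with one bound. Hence the two norms in (A2). Exponents: the scores have moments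
    of order 2 kappa q / (q - 1), [G] of order 2 kappa q, so by Young's inequality [H] has order 2
    kappa > 2. A random number of summands costs a small exponent, paid by delta for [G] and by the
    excess of 2 kappa over 2 for [BC]. [omega], a supremum over a continuum of parameters, is not
    known to be measurable: bounds through it rest on monotonicity of the integral for arbitrary
    nonnegative functions, and measurable majorants are taken along sequences. The coupled pair, the
    estimator and the block live on three probability spaces, described by one-step conditional
    laws; they are compared through laws on path space. *)

Section powR_inequalities.
Context (R : realType).
Implicit Types (x y e a b m q : R).

(** Either [e * x^(b - a) >= 1], and the first term suffices, or [x] lies below the level
    [e^(-1/(b - a))] at which [e * x^b] equals [x^a]. *)
Lemma powR_le_young a b e x : 0 < a -> a < b -> 0 < e -> 0 <= x ->
  x `^ a <= e * x `^ b + e `^ (- (a / (b - a))).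
Proof.
move=> a0 ab e0 x0; have ba : 0 < b - a by rewrite subr_gt0.
have [h|h] := leP 1 (e * x `^ (b - a)).
  have -> : x `^ b = x `^ (b - a) * x `^ a.
    by rewrite -powRD ?subrK// (gt_eqF (lt_trans a0 ab)).
  rewrite mulrA -[leLHS]addr0 lerD ?powR_ge0//.
  by rewrite -[leLHS]mul1r ler_wpM2r ?powR_ge0.
rewrite -[leLHS]add0r lerD ?mulr_ge0 ?powR_ge0 ?(ltW e0)//.
rewrite -[in leLHS](mulfVK (lt0r_neq0 ba) a) mulrC powRrM.
have -> : e `^ (- (a / (b - a))) = (e^-1) `^ (a / (b - a)).
  by rewrite -(powR_inv1 (ltW e0)) -powRrM mulN1r.
rewrite ge0_ler_powR ?nnegrE ?powR_ge0 ?invr_ge0 ?(ltW e0)//.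
  by rewrite divr_ge0 ?ltW.
by rewrite -[leRHS]mulr1 mulrC ler_pdivlMr// mulrC ltW.
Qed.

Lemma powR_le1D a b x : 0 <= a -> a <= b -> 0 <= x -> x `^ a <= 1 + x `^ b.
Proof.
move=> a0 ab x0; have [x1|x1] := leP 1 x.
  by rewrite (le_trans (ler_powR x1 ab))// lerDr.
rewrite (@le_trans _ _ 1)// ?lerDl ?powR_ge0//.
have -> : 1 = 1 `^ a :> R by rewrite powR1.
rewrite ge0_ler_powR ?nnegrE//; exact: ltW.
Qed.

(* Convexity, applied to the combination of [x / (1 - q)] and [y / q] with
   weights [1 - q] and [q]. *)
Lemma powRD_weighted m q x y : 1 <= m -> 0 < q < 1 -> 0 <= x -> 0 <= y ->
  (x + y) `^ m <= (1 - q) `^ (1 - m) * x `^ m + q `^ (1 - m) * y `^ m.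
Proof.
move=> m1 /andP[q0 q1] x0 y0.
have q1' : 0 < 1 - q by rewrite subr_gt0.
have key u w : 0 < w -> 0 <= u -> w * (u / w) `^ m = w `^ (1 - m) * u `^ m.
  move=> w0 u0; rewrite powRM ?invr_ge0 ?(ltW w0)// -(powR_inv1 (ltW w0)).
  rewrite -powRrM mulN1r [RHS]mulrC mulrCA; congr (_ * _).
  by rewrite -{1}(powRr1 (ltW w0)) -powRD// (gt_eqF w0) implybT.
rewrite -!key//.
have q01 : 0 <= 1 - q <= 1 by rewrite ltW//= gerBl ltW.
have /andP[q01a q01b] := q01.
have := @convex_powR R m m1 (Itv01 q01a q01b) (x / (1 - q)) (y / q).
rewrite !inE /= !in_itv/= !andbT !divr_ge0 ?(ltW q0)// ?(ltW q1')//.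
move=> /(_ isT isT); rewrite convRE [X in X `^ _ <= _ -> _]convRE /= /unstable.onem subKr.
by rewrite mulrC mulfVK ?gt_eqF// [q * (y / q)]mulrC mulfVK ?gt_eqF.
Qed.

(** The constants do not involve [n], as the sums to come have a random number of terms. The price
    is weights growing like [(q^(1 - m))^i], which the geometric decay of the tails has to beat.
    Each step of the induction gives weight [1 - q] to the first term and [q] to the rest. *)
Lemma powR_sum_weighted m q n (u : nat -> R) : 1 <= m -> 0 < q < 1 ->
  (forall i, 0 <= u i) ->
  (\sum_(0 <= i < n) u i) `^ m <=
  \sum_(0 <= i < n) (1 - q) `^ (1 - m) * (q `^ (1 - m)) ^+ i * u i `^ m.
Proof.
move=> m1 q01 u0; elim: n u u0 => [|n IH] u u0.
  by rewrite !big_geq// powR0// gt_eqF// (lt_le_trans ltr01).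
rewrite big_nat_recl// big_nat_recl//= expr0 mulr1.
have s0 : 0 <= \sum_(0 <= i < n) u i.+1 by apply: sumr_ge0.
rewrite (le_trans (powRD_weighted m1 q01 (u0 0%N) s0))// lerD2l.
rewrite (le_trans (ler_wpM2l _ (IH (u \o succn) _)))// ?powR_ge0//.
  by move=> i; exact: u0.
rewrite mulr_sumr ler_sum// => i _ /=.
by rewrite exprS le_eqVlt; apply/orP; left; apply/eqP; ring.
Qed.

(* The rate [s] dominates [rho `^ ((b - a) / (2 * a))] and [rho `^ (1 / 2)],
   which is what Young's inequality leaves of a decay in [rho]; the weight [w]
   is at most [s `^ (- 1 / 2)], so that [w * s] is still a contraction. *)
Lemma young_rates a b rho : 1 <= a -> a < b -> 0 < rho < 1 ->
  exists c s w u : R,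
    [/\ 0 <= c, 0 < s < 1, 0 < u < 1, 0 < w /\ w * s <= u &
      (forall n (x : nat -> R), (forall i, 0 <= x i) ->
        (\sum_(0 <= i < n) x i) `^ a <=
        \sum_(0 <= i < n) c * w ^+ i * x i `^ a) /\
      (forall n, exists t : R, [/\ 0 <= t, t * rho ^+ n <= s ^+ n &
        forall x, 0 <= x -> x `^ a <= s ^+ n * x `^ b + t])].
Proof.
move=> a1 ab /andP[r0 r1]; have a0 : 0 < a by rewrite (lt_le_trans ltr01).
have b0 : 0 < b by rewrite (lt_trans a0).
have ba : 0 < b - a by rewrite subr_gt0.
pose th : R := (b - a) / (2 * a).
have th0 : 0 < th by rewrite divr_gt0// mulr_gt0.
pose s := Num.max (rho `^ th) (rho `^ 2^-1).
have powlt1 x t : 0 < x < 1 -> 0 < t -> 0 < x `^ t < 1.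
  move=> /andP[x0 x1] t0; rewrite powR_gt0//= /powR gt_eqF// -expR0 ltr_expR.
  by rewrite pmulr_rlt0// ln_lt0// x0.
have r01 : 0 < rho < 1 by rewrite r0.
have s0 : 0 < s by rewrite lt_max powR_gt0.
have s1 : s < 1.
  by rewrite gt_max (andP (powlt1 _ _ r01 th0)).2 (andP (powlt1 _ _ r01 _)).2.
(* With this exponent [q^(1 - a)] is [s^((1 - a) / (2 * a))], and its product with [s] is
   [s^(1/2 + 1/(2 * a))], below [u]. *)
pose q := s `^ (2 * a)^-1.
have q01 : 0 < q < 1 by apply: powlt1; rewrite ?s0// invr_gt0 mulr_gt0.
pose u := s `^ 2^-1.
have /andP[u0 u1] : 0 < u < 1 by apply: powlt1; rewrite ?s0.
have qu : q `^ (1 - a) * s <= u.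
  rewrite /q -{2}(powRr1 (ltW s0)) -powRrM -powRD; last first.
    by rewrite (gt_eqF s0) implybT.
  rewrite ger_powR ?s0 ?(ltW s1)//.
  have -> : (2 * a)^-1 * (1 - a) + 1 = 2^-1 + (2 * a)^-1.
    by field; rewrite gt_eqF.
  by rewrite lerDl invr_ge0 mulr_ge0// ltW.
exists ((1 - q) `^ (1 - a)), s, (q `^ (1 - a)), u; split.
- exact: powR_ge0.
- by rewrite s0.
- by rewrite u0.
- by split=> //; rewrite powR_gt0// (andP q01).1.
split=> [n x x0|n]; first exact: powR_sum_weighted.
(* Since [th * a / (b - a) = 1/2], the remainder in Young's inequality is [rho^(-n/2)]: half of the
   decay pays for it and half is left. *)
pose e := (rho `^ th) ^+ n.
have e0 : 0 < e by rewrite exprn_gt0// powR_gt0.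
exists (e `^ (- (a / (b - a)))); split.
- exact: powR_ge0.
- have -> : e = rho `^ (th * n%:R) by rewrite powRrM powR_mulrn ?powR_ge0.
  rewrite -powRrM -(powR_mulrn n (ltW r0)) -powRD; last first.
    by rewrite (gt_eqF r0) implybT.
  have -> : th * n%:R * - (a / (b - a)) + n%:R = 2^-1 * n%:R.
    by rewrite /th; field; rewrite !gt_eqF.
  rewrite powRrM powR_mulrn ?powR_ge0// lerXn2r ?nnegrE ?powR_ge0 ?(ltW s0)//.
  by rewrite le_max lexx orbT.
- move=> x x0; rewrite (le_trans (powR_le_young a0 ab e0 x0))// lerD2r.
  rewrite ler_wpM2r ?powR_ge0// lerXn2r ?nnegrE ?powR_ge0 ?(ltW s0)//.
  by rewrite le_max lexx.
Qed.

Lemma sqrtr_le x : 1 <= x -> Num.sqrt x <= x.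
Proof.
move=> x1; have x0 : 0 <= x by exact: le_trans x1.
rewrite -[leRHS]sqr_sqrtr// expr2 ler_peMr ?sqrtr_ge0//.
by rewrite -sqrtr1 ler_wsqrtr.
Qed.

End powR_inequalities.

Section measure_inequalities.
Local Open Scope ereal_scope.
Context d (T : measurableType d) (R : realType).
Implicit Types (mu : {measure set T -> \bar R}).

(* The integral of a nonnegative function is a supremum over the simple
   functions below it, hence monotone on all functions. *)
Lemma ge0_le_integral_nonmeas mu (f g : T -> \bar R) :
  (forall x, 0 <= f x) -> (forall x, f x <= g x) ->
  \int[mu]_x f x <= \int[mu]_x g x.
Proof.
move=> f0 fg; have g0 x : 0 <= g x by exact: le_trans (fg x).
rewrite !ge0_integralTE//; apply: le_ereal_sup => _ [h hf <-].
by exists h => // x; exact: le_trans (fg x).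
Qed.

(* Splitting [|f|] at the level [c] where [c `^ m] bounds the m-th moment. *)
Lemma powR_integral_le mu (f : T -> R) (m A : R) : mu setT <= 1 ->
  measurable_fun setT f -> (1 <= m)%R -> (0 < A)%R ->
  \int[mu]_x (`|f x| `^ m)%:E <= A%:E ->
  \int[mu]_x `|f x|%:E <= (2 * A `^ m^-1)%:E.
Proof.
move=> mu1 mf m1 A0 fA; set c := (A `^ m^-1)%R.
have m0 : (0 < m)%R by rewrite (lt_le_trans ltr01).
have c0 : (0 < c)%R by rewrite powR_gt0.
have mm : measurable_fun setT
    (EFin \o (fun x => (c `^ (1 - m) * `|f x| `^ m)%R)).
  apply/measurable_EFinP; apply: measurable_funM => //.
  apply: (measurableT_comp (measurable_powR m)).
  exact: measurableT_comp.
apply: (@le_trans _ _ (\int[mu]_x (c%:E + (c `^ (1 - m) * `|f x| `^ m)%:E))).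
  apply: ge0_le_integral_nonmeas => x; first by rewrite lee_fin.
  rewrite -EFinD lee_fin.
  have [fc|fc] := leP `|f x|%R c.
    by rewrite (le_trans fc)// lerDl mulr_ge0 ?powR_ge0.
  have f0 : (0 < `|f x|)%R by exact: lt_trans fc.
  rewrite -[leLHS]add0r lerD//; first exact: ltW.
  apply: (@le_trans _ _ (`|f x| `^ (1 - m) * `|f x| `^ m)%R).
    by rewrite -powRD ?subrK ?powRr1 ?oner_eq0// ltW.
  rewrite ler_wpM2r ?powR_ge0// -opprB !powRN lef_pV2 ?posrE ?powR_gt0//.
  by rewrite ge0_ler_powR ?nnegrE ?subr_ge0// ltW.
rewrite ge0_integralD//; last 2 first.
- by move=> x _; rewrite lee_fin ltW.
- by move=> x _; rewrite lee_fin mulr_ge0 ?powR_ge0.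
rewrite integral_cst// mulrDl mul1r EFinD leeD//.
  by rewrite -[leRHS]mule1 lee_pmul2l// lte_fin.
under eq_integral do rewrite EFinM.
rewrite ge0_integralZl_EFin ?powR_ge0//; last first.
  apply/measurable_EFinP; apply: (measurableT_comp (measurable_powR m)).
  exact: measurableT_comp.
rewrite (le_trans (lee_wpmul2l _ fA))//; first by rewrite lee_fin powR_ge0.
rewrite -EFinM lee_fin {1}/c -powRrM mulrBr mulr1 mulVf ?gt_eqF//.
by rewrite -{2}(powRr1 (ltW A0)) -powRD ?subrK ?(gt_eqF A0) ?implybT.
Qed.

(** [A i] stands for the event that the i-th term of a random sum is present; the number of terms
    that dominate [F] depends on the point. [C] and [s] depend on the exponents and on [rho] alone,
    so the bound is linear in [K]: with [K] a multiple of [V] it holds uniformly in the starting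
    state. The shift [j] carries the decay in the burn-in. *)
Lemma geometric_sum_moment (a b rho : R) :
  (1 <= a)%R -> (a < b)%R -> (0 < rho < 1)%R ->
  exists C s : R, [/\ (0 <= C)%R, (0 < s < 1)%R &
    forall mu (K : R) (j : nat) (D : nat -> T -> R) (A : nat -> set T)
      (F : T -> R),
    (0 <= K)%R ->
    (forall i, measurable_fun setT (D i)) -> (forall i x, 0 <= D i x)%R ->
    (forall i, measurable (A i)) ->
    (forall i, \int[mu]_x (D i x `^ b)%:E <= K%:E) ->
    (forall i, mu (A i) <= (K * rho ^+ (j + i))%:E) ->
    (forall x, 0 <= F x)%R ->
    (forall x, exists n, F x <= \sum_(0 <= i < n) D i x * \1_(A i) x)%R ->
    \int[mu]_x (F x `^ a)%:E <= (C * K * s ^+ j)%:E].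
Proof.
move=> a1 ab r01.
have [c [s [w [u [c0 s01 /andP[u0 u1] [w0 wsu] [sumle young]]]]]] :=
  young_rates a1 ab r01.
have /andP[s0 s1] := s01.
exists (2 * c * (1 - u)^-1)%R, s; split=> //.
  by rewrite !mulr_ge0// invr_ge0 subr_ge0 (ltW u1).
move=> mu K j D A F K0 mD D0 mA DK AK F0 FD.
have /choice[t tP] n := young (j + n)%N.
(* [B i] is linear in [D i x ^ b] and in the indicator of [A i], so that its integral is controlled
   by the two assumed bounds; off [A i] the i-th term of the sum vanishes. *)
pose B i x := (c * w ^+ i * (s ^+ (j + i) * D i x `^ b + t i * \1_(A i) x))%R.
have B0 i x : (0 <= B i x)%R.
  have [ti _ _] := tP i.
  by rewrite !mulr_ge0 ?exprn_ge0 ?(ltW w0) ?addr_ge0 ?mulr_ge0 ?powR_ge0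
    ?exprn_ge0 ?(ltW s0).
have mB1 i : measurable_fun setT (fun x => s ^+ (j + i) * D i x `^ b)%R.
  apply: measurable_funM => //.
  exact: (measurableT_comp (measurable_powR b)).
have mB2 i : measurable_fun setT (fun x => t i * \1_(A i) x)%R.
  by apply: measurable_funM => //; exact: measurable_indic.
have mB i : measurable_fun setT (B i).
  by apply: measurable_funM => //; exact: measurable_funD.
have FB x : (F x `^ a)%:E <= \sum_(i <oo) (B i x)%:E.
  have [n Fn] := FD x.
  apply: (@le_trans _ _ (\sum_(0 <= i < n) (B i x)%:E)); last first.
    by apply: nneseries_lim_ge => i _ _; rewrite lee_fin.
  rewrite sumEFin lee_fin.
  have D10 i : (0 <= D i x * \1_(A i) x)%R by rewrite mulr_ge0.
  apply: (@le_trans _ _ ((\sum_(0 <= i < n) D i x * \1_(A i) x)%R `^ a)%R).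
    by rewrite ge0_ler_powR ?nnegrE ?(le_trans ler01 a1)// sumr_ge0.
  apply: (le_trans (sumle _ _ D10)); apply: ler_sum => i _.
  have [ti0 _ tiy] := tP i.
  rewrite ler_wpM2l ?mulr_ge0 ?exprn_ge0 ?(ltW w0)//.
  rewrite indicE; case: (x \in A i); last first.
    rewrite !mulr0 powR0 ?addr0 ?gt_eqF ?(lt_le_trans ltr01 a1)//.
    by rewrite mulr_ge0 ?powR_ge0// exprn_ge0// ltW.
  by rewrite !mulr1 tiy.
apply: (@le_trans _ _ (\int[mu]_x \sum_(i <oo) (B i x)%:E)).
  by apply: ge0_le_integral_nonmeas => // x; rewrite lee_fin powR_ge0.
rewrite integral_nneseries//; last 2 first.
- by move=> i; exact/measurable_EFinP.
- by move=> i x _; rewrite lee_fin.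
apply: (@le_trans _ _ (\sum_(i <oo) (2 * c * K * s ^+ j * u ^+ i)%:E)).
  apply: lee_nneseries => i _ /=; first by move=> _; apply: integral_ge0 => x _; rewrite lee_fin.
  have [ti0 tr _] := tP i.
  rewrite (eq_integral (fun x => (c * w ^+ i)%:E * ((s ^+ (j + i))%:E *
      (D i x `^ b)%:E + (t i)%:E * (\1_(A i) x)%:E))); last first.
    by move=> x _ /=; rewrite -!EFinM.
  have D0i x : 0%R <= (D i x `^ b)%:E by rewrite lee_fin powR_ge0.
  have mDi : measurable_fun setT (EFin \o (fun x => D i x `^ b)%R).
    by apply/measurable_EFinP; exact: (measurableT_comp (measurable_powR b)).
  have mAi : measurable_fun setT (EFin \o (\1_(A i) : T -> R)).
    by apply/measurable_EFinP; exact: measurable_indic.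
  rewrite ge0_integralZl_EFin//; last 3 first.
  - by move=> x _; apply: adde_ge0; apply: mule_ge0 => //;
      rewrite lee_fin ?exprn_ge0 ?(ltW s0).
  - by apply: emeasurable_funD; exact: measurable_funeM.
  - by rewrite mulr_ge0// exprn_ge0// ltW.
  rewrite ge0_integralD//; last 4 first.
  - by move=> x _; apply: mule_ge0 => //; rewrite lee_fin exprn_ge0 ?(ltW s0).
  - exact: measurable_funeM.
  - by move=> x _; rewrite mule_ge0// lee_fin.
  - exact: measurable_funeM.
  rewrite ge0_integralZl_EFin//; last by rewrite exprn_ge0 ?ltW.
  rewrite ge0_integralZl_EFin// integral_indic// setIT.
  (* The moment of [D i] and the probability of [A i], multiplied by [t i], each contribute at most
     [K * s ^+ (j + i)]; the weight [w ^+ i] then leaves the ratio [w * s <= u < 1]. *)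
  apply: (@le_trans _ _ ((c * w ^+ i)%:E * (2 * K * s ^+ (j + i))%:E)).
    rewrite lee_wpmul2l ?lee_fin ?mulr_ge0 ?exprn_ge0 ?(ltW w0)//.
    have -> : (2 * K * s ^+ (j + i) = s ^+ (j + i) * K + K * s ^+ (j + i))%R by ring.
    rewrite EFinD leeD//.
      by rewrite EFinM lee_wpmul2l// lee_fin exprn_ge0 ?(ltW s0).
    rewrite (le_trans (lee_wpmul2l _ (AK i))) ?lee_fin//.
    by rewrite mulrCA ler_wpM2l.
  rewrite -EFinM lee_fin exprD.
  have -> : (c * w ^+ i * (2 * K * (s ^+ j * s ^+ i)) =
      2 * c * K * s ^+ j * (w * s) ^+ i)%R by rewrite exprMn; ring.
  rewrite ler_wpM2l ?mulr_ge0 ?exprn_ge0 ?(ltW s0)//.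
  by rewrite lerXn2r ?nnegrE ?mulr_ge0 ?(ltW u0) ?(ltW w0) ?(ltW s0).
have cKs0 : (0 <= 2 * c * K * s ^+ j)%R.
  by rewrite !mulr_ge0// exprn_ge0// ltW.
apply: lime_le.
  by apply: is_cvg_nneseries => i _ _; rewrite lee_fin mulr_ge0// exprn_ge0 ?ltW.
apply: nearW => n; rewrite sumEFin lee_fin.
have u1' : (`|u| < 1)%R by rewrite gtr0_norm.
rewrite (le_trans (geometric_le_lim n cKs0 u0 u1'))//.
by rewrite le_eqVlt; apply/orP; left; apply/eqP; ring.
Qed.

End measure_inequalities.

(** * Conditional laws and laws of paths *)

Lemma sigma_algebra_setT T (G : set (set T)) : sigma_algebra setT G -> G setT.
Proof. by case=> G0 /(_ _ G0); rewrite setD0. Qed.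

Lemma generated_sub_measurable d (T : measurableType d) (G : set (set T)) :
  G `<=` measurable -> <<s G >> `<=` measurable.
Proof. by apply: smallest_sub; exact: sigma_algebra_measurable. Qed.

Section kernel_constructions.
Local Open Scope ereal_scope.
Context d1 d2 d3 (S1 : measurableType d1) (S2 : measurableType d2)
  (S3 : measurableType d3) (R : realType).

Section precomposition.
Variables (Q : R.-pker S2 ~> S3) (U : S1 -> S2).

Definition kernel_pre (mU : measurable_fun setT U) (x : S1) :
  {measure set S3 -> \bar R} := Q (U x).

Hypothesis mU : measurable_fun setT U.

Let measurable_kernel_pre B : measurable B ->
  measurable_fun setT (kernel_pre mU ^~ B).
Proof. by move=> mB; exact: (measurableT_comp (measurable_kernel Q _ mB)). Qed.

HB.instance Definition _ := isKernel.Build _ _ _ _ _ (kernel_pre mU)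
  measurable_kernel_pre.

Let kernel_pre_prob x : kernel_pre mU x setT = 1.
Proof. exact: prob_kernel. Qed.

HB.instance Definition _ := Kernel_isProbability.Build _ _ _ _ _
  (kernel_pre mU) kernel_pre_prob.

End precomposition.

Section law.
Variables (Q : R.-pker S1 ~> S2) (Z : S2 -> S3).

Definition kernel_law (mZ : measurable_fun setT Z) (x : S1) :
  {measure set S3 -> \bar R} :=
  measure_function_pushforward__canonical__measure_function_Measure (Q x) mZ.

Hypothesis mZ : measurable_fun setT Z.

Let measurable_kernel_law B : measurable B ->
  measurable_fun setT (kernel_law mZ ^~ B).
Proof.
move=> mB; apply: (measurable_kernel Q).
by rewrite -[X in measurable X]setTI; exact: mZ.
Qed.

HB.instance Definition _ := isKernel.Build _ _ _ _ _ (kernel_law mZ)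
  measurable_kernel_law.

Let kernel_law_prob x : kernel_law mZ x setT = 1.
Proof.
by rewrite /kernel_law/= /pushforward preimage_setT prob_kernel.
Qed.

HB.instance Definition _ := Kernel_isProbability.Build _ _ _ _ _
  (kernel_law mZ) kernel_law_prob.

End law.

Section graph.
Variables (Q : R.-pker S1 ~> S3) (g : S1 -> S2).

Lemma measurable_graph_pair (x : S2) : measurable_fun setT (fun y : S3 => (x, y)).
Proof. exact: measurable_fun_pair. Qed.

(** The law of the pair [(g x, y)] with [y] drawn from [Q x]. The idle factor [unit] is the source
    of [kernel_cst], so that composing the two gives the joint law of a variable and of a draw
    depending on it. *)
Definition kernel_graph (mg : measurable_fun setT g) (ux : unit * S1) :
    {measure set (S2 * S3) -> \bar R} :=
  measure_function_pushforward__canonical__measure_function_Measure (Q ux.2)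
    (measurable_graph_pair (g ux.2)).

Hypothesis mg : measurable_fun setT g.

Let measurable_kernel_graph B : measurable B ->
  measurable_fun setT (kernel_graph mg ^~ B).
Proof.
move=> mB; apply: (@measurableT_comp _ _ _ _ _ _
  (fun x => Q x ((fun y => (g x, y)) @^-1` B))) => //.
have -> : (fun x => Q x ((fun y => (g x, y)) @^-1` B)) =
    (fun x => \int[Q x]_y (\1_B (g x, y))%:E).
  apply/funext => x; rewrite -[RHS]/(\int[Q x]_y
    (\1_((fun y => (g x, y)) @^-1` B) y)%:E) integral_indic ?setIT//.
  by rewrite -[X in measurable X]setTI; exact: measurable_graph_pair.
apply: (@measurable_kfcomp _ _ _ _ _ Q (fun xy => (\1_B (g xy.1, xy.2))%:E)).
  apply/measurable_EFinP; apply: (measurableT_comp (measurable_indic mB)).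
  by apply: measurable_fun_pair => //; exact: measurableT_comp.
by move=> xy; rewrite lee_fin.
Qed.

HB.instance Definition _ := isKernel.Build _ _ _ _ _ (kernel_graph mg)
  measurable_kernel_graph.

Let kernel_graph_prob x : kernel_graph mg x setT = 1.
Proof. by rewrite /kernel_graph/= /pushforward preimage_setT prob_kernel. Qed.

HB.instance Definition _ := Kernel_isProbability.Build _ _ _ _ _
  (kernel_graph mg) kernel_graph_prob.

End graph.

Section constant.
Variable mu : {measure set S1 -> \bar R}.

Definition kernel_cst (mu1 : mu setT = 1) (_ : unit) :
  {measure set S1 -> \bar R} := mu.

Hypothesis mu1 : mu setT = 1.

Let measurable_kernel_cst B : measurable B ->
  measurable_fun setT (kernel_cst mu1 ^~ B).
Proof. by []. Qed.

HB.instance Definition _ := isKernel.Build _ _ _ _ _ (kernel_cst mu1)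
  measurable_kernel_cst.

HB.instance Definition _ := Kernel_isProbability.Build _ _ _ _ _
  (kernel_cst mu1) (fun=> mu1).

End constant.

End kernel_constructions.

Section disintegration.
Local Open Scope ereal_scope.
Context dI dY dZ dS (I : measurableType dI) (Y : measurableType dY)
  (Z : measurableType dZ) (S : measurableType dS) (R : realType).
Variables (mI : {measure set I -> \bar R}) (K : I -> {measure set Y -> \bar R})
  (mZ : {measure set Z -> \bar R}) (h : Z -> S) (g : I -> Y -> S).
Hypothesis dis : forall F : S -> \bar R, measurable_fun setT F ->
  (forall x, 0 <= F x) ->
  measurable_fun setT (fun i => \int[K i]_y F (g i y)) /\
  \int[mZ]_z F (h z) = \int[mI]_i \int[K i]_y F (g i y).

(** The nonnegative case, applied to the positive and negative parts. The decomposition is left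
    abstract because it is used for conditional laws, for iterated kernels and for invariant
    laws. *)
Lemma integral_disintegration (F : S -> R) : measurable_fun setT F ->
  mZ.-integrable setT (fun z => (F (h z))%:E) ->
  (forall i, (K i).-integrable setT (fun y => (F (g i y))%:E)) ->
  mI.-integrable setT (fun i => \int[K i]_y (F (g i y))%:E) /\
  \int[mZ]_z (F (h z))%:E = \int[mI]_i \int[K i]_y (F (g i y))%:E.
Proof.
move=> mF intF intFK.
pose p x := (F^\+%R x)%:E; pose n x := (F^\-%R x)%:E.
have mp : measurable_fun setT p by exact/measurable_EFinP/measurable_funrpos.
have mn : measurable_fun setT n by exact/measurable_EFinP/measurable_funrneg.
have p0 x : 0 <= p x by rewrite lee_fin funrpos_ge0.
have n0 x : 0 <= n x by rewrite lee_fin funrneg_ge0.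
have split_int d (X : measurableType d) (mu : {measure set X -> \bar R})
    (k : X -> S) :
    \int[mu]_x (F (k x))%:E = \int[mu]_x p (k x) - \int[mu]_x n (k x).
  rewrite integralE; congr (_ - _); apply: eq_integral => x _.
    by rewrite funeposE /p /funrpos EFin_max.
  by rewrite funenegE /n /funrneg EFin_max.
have fin_pn d (X : measurableType d) (mu : {measure set X -> \bar R})
    (k : X -> S) : mu.-integrable setT (fun x => (F (k x))%:E) ->
    \int[mu]_x p (k x) \is a fin_num /\ \int[mu]_x n (k x) \is a fin_num.
  move=> intFk; split.
    rewrite (eq_integral ((fun x => (F (k x))%:E)^\+)) ?integrable_pos_fin_num//.
    by move=> x _; rewrite funeposE /p /funrpos EFin_max.
  rewrite (eq_integral ((fun x => (F (k x))%:E)^\-)) ?integrable_neg_fin_num//.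
  by move=> x _; rewrite funenegE /n /funrneg EFin_max.
have [fin_p fin_n] := fin_pn _ _ _ _ intF.
have [[mIp ep] [mIn en]] := (dis mp p0, dis mn n0).
have -> : (fun i => \int[K i]_y (F (g i y))%:E) =
    (fun i => \int[K i]_y p (g i y) - \int[K i]_y n (g i y)).
  by apply/funext => i; rewrite split_int.
rewrite (split_int _ _ mZ h) ep en.
rewrite ep in fin_p; rewrite en in fin_n.
have inth (k : S -> \bar R) : (forall x, 0 <= k x) ->
    measurable_fun setT (fun i => \int[K i]_y k (g i y)) ->
    \int[mI]_i \int[K i]_y k (g i y) \is a fin_num ->
    mI.-integrable setT (fun i => \int[K i]_y k (g i y)).
  move=> k0 mk fk; apply/integrableP; split=> //.
  under eq_integral do rewrite gee0_abs ?integral_ge0//.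
  by rewrite ltey_eq fk.
split; last by rewrite -(integralB measurableT (inth p p0 mIp fin_p) (inth n n0 mIn fin_n)).
exact: (integrableB _ (inth p p0 mIp fin_p) (inth n n0 mIn fin_n)).
Qed.

End disintegration.

Section conditional_laws.
Local Open Scope ereal_scope.
Context dO dM d1 d2 (O : measurableType dO) (M : measurableType dM)
  (S1 : measurableType d1) (S2 : measurableType d2) (R : realType)
  (Pr : {measure set O -> \bar R}) (G : set (set O)).
Hypotheses (Pr1 : Pr setT = 1) (Gm : G `<=` measurable).
Variables (U : O -> S1) (Q : R.-pker S1 ~> S2) (Z : O -> S2) (zeta : O -> M).
Hypotheses (mU : measurable_fun setT U) (mZ : measurable_fun setT Z).
Hypothesis Gzeta : forall A, measurable A -> G (zeta @^-1` A).
Hypothesis QZ : cond_law Pr G U Q Z.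

Let mzeta : measurable_fun setT zeta.
Proof. by move=> _ A mA; rewrite setTI; apply/Gm/Gzeta. Qed.

Let mzetaZ : measurable_fun setT (fun w => (zeta w, Z w)).
Proof. exact: measurable_fun_pair. Qed.

(** [zeta], which is measurable for [G], is frozen while [Z] is integrated. The law of [(zeta, Z)]
    and the mixture of kernels agree on rectangles by [QZ], and rectangles form a generating
    pi-system. *)
Lemma cond_law_integral_ge0 (F : M * S2 -> \bar R) :
  measurable_fun setT F -> (forall x, 0 <= F x) ->
  \int[Pr]_w F (zeta w, Z w) = \int[Pr]_w \int[Q (U w)]_y F (zeta w, y).
Proof.
move=> mF F0.
pose k := kernel_graph (kernel_pre Q mU) mzeta.
pose l := kernel_cst Pr1.
have eqm E : measurable E ->
    measure_function_pushforward__canonical__measure_function_Measure Pr mzetaZ E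
    = mkcomp l k tt E.
  apply: (@measure_unique _ _ _ [set A `*` B | A in measurable & B in measurable]
    (fun=> setT)).
  - by rewrite measurable_prod_measurableType.
  - move=> _ _ [A mA [B mB <-]] [A' mA' [B' mB' <-]].
    exists (A `&` A'); first exact: measurableI.
    exists (B `&` B'); first exact: measurableI.
    by rewrite setXI.
  - move=> _; exists setT => //; exists setT => //; exact: setXTT.
  - by apply/seteqP; split => // x _; exists 0%N.
  - move=> _ [A mA [B mB <-]] /=; rewrite /pushforward /kcomp/=.
    rewrite -[X in Pr X]/(zeta @^-1` A `&` Z @^-1` B) QZ//; last exact: Gzeta.
    rewrite [LHS]integral_mkcond; apply: eq_integral => w _.
    rewrite /pushforward patchE /kernel_pre/=.
    case: ifPn => [/set_mem Aw|/negP Aw].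
      by congr (Q _ _); apply/seteqP; split=> // y [].
    rewrite (_ : _ @^-1` _ = set0) ?measure0//.
    by apply/seteqP; split=> // y [/= Aw' _]; apply: Aw; rewrite inE.
  - by move=> _; rewrite /= /pushforward preimage_setT Pr1 ltry.
rewrite -[LHS](@ge0_integral_pushforward _ _ _ _ _ _ mzetaZ Pr setT F)//.
rewrite (@eq_measure_integral _ _ _ _ (mkcomp l k tt)); last first.
  by move=> E mE _; exact: eqm.
rewrite integral_kcomp//; apply: eq_integral => w _ /=.
by rewrite ge0_integral_pushforward//; exact: measurable_graph_pair.
Qed.

Lemma cond_law_integral (F : M * S2 -> R) :
  measurable_fun setT F ->
  Pr.-integrable setT (fun w => (F (zeta w, Z w))%:E) ->
  (forall w, (Q (U w)).-integrable setT (fun y => (F (zeta w, y))%:E)) ->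
  Pr.-integrable setT (fun w => \int[Q (U w)]_y (F (zeta w, y))%:E) /\
  \int[Pr]_w (F (zeta w, Z w))%:E =
  \int[Pr]_w \int[Q (U w)]_y (F (zeta w, y))%:E.
Proof.
move=> mF; apply: (integral_disintegration
  (h := fun w => (zeta w, Z w)) (g := fun w y => (zeta w, y))) => // k mk k0.
split; last exact: cond_law_integral_ge0.
apply: (@measurable_kfcomp _ _ _ _ _ (kernel_pre Q mU)
  (fun xy => k (zeta xy.1, xy.2))) => //.
apply: (measurableT_comp mk); apply: measurable_fun_pair => //.
exact: measurableT_comp.
Qed.

End conditional_laws.

Section restricted_conditional_laws.
Local Open Scope ereal_scope.
Context dO d1 d2 (O : measurableType dO)
  (S1 : measurableType d1) (S2 : measurableType d2) (R : realType)
  (Pr : {measure set O -> \bar R}) (G : set (set O)).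
Hypotheses (Pr1 : Pr setT = 1) (sG : sigma_algebra setT G)
  (Gm : G `<=` measurable).
Variables (U : O -> S1) (Q : R.-pker S1 ~> S2) (Z : O -> S2).
Hypotheses (mU : measurable_fun setT U) (mZ : measurable_fun setT Z).
Hypothesis QZ : cond_law Pr G U Q Z.

(** Freezing with [zeta] the identity of [O], its target carrying the sigma-algebra [G]: the
    indicator of [A] is then a measurable function of [zeta]. *)
Lemma cond_law_integral_set (A : set O) (F : S2 -> \bar R) :
  G A -> measurable_fun setT F -> (forall y, 0 <= F y) ->
  \int[Pr]_(w in A) F (Z w) = \int[Pr]_(w in A) \int[Q (U w)]_y F y.
Proof.
move=> GA mF F0.
have mA : G.-sigma.-measurable A by rewrite measurable_g_measurableTypeE.
pose H (wy : g_sigma_algebraType G * S2) := (\1_A wy.1)%:E * F wy.2.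
have mH : measurable_fun setT H.
  apply: emeasurable_funM; last exact: measurableT_comp.
  apply/measurable_EFinP.
  exact: (measurableT_comp (measurable_indic mA) measurable_fst).
have H0 wy : 0 <= H wy by rewrite mule_ge0.
have GK B : G.-sigma.-measurable B -> G (id @^-1` B).
  by rewrite measurable_g_measurableTypeE.
have := @cond_law_integral_ge0 _ _ _ _ _ (g_sigma_algebraType G) _ _ _ Pr G Pr1
  Gm U Q Z id mU mZ GK QZ H mH H0.
rewrite /H/= => E.
rewrite [LHS]integral_mkcond [RHS]integral_mkcond.
transitivity (\int[Pr]_w ((\1_A w)%:E * F (Z w))).
  by apply: eq_integral => w _; rewrite patchE indicE; case: ifPn => _;
    rewrite ?mul1e ?mul0e.
rewrite E; apply: eq_integral => w _; rewrite patchE indicE.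
by case: ifPn => _; under eq_integral do rewrite ?mul1e ?mul0e; rewrite ?integral0.
Qed.

End restricted_conditional_laws.

Section kernel_mixtures.
Local Open Scope ereal_scope.
Context d1 d2 (S1 : measurableType d1) (S2 : measurableType d2) (R : realType)
  (mu : {measure set S1 -> \bar R}) (A : set S1) (k : R.-ker S1 ~> S2).

Definition kernel_mixture (mA : measurable A) (B : set S2) : \bar R :=
  \int[mu]_(x in A) k x B.

Hypothesis mA : measurable A.

Let mixture0 : kernel_mixture mA set0 = 0.
Proof. by apply: integral0_eq => x _; rewrite measure0. Qed.

Let mixture_ge0 B : 0 <= kernel_mixture mA B.
Proof. exact: integral_ge0. Qed.

Let mixture_sigma_additive : semi_sigma_additive (kernel_mixture mA).
Proof.
move=> B mB tB mUB; rewrite [X in _ --> X](_ : _ =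
  \int[mu]_(x in A) (\sum_(n <oo) k x (B n))); last first.
  apply: eq_integral => x _.
  by apply/esym/cvg_lim => //; exact/measure_semi_sigma_additive.
apply/cvg_closeP; split.
  by apply: is_cvg_nneseries => n _ _; exact: integral_ge0.
rewrite closeE// integral_nneseries// => n.
exact/measurable_funTS/measurable_kernel.
Qed.

HB.instance Definition _ := isMeasure.Build _ _ R
  (kernel_mixture mA) mixture0 mixture_ge0 mixture_sigma_additive.

End kernel_mixtures.

Section path_spaces.
Local Open Scope ereal_scope.
Context d (S : measurableType d).

(** Finite-dimensional rectangles: a generating family closed under intersection, on which two laws
    of paths can be compared. *)
Definition cylinders : set (set (nat -> S)) :=
  [set C | exists n (B : nat -> set S), (forall i, measurable (B i)) /\
     C = [set w | forall i, (i < n)%N -> B i (w i)]].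

Definition path_space := g_sigma_algebraType cylinders.
HB.instance Definition _ := Measurable.on path_space.

Lemma measurable_path_coord (n : nat) :
  measurable_fun setT (fun w : path_space => w n).
Proof.
move=> _ B mB; rewrite setTI; apply: sub_sigma_algebra.
exists n.+1, (fun i => if i == n then B else setT); split.
  by move=> i; case: ifP.
apply/seteqP; split=> [w /= Bw i _|w /= /(_ n (ltnSn n))]; last by rewrite eqxx.
by case: ifPn => // /eqP ->.
Qed.

Lemma measurable_path dO (O : measurableType dO) (W : nat -> O -> S) :
  (forall n, measurable_fun setT (W n)) ->
  measurable_fun setT (fun w => W ^~ w : path_space).
Proof.
move=> mW; apply: (@measurability _ _ O (path_space) setT _ cylinders) => //.
move=> _ [_ [n [B [mB ->]]] <-].
rewrite setTI (_ : _ @^-1` _ = \bigcap_(i in `I_n) W i @^-1` B i); last first.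
  by apply/seteqP; split=> w /= h i /=; exact: h.
apply: bigcap_measurableType => // i _; rewrite -[X in measurable X]setTI.
exact: mW.
Qed.

End path_spaces.
Arguments path_space {d} S.
Arguments cylinders {d} S.

(** * Markov chains in a filtration and the laws of their paths *)

Section adapted_chains.
Local Open Scope ereal_scope.
Context d (S : measurableType d) (R : realType).
Implicit Types (Q : R.-pker S ~> S).

(** The filtration may be larger than the chain's own and no initial law is fixed: the lagged copies
    and the auxiliary pairs are Markov given histories that contain other processes. *)
Definition adapted_chain dO (O : measurableType dO)
    (Pr : {measure set O -> \bar R}) (Gs : nat -> set (set O)) Q
    (W : nat -> O -> S) : Prop :=
  [/\ Pr setT = 1,
      forall n, sigma_algebra setT (Gs n) /\ Gs n `<=` measurable,
      forall n, Gs n `<=` Gs n.+1,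
      forall n B, measurable B -> Gs n (W n @^-1` B) &
      forall n, cond_law Pr (Gs n) (W n) Q (W n.+1)].

(** The backward recursion for the mean of [1_(B 0)(W 0) ... 1_(B (n - 1))(W (n - 1)) F(W n)] under
    the chain started at a given state. *)
Fixpoint cylinder_iter Q (B : nat -> set S) (n : nat) (F : S -> \bar R) :
    S -> \bar R :=
  if n is m.+1 then
    cylinder_iter Q B m (fun x => (\1_(B m) x)%:E * \int[Q x]_y F y)
  else F.

Lemma measurable_cylinder_iter Q B n F : (forall i, measurable (B i)) ->
  measurable_fun setT F -> (forall x, 0 <= F x) ->
  measurable_fun setT (cylinder_iter Q B n F) /\
  forall x, 0 <= cylinder_iter Q B n F x.
Proof.
move=> mB; elim: n F => //= n IH F mF F0; apply: IH.
  apply: emeasurable_funM.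
    by apply/measurable_EFinP; exact: measurable_indic.
  exact: (measurable_fun_integral_kernel (measurable_kernel Q)).
by move=> y; rewrite mule_ge0 ?integral_ge0.
Qed.

Section one_chain.
Context dO (O : measurableType dO) (Pr : {measure set O -> \bar R})
  (Gs : nat -> set (set O)) Q (W : nat -> O -> S).
Hypothesis WP : adapted_chain Pr Gs Q W.

Lemma adapted_chain_measurable n : measurable_fun setT (W n).
Proof.
by case: WP => _ sG _ WG _ _ B mB; rewrite setTI; apply/(sG n).2/WG.
Qed.

Lemma adapted_chain_setT : Gs 0%N setT.
Proof.
case: WP => _ sG _ _ _; have [G0 GC _] := (sG 0%N).1.
by have := GC _ G0; rewrite setD0.
Qed.

Lemma adapted_chain_filtration m n : (m <= n)%N -> Gs m `<=` Gs n.
Proof.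
case: WP => _ _ GS _ _; elim: n => [|n IH]; first by rewrite leqn0 => /eqP ->.
by rewrite leq_eqVlt => /predU1P[->//|/IH]; move/subset_trans; apply.
Qed.

Lemma adapted_chain_step n A (F : S -> \bar R) :
  Gs n A -> measurable_fun setT F -> (forall y, 0 <= F y) ->
  \int[Pr]_(w in A) F (W n.+1 w) = \int[Pr]_(w in A) \int[Q (W n w)]_y F y.
Proof.
case: (WP) => Pr1 sG _ _ QW GA mF F0.
have [sGn Gnm] := sG n.
apply: (cond_law_integral_set Pr1 sGn Gnm _ _ (QW n)) => //;
  exact: adapted_chain_measurable.
Qed.

(** Induction on the length, conditioning at the last step: the constraint on the coordinates up to
    [n] is an event of [Gs n]. *)
Lemma adapted_chain_cylinder (B : nat -> set S) n A (F : S -> \bar R) :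
  (forall i, measurable (B i)) -> Gs 0%N A ->
  measurable_fun setT F -> (forall y, 0 <= F y) ->
  \int[Pr]_(w in A `&` [set w | forall i, (i < n)%N -> B i (W i w)]) F (W n w) =
  \int[Pr]_(w in A) cylinder_iter Q B n F (W 0%N w).
Proof.
case: (WP) => Pr1 sG GS WG _ mB GA; elim: n F => [|n IH] F mF F0.
  by rewrite (_ : A `&` _ = A)//; apply/seteqP; split=> // w [].
have mQF : measurable_fun setT (fun x => \int[Q x]_y F y).
  by apply: (measurable_fun_integral_kernel (measurable_kernel Q)).
rewrite /= -IH; last 2 first.
- apply: emeasurable_funM => //.
  by apply/measurable_EFinP; exact: measurable_indic.
- by move=> y; rewrite mule_ge0 ?integral_ge0.
have GC : Gs n (A `&` [set w | forall i, (i < n.+1)%N -> B i (W i w)]).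
  pose On := g_sigma_algebraType (Gs n).
  have GE : (Gs n).-sigma.-measurable = Gs n.
    exact: measurable_g_measurableTypeE (sG n).1.
  rewrite -GE; apply: (@measurableI _ On).
    by rewrite GE; exact: (adapted_chain_filtration (leq0n n)).
  rewrite (_ : [set _ | _] = \bigcap_(i in `I_n.+1) W i @^-1` B i).
    apply: (@bigcap_measurableType _ On) => i /= ni.
    by rewrite GE; apply: (adapted_chain_filtration (m := i)) => //; exact: WG.
  by apply/seteqP; split=> w /= h i /=; exact: h.
rewrite adapted_chain_step//.
rewrite [LHS]integral_mkcond [RHS]integral_mkcond.
apply: eq_integral => w _; rewrite !patchE indicE.
case: ifPn => [/set_mem[Aw Bw]|Bw]; case: ifPn => [/set_mem[Aw' Bw']|Bw'] //.
- by rewrite mem_set ?mul1e//; exact: Bw.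
- case/negP: Bw'; apply/mem_set; split => // i ni; apply: Bw.
  exact: ltnW.
- rewrite memNset ?mul0e// => Bn; case/negP: Bw; apply/mem_set; split => // i.
  by rewrite ltnS leq_eqVlt => /predU1P[->//|]; exact: Bw'.
Qed.

End one_chain.

Lemma adapted_chain_shift dO (O : measurableType dO)
    (Pr : {measure set O -> \bar R}) Gs Q (W : nat -> O -> S) k :
  adapted_chain Pr Gs Q W ->
  adapted_chain Pr (fun n => Gs (k + n)%N) Q (fun n => W (k + n)%N).
Proof.
move=> [Pr1 sG GS WG QW]; split.
- exact: Pr1.
- by move=> n; exact: sG.
- by move=> n; rewrite addnS; exact: GS.
- by move=> n; exact: WG.
- by move=> n; rewrite addnS; exact: QW.
Qed.

Lemma markov_chain_adapted dO (O : measurableType dO)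
    (Pr : {measure set O -> \bar R}) Q mu (W : nat -> O -> S) :
  Pr setT = 1 -> markov_chain Pr Q mu W ->
  adapted_chain Pr (fun n => sigma_fam `I_n.+1 W) Q W.
Proof.
move=> Pr1 [mW _ QW]; split=> // n.
- split; first exact: smallest_sigma_algebra.
  apply: generated_sub_measurable.
  by move=> _ [i _ [B mB <-]]; exact: mW.
- apply: sub_sigma_algebra2 => _ [i /= ni [B mB <-]]; exists i; last by exists B.
  exact: ltnW.
- move=> B mB; apply: sub_sigma_algebra; exists n => /=; first exact: ltnSn.
  by exists B => //; rewrite setTI.
Qed.

Lemma fresh_run_adapted dO (O : measurableType dO)
    (Pr : {measure set O -> \bar R}) Q (G : set (set O)) (U : O -> S)
    (W : nat -> O -> S) :
  Pr setT = 1 -> G `<=` measurable -> fresh_run Pr Q G U W ->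
  adapted_chain Pr (fun n => <<s G `|` sigma_fam `I_n.+1 W >>) Q W.
Proof.
move=> Pr1 Gm [mW _ QW].
have sfm n : sigma_fam `I_n W `<=` measurable.
  apply: generated_sub_measurable.
  by move=> _ [i _ [B mB <-]]; exact: mW.
split=> // n.
- split; first exact: smallest_sigma_algebra.
  apply: generated_sub_measurable.
  by rewrite subUset; split.
- apply: sub_sigma_algebra2; apply: setUS; apply: sub_sigma_algebra2.
  move=> _ [i /= ni [B mB <-]]; exists i; last by exists B.
  exact: ltnW.
- move=> B mB; apply: sub_sigma_algebra; right; apply: sub_sigma_algebra.
  by exists n => /=; [exact: ltnSn|exists B => //; rewrite setTI].
Qed.

Section law_of_the_path.
Context dO (O : measurableType dO) (Pr : {measure set O -> \bar R})
  (Gs : nat -> set (set O)) Q (W : nat -> O -> S).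
Context dC (OC : measurableType dC) (C : R.-pker S ~> OC) (WC : nat -> OC -> S).
Hypothesis WP : adapted_chain Pr Gs Q W.
Hypothesis CP : forall s, markov_chain (C s) Q \d_s WC.
Hypothesis mWC : measurable_fun setT (fun w => WC ^~ w : path_space S).

(** Transfers a chain from its own probability space to the reference space [OC]: on cylinders both
    measures reduce to [cylinder_iter], which knows the kernel only. *)
Lemma adapted_chain_law :
  cond_law Pr (Gs 0%N) (W 0%N) (kernel_law C mWC)
    (fun w => W ^~ w : path_space S).
Proof.
case: (WP) => Pr1 sG _ _ _ A B GA mB.
have mA : measurable A by apply: (sG 0%N).2.
have mW := adapted_chain_measurable WP.
pose k := kernel_pre (kernel_law C mWC) (mW 0%N).
rewrite setIC -[LHS]/(pushforward (mrestr Pr mA) (fun w => W ^~ w : path_space S) B).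
rewrite -[RHS]/(kernel_mixture Pr k mA B).
have C1 s : C s setT = 1 by exact: prob_kernel.
have mcyl n (D : nat -> set S) : (forall i, measurable (D i)) ->
    measurable ([set w | forall i, (i < n)%N -> D i (w i)] : set (path_space S)).
  by move=> mD; apply: sub_sigma_algebra; exists n, D.
have cylE n (D : nat -> set S) : (forall i, measurable (D i)) ->
    pushforward (mrestr Pr mA) (fun w => W ^~ w : path_space S)
      [set w | forall i, (i < n)%N -> D i (w i)] =
    kernel_mixture Pr k mA [set w | forall i, (i < n)%N -> D i (w i)].
  move=> mD; rewrite /pushforward /mrestr setIC.
  transitivity (\int[Pr]_(w in A `&`
    [set w | forall i, (i < n)%N -> D i (W i w)]) (cst 1 (W n w))).
    rewrite integral_cst ?mul1e//.
    apply: measurableI => //.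
    have := measurable_path mW measurableT (mcyl n _ mD).
    by rewrite setTI.
  have [mr r0] := measurable_cylinder_iter Q n mD
    (@measurable_cst _ _ _ _ setT 1) (fun=> lee01).
  rewrite (adapted_chain_cylinder WP n (F := cst 1) mD GA)//.
  apply: eq_integral => w _.
  rewrite /k /kernel_pre/= /pushforward.
  have CW := markov_chain_adapted (C1 (W 0%N w)) (CP (W 0%N w)).
  have := adapted_chain_cylinder CW n (F := cst 1) mD (adapted_chain_setT CW)
    (@measurable_cst _ _ _ _ setT 1) (fun=> lee01).
  rewrite setTI integral_cst; last first.
    have := measurable_path (adapted_chain_measurable CW) measurableT (mcyl n _ mD).
    by rewrite setTI.
  rewrite mul1e => ->.
  have [_ WC0 _] := CP (W 0%N w).
  rewrite -[RHS](@ge0_integral_pushforward _ _ _ _ _ _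
    (adapted_chain_measurable CW 0%N) (C (W 0%N w)) setT
    (cylinder_iter Q D n (cst 1)))//.
  rewrite (@eq_measure_integral _ _ _ _ (\d_(W 0%N w))); last first.
    by move=> ? E mE _; exact: WC0.
    exact: (adapted_chain_measurable CW 0%N).
  by rewrite integral_dirac// diracT mul1e.
pose m1 := measure_function_pushforward__canonical__measure_function_Measure
  (mrestr Pr mA) (measurable_path mW).
pose m2 : {measure set (path_space S) -> \bar R} := kernel_mixture Pr k mA.
rewrite -[LHS]/(m1 B) -[RHS]/(m2 B).
apply: (@measure_unique _ _ (path_space S) (cylinders S) (fun=> setT)) => //.
- move=> _ _ [n [D [mD ->]]] [n' [D' [mD' ->]]].
  (* The shorter cylinder is extended by unconstrained coordinates. *)
  exists (maxn n n'), (fun i => (if (i < n)%N then D i else setT) `&`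
    (if (i < n')%N then D' i else setT)); split.
    by move=> i; apply: measurableI; case: ifP.
  apply/seteqP; split=> [w /= [Dw D'w] i _|w /= Dw].
    by split; case: ifPn => // ni; [exact: Dw|exact: D'w].
  split=> i ni; have := Dw i; rewrite leq_max ni ?orbT => /(_ isT)[].
    by [].
  by [].
- by move=> _; exists 0%N, (fun=> setT); split => //; apply/seteqP; split.
- by apply/seteqP; split => // x _; exists 0%N.
- by move=> _ [n [D [mD ->]]]; exact: cylE.
- move=> _; rewrite /= /pushforward /mrestr preimage_setT setTI.
  by rewrite (@le_lt_trans _ _ (Pr setT)) ?Pr1 ?ltry// -Pr1 le_measure ?inE.
Qed.

End law_of_the_path.

End adapted_chains.

(** * Iterated kernels and drift *)

Section transfer.
Local Open Scope ereal_scope.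
Context d1 d2 d3 (S1 : measurableType d1) (S2 : measurableType d2)
  (S3 : measurableType d3) (R : realType).
Variables (m1 : {measure set S1 -> \bar R}) (m2 : {measure set S2 -> \bar R})
  (h1 : S1 -> S3) (h2 : S2 -> S3).

Lemma integral_transfer :
  (forall F : S3 -> \bar R, measurable_fun setT F -> (forall x, 0 <= F x) ->
    \int[m1]_x F (h1 x) = \int[m2]_x F (h2 x)) ->
  forall F : S3 -> R, measurable_fun setT F ->
    \int[m1]_x (F (h1 x))%:E = \int[m2]_x (F (h2 x))%:E.
Proof.
move=> m12 F mF.
have split_int d (X : measurableType d) (mu : {measure set X -> \bar R})
    (h : X -> S3) :
    \int[mu]_x (F (h x))%:E =
    \int[mu]_x (F^\+%R (h x))%:E - \int[mu]_x (F^\-%R (h x))%:E.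
  rewrite integralE; congr (_ - _); apply: eq_integral => x _.
    by rewrite funeposE /funrpos EFin_max.
  by rewrite funenegE /funrneg EFin_max.
rewrite !split_int (m12 (fun y => (F^\+%R y)%:E)) ?(m12 (fun y => (F^\-%R y)%:E))//.
- by apply/measurable_EFinP/measurable_funrneg.
- by move=> x; rewrite lee_fin funrneg_ge0.
- by apply/measurable_EFinP/measurable_funrpos.
- by move=> x; rewrite lee_fin funrpos_ge0.
Qed.

End transfer.

Section kernel_iterates.
Local Open Scope ereal_scope.
Context d (S : measurableType d) (R : realType).
Implicit Types (Q : R.-pker S ~> S) (F : S -> \bar R).

Lemma integral_kiter0 Q x F : measurable_fun setT F ->
  \int[kiter Q 0 x]_y F y = F x.
Proof. by move=> mF; rewrite /= integral_dirac// diracT mul1e. Qed.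

Lemma integral_kiterS Q n x F : measurable_fun setT F -> (forall y, 0 <= F y) ->
  \int[kiter Q n.+1 x]_y F y = \int[Q x]_y \int[kiter Q n y]_u F u.
Proof.
move=> mF F0.
have := @integral_kcomp _ _ _ _ _ _ R Q (@kernel.kernel_snd _ _ _ S S S R (kiter Q n))
  x F F0 mF.
by [].
Qed.

Lemma measurable_integral_kernel d' (S' : measurableType d')
    (k : R.-ker S' ~> S) F :
  measurable_fun setT F -> (forall y, 0 <= F y) ->
  measurable_fun setT (fun x => \int[k x]_y F y).
Proof.
by move=> mF F0; exact: (measurable_fun_integral_kernel (measurable_kernel k)).
Qed.

Lemma kiter_setT Q n x : kiter Q n x setT = 1.
Proof.
elim: n x => [|n IH] x; first by rewrite /= /kdirac diracT.
rewrite -[LHS]mul1e -integral_cst// integral_kiterS//.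
under eq_integral do rewrite integral_cst// mul1e IH.
by rewrite integral_cst// mul1e prob_kernel.
Qed.

Section chains.
Context dO (O : measurableType dO) (Pr : {measure set O -> \bar R})
  (Gs : nat -> set (set O)) Q (W : nat -> O -> S).
Hypothesis WP : adapted_chain Pr Gs Q W.

Lemma adapted_chain_kiter m n A F :
  Gs m A -> measurable_fun setT F -> (forall y, 0 <= F y) ->
  \int[Pr]_(w in A) F (W (m + n)%N w) =
  \int[Pr]_(w in A) \int[kiter Q n (W m w)]_y F y.
Proof.
move=> GA mF F0; elim: n m GA => [|n IH] m GA.
  by rewrite addn0; apply: eq_integral => w _; rewrite integral_kiter0.
rewrite addnS -addSn IH; last first.
  by apply: (adapted_chain_filtration WP) GA; exact: leqnSn.
rewrite (adapted_chain_step WP GA (F := fun y => \int[kiter Q n y]_u F u)).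
- by apply: eq_integral => w _; rewrite integral_kiterS.
- exact: measurable_integral_kernel.
- by move=> y; exact: integral_ge0.
Qed.

Lemma adapted_chain_marginal n F :
  measurable_fun setT F -> (forall y, 0 <= F y) ->
  \int[Pr]_w F (W n w) = \int[Pr]_w \int[kiter Q n (W 0%N w)]_y F y.
Proof.
by move=> mF F0; exact: (adapted_chain_kiter n (adapted_chain_setT WP) mF F0).
Qed.

(** Lumpability: the kernel seen through [h] depends on the state through [h] only. For the
    projections of a coupled pair it says that each coordinate is a chain in the filtration of the
    pair. *)
Lemma adapted_chain_image d' (S' : measurableType d') (Q' : R.-pker S' ~> S')
    (h : S -> S') : measurable_fun setT h ->
  (forall x B, measurable B -> Q x (h @^-1` B) = Q' (h x) B) ->
  adapted_chain Pr Gs Q' (fun n => h \o W n).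
Proof.
move=> mh hQ; have [Pr1 sG GS WG QW] := WP.
have mhB B : measurable B -> measurable (h @^-1` B).
  by move=> mB; rewrite -[X in measurable X]setTI; exact: mh.
split=> // n.
  by move=> B mB; rewrite comp_preimage; exact/WG/mhB.
move=> A B GA mB; rewrite comp_preimage QW//; last exact: mhB.
by apply: eq_integral => w _; rewrite hQ.
Qed.

End chains.

Lemma integral_law dO (O : measurableType dO) (Pr : {measure set O -> \bar R})
    (mu : {measure set S -> \bar R}) (U : O -> S) F :
  measurable_fun setT U ->
  (forall B, measurable B -> Pr (U @^-1` B) = mu B) ->
  measurable_fun setT F -> (forall y, 0 <= F y) ->
  \int[Pr]_w F (U w) = \int[mu]_x F x.
Proof.
move=> mU Umu mF F0.
rewrite -[LHS](@ge0_integral_pushforward _ _ _ _ _ _ mU Pr setT F)//.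
by apply: (@eq_measure_integral _ _ _ _ mu) => E mE _; exact: Umu.
Qed.

Lemma invariant_integral Q (mu : probability S R) F : invariant Q mu ->
  measurable_fun setT F -> (forall y, 0 <= F y) ->
  \int[mu]_x \int[Q x]_y F y = \int[mu]_x F x.
Proof.
move=> Qmu mF F0.
have mu1 : mu setT = 1 by exact: probability_setT.
pose k := kernel_pre Q (@measurable_snd _ _ unit S).
rewrite [RHS](@eq_measure_integral _ _ _ _ (mkcomp (kernel_cst mu1) k tt)).
  by rewrite integral_kcomp.
by move=> E mE _; first [exact: (Qmu E mE)|exact: (esym (Qmu E mE))].
Qed.

End kernel_iterates.

Section drift.
Local Open Scope ereal_scope.
Context d (S : measurableType d) (R : realType).
Variables (Q : R.-pker S ~> S) (V : S -> R) (lambda b : R).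
Hypotheses (mV : measurable_fun setT V) (V1 : forall x, (1 <= V x)%R).
Hypotheses (lambda01 : (0 < lambda < 1)%R) (b0 : (0 <= b)%R).
Hypothesis QV : forall x, \int[Q x]_y (V y)%:E <= (lambda * V x + b)%:E.

Let B := (b / (1 - lambda))%R.

Let V0 x : (0 <= V x)%R.
Proof. exact: le_trans (V1 x). Qed.

Let mVE : measurable_fun setT (EFin \o V).
Proof. exact/measurable_EFinP. Qed.

Let VE0 x : 0 <= (V x)%:E.
Proof. by rewrite lee_fin. Qed.

Lemma drift_kiter n x : \int[kiter Q n x]_y (V y)%:E <= (V x + B)%:E.
Proof.
have /andP[l0 l1] := lambda01; have l1' : (0 < 1 - lambda)%R by rewrite subr_gt0.
have B0 : (0 <= B)%R by rewrite divr_ge0// ltW.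
have ln n' : (0 <= lambda ^+ n' <= 1)%R.
  by rewrite exprn_ge0 ?exprn_ile1 ?ltW.
(* [B] is the fixed point of the map [v |-> lambda * v + b], whose iterates are convex combinations
   of the starting value and of [B]. *)
suff: \int[kiter Q n x]_y (V y)%:E <= (lambda ^+ n * V x + B * (1 - lambda ^+ n))%:E.
  move=> /le_trans; apply; rewrite lee_fin lerD//.
    by rewrite ler_piMl// (andP (ln n)).2.
  by rewrite ler_piMr// gerBl (andP (ln n)).1.
elim: n x => [|n IH] x.
  by rewrite (integral_kiter0 Q x mVE) subrr mulr0 addr0 mul1r.
rewrite (integral_kiterS Q n x mVE VE0).
apply: (@le_trans _ _
    (\int[Q x]_y ((lambda ^+ n)%:E * (V y)%:E + (B * (1 - lambda ^+ n))%:E))).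
  apply: ge0_le_integral_nonmeas => y; last exact: IH.
  by apply: integral_ge0 => u _; rewrite lee_fin.
have /andP[ln0 ln1] := ln n.
have mlV : measurable_fun setT (fun y => (lambda ^+ n)%:E * (V y)%:E).
  exact: measurable_funeM.
rewrite ge0_integralD//; last 2 first.
- by move=> y _; rewrite mule_ge0 ?lee_fin.
- by move=> y _; rewrite lee_fin mulr_ge0// subr_ge0.
rewrite integral_cst// [X in _ * X]prob_kernel mule1.
rewrite (ge0_integralZl_EFin _ _ (fun y _ => VE0 y) mVE ln0)//.
apply: (@le_trans _ _ ((lambda ^+ n)%:E * (lambda * V x + b)%:E +
    (B * (1 - lambda ^+ n))%:E)).
  by rewrite leeD2r// lee_wpmul2l ?lee_fin.
rewrite -EFinM -EFinD lee_fin le_eqVlt; apply/orP; left; apply/eqP.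
by rewrite /B exprS; field; rewrite gt_eqF.
Qed.

(* For [m N = min (V, N)] and [n N = min (lambda V + b, N)], invariance gives
   [mu (m N) <= mu (n N)], while [m N - n N + b] is nonnegative and eventually
   equal to [(1 - lambda) V]: conclude by Fatou's lemma. *)
Lemma drift_invariant (mu : probability S R) : invariant Q mu ->
  \int[mu]_x (V x)%:E <= B%:E.
Proof.
move=> Qmu.
have /andP[l0 l1] := lambda01; have l1' : (0 < 1 - lambda)%R by rewrite subr_gt0.
pose m (N : nat) x := Num.min (V x) N%:R.
pose n (N : nat) x := Num.min (lambda * V x + b)%R N%:R.
have lVb0 x : (0 <= lambda * V x + b)%R by rewrite addr_ge0// mulr_ge0// ltW.
have m0 N x : (0 <= m N x)%R by rewrite le_min V0/=.
have n0 N x : (0 <= n N x)%R by rewrite le_min lVb0/=.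
have mlVb : measurable_fun setT (fun x => lambda * V x + b)%R.
  by apply: measurable_funD => //; exact: measurable_funM.
have mm N : measurable_fun setT (m N) by exact: measurable_minr.
have mn N : measurable_fun setT (n N) by exact: measurable_minr.
pose f N x := (m N x - n N x + b)%R.
have f0 N x : (0 <= f N x)%R.
  rewrite /f addrAC subr_ge0 /n ge_min /m.
  have [VN|VN] := leP (V x) N%:R; last by rewrite lerDl b0 orbT.
  by rewrite lerD2r ler_piMl// ltW.
have mf N : measurable_fun setT (f N).
  by apply: measurable_funD => //; exact: measurable_funB.
have mn_le N : \int[mu]_x (m N x)%:E <= \int[mu]_x (n N x)%:E.
  rewrite -(@invariant_integral _ _ _ Q)//; last 2 first.
  - exact/measurable_EFinP.
  - by move=> y; rewrite lee_fin.
  apply: ge0_le_integral_nonmeas => x.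
    by apply: integral_ge0 => y _; rewrite lee_fin.
  rewrite /n EFin_min le_min; apply/andP; split.
    apply: (le_trans _ (QV x)); apply: ge0_le_integral_nonmeas => y.
      by rewrite lee_fin.
    by rewrite lee_fin ge_min lexx.
  apply: (@le_trans _ _ (\int[Q x]_y N%:R%:E)).
    apply: ge0_le_integral_nonmeas => y; rewrite lee_fin//.
    by rewrite ge_min lexx orbT.
  by rewrite integral_cst// [X in _ * X]prob_kernel mule1.
have mu1 : mu setT = 1 by exact: probability_setT.
have nfin N : \int[mu]_x (n N x)%:E \is a fin_num.
  rewrite ge0_fin_numE; last by apply: integral_ge0 => x _; rewrite lee_fin.
  apply: (@le_lt_trans _ _ (\int[mu]_x N%:R%:E)); last first.
    by rewrite integral_cst// [X in _ * X]mu1 mule1 ltry.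
  apply: ge0_le_integral_nonmeas => y; rewrite lee_fin//.
  by rewrite ge_min lexx orbT.
have fb N : \int[mu]_x (f N x)%:E <= b%:E.
  rewrite -(leeD2rE _ _ (nfin N)) -ge0_integralD//; last 4 first.
  - by move=> x _; rewrite lee_fin.
  - exact/measurable_EFinP.
  - by move=> x _; rewrite lee_fin.
  - exact/measurable_EFinP.
  rewrite (eq_integral (fun x => (m N x)%:E + b%:E)); last first.
    by move=> x _; rewrite -!EFinD; congr EFin; rewrite /f; ring.
  rewrite ge0_integralD//; [|by move=> x _; rewrite lee_fin|exact/measurable_EFinP].
  by rewrite integral_cst// [X in _ * X]mu1 mule1 addeC leeD2l.
have := @fatou _ _ _ mu setT measurableT (fun N x => (f N x)%:E)
  (fun N => (measurable_EFinP _ _).2 (mf N)) (fun N x _ => f0 N x).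
have -> : (fun x => limn_einf (fun N => (f N x)%:E)) =
    (fun x => (1 - lambda)%:E * (V x)%:E).
  apply/funext => x.
  have fx : (f N x)%:E @[N --> \oo] --> ((1 - lambda) * V x)%:E.
    apply: cvg_near_cst; near=> N.
    have VN : (V x <= N%:R)%R by near: N; exact: nbhs_infty_ger.
    have VbN : (lambda * V x + b <= N%:R)%R by near: N; exact: nbhs_infty_ger.
    by rewrite /f /m /n !min_l//; congr EFin; ring.
  by rewrite is_cvg_limn_einfE ?(cvg_lim _ fx)//; apply/cvg_ex; eexists; exact: fx.
rewrite (ge0_integralZl_EFin _ _ (fun x _ => VE0 x) mVE (ltW l1'))//.
have Bb : ((1 - lambda) * B = b)%R by rewrite /B mulrC mulfVK ?gt_eqF.
move=> h; rewrite -(@lee_pmul2l _ (1 - lambda)%:E)//.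
  rewrite -EFinM Bb (le_trans h)//.
  rewrite limn_einf_lim; apply: lime_le; first exact: is_cvg_einfs.
  apply: nearW => N; apply: le_trans (fb N); apply: ereal_inf_lbound.
  by exists N => //=.
Unshelve. all: by end_near.
Qed.

End drift.

(** * Functionals of a coupled path *)

Section first_times.
Variable A : nat -> Prop.

Lemma first_time_Some n :
  first_time A = Some n <-> A n /\ forall i, (i < n)%N -> ~ A i.
Proof.
rewrite /first_time; case: pselect => [h|h]; last first.
  split=> // -[An _]; case: h; exists n; exact/asboolP.
case: ex_minnP => m /asboolP Am mmin; split=> [[<-]|[An nA]].
  by split=> // i im /asboolP/mmin; rewrite leqNgt im.
congr Some; apply/eqP; rewrite eqn_leq mmin ?asboolT//=.
by rewrite leqNgt; apply/negP => /nA.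
Qed.

Lemma first_time_None : first_time A = None <-> forall i, ~ A i.
Proof.
rewrite /first_time; case: pselect => [h|h]; split=> //.
  by move=> h'; exfalso; case: h => n /asboolP /h'.
by move=> _ i Ai; apply: h; exists i; exact/asboolP.
Qed.

Lemma time_gt_first_time t :
  time_gt (first_time A) t <-> forall i, (i <= t)%N -> ~ A i.
Proof.
case E : (first_time A) => [s|] /=.
  have [As sA] := (first_time_Some s).1 E; split=> [ts i it|h].
    by apply: sA; exact: leq_ltn_trans ts.
  by rewrite ltnNge; apply/negP => /h.
by split=> // _ i _; exact: (first_time_None.1 E).
Qed.

End first_times.

Section measurable_option_case.
Context d d' (S : measurableType d) (S' : measurableType d').

Lemma measurable_option_case (tau : S -> option nat) (g : nat -> S -> S')
    (g0 : S -> S') :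
  (forall t, measurable [set x | tau x = Some t]) ->
  (forall t, measurable_fun setT (g t)) -> measurable_fun setT g0 ->
  measurable_fun setT (fun x => if tau x is Some t then g t x else g0 x).
Proof.
move=> mtau mg mg0.
pose E n := if n is t.+1 then [set x | tau x = Some t] else [set x | tau x = None].
have EU : \bigcup_n E n = setT.
  apply/seteqP; split=> // x _.
  by case Ex : (tau x) => [t|]; [exists t.+1|exists 0%N].
have mE n : measurable (E n).
  case: n => [|n]; last exact: mtau.
  have -> : E 0%N = ~` \bigcup_t [set x | tau x = Some t].
    apply/seteqP; split=> [x /= Ex [t _] /=|x /= h]; first by rewrite Ex.
    by case Ex : (tau x) => [t|//]; case: h; exists t.
  exact/measurableC/bigcup_measurable.
rewrite -EU; apply/measurable_fun_bigcup => // n.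
case: n => [|n].
  apply: (eq_measurable_fun g0); last exact: measurable_funTS.
  by move=> x; rewrite inE /= => ->.
apply: (eq_measurable_fun (g n)); last exact: measurable_funTS.
by move=> x; rewrite inE /= => ->.
Qed.

Lemma measurable_first_time (A : nat -> set S) t :
  (forall i, measurable (A i)) ->
  measurable [set x | first_time (A ^~ x) = Some t].
Proof.
move=> mA.
have -> : [set x | first_time (A ^~ x) = Some t] =
    A t `&` \bigcap_(i in `I_t) ~` A i.
  by apply/seteqP; split=> x /= => [/first_time_Some|?]; [|exact/first_time_Some].
apply: measurableI => //.
by apply: bigcap_measurableType => i _; exact: measurableC.
Qed.

Lemma measurable_time_gt (A : nat -> set S) t :
  (forall i, measurable (A i)) ->
  measurable [set x | time_gt (first_time (A ^~ x)) t].
Proof.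
move=> mA.
have -> : [set x | time_gt (first_time (A ^~ x)) t] =
    \bigcap_(i in `I_t.+1) ~` A i.
  apply/seteqP; split=> x /= => [/time_gt_first_time h i /=|h].
    by rewrite ltnS => /h.
  by apply/time_gt_first_time => i it; apply: h; rewrite /= ltnS.
by apply: bigcap_measurableType => i _; exact: measurableC.
Qed.

End measurable_option_case.

Section path_functionals.
Context d (T : measurableType d) (R : realType).
Variables (f : T -> R) (L : nat).
Hypotheses (mf : measurable_fun setT f) (mdiag : measurable (@diag d T)).

Local Notation PT := (path_space (T * T)%type).

Let mfd i : measurable_fun setT (fun w : PT => f (w i).1 - f (w i).2).
Proof.
apply: measurable_funB; apply: (measurableT_comp mf).
  exact: (measurableT_comp measurable_fst (measurable_path_coord i)).
exact: (measurableT_comp measurable_snd (measurable_path_coord i)).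
Qed.

Let mmeet t : measurable [set w : PT | meeting w = Some t].
Proof.
apply: (@measurable_first_time _ PT
  (fun i => [set w : PT | (w i).1 = (w i).2])) => i.
have := measurable_path_coord i measurableT mdiag.
by rewrite setTI.
Qed.

Lemma measurable_meeting_gt t :
  measurable [set w : PT | time_gt (meeting w) t].
Proof.
apply: (@measurable_time_gt _ PT
  (fun i => [set w : PT | (w i).1 = (w i).2])) => i.
have := measurable_path_coord i measurableT mdiag.
by rewrite setTI.
Qed.

Lemma measurable_Gval : measurable_fun setT (Gval f L : PT -> R).
Proof.
apply: (@measurable_option_case _ _ PT _ (@meeting T) (fun t w =>
  \sum_(0 <= i < (t %/ L).+1) (f (w (i * L)%N).1 - f (w (i * L)%N).2)) (cst 0)) => //.
by move=> t; apply: measurable_sum.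
Qed.

(** Along a path that meets and then stays on the diagonal it bounds every partial sum of the
    differences of [f], not only [Gval]: the majorant for dominated convergence. *)
Definition Gabs (w : nat -> T * T) : R :=
  if meeting w is Some t then
    \sum_(0 <= i < (t %/ L).+1) `|f (w (i * L)%N).1 - f (w (i * L)%N).2|
  else 0.

Lemma measurable_Gabs : measurable_fun setT (Gabs : PT -> R).
Proof.
apply: (@measurable_option_case _ _ PT _ (@meeting T) (fun t w =>
  \sum_(0 <= i < (t %/ L).+1) `|f (w (i * L)%N).1 - f (w (i * L)%N).2|) (cst 0)) => //.
by move=> t; apply: measurable_sum => i; exact: measurableT_comp.
Qed.

Definition meeting_value (w : nat -> T * T) : R :=
  if meeting w is Some t then t%:R else 0.

Lemma measurable_meeting_value : measurable_fun setT (meeting_value : PT -> R).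
Proof.
exact: (@measurable_option_case _ _ PT _ (@meeting T) (fun t _ => t%:R : R)
  (cst (0 : R))).
Qed.

Lemma measurable_run_cost : measurable_fun setT (run_cost R : PT -> \bar R).
Proof.
exact: (@measurable_option_case _ _ PT _ (@meeting T)
  (fun t _ => (2 * t)%:R%:E : \bar R) (cst +oo%E)).
Qed.

Lemma Gabs_ge0 w : 0 <= Gabs w.
Proof. by rewrite /Gabs; case: meeting => // t; exact: sumr_ge0. Qed.

Lemma normr_Gval w : `|Gval f L w| <= Gabs w.
Proof.
rewrite /Gval /Gabs; case: meeting => [t|]; last by rewrite normr0.
exact: ler_norm_sum.
Qed.

Lemma meeting_value_ge0 w : 0 <= meeting_value w.
Proof. by rewrite /meeting_value; case: meeting. Qed.

(** [time_gt] moved by one step, so that the event for [n = 0] is sure and, on a path that meets,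
    the i-th term of [Gval] is present exactly when [meeting_ge w (i * L)]. *)
Definition meeting_ge (w : nat -> T * T) (n : nat) : Prop :=
  forall i, (i < n)%N -> ~ diag (w i).

Lemma meeting_geP w n : meeting_ge w n.+1 <-> time_gt (meeting w) n.
Proof.
split=> [h|/time_gt_first_time h i].
  by apply/time_gt_first_time => i; rewrite -ltnS; exact: h.
by rewrite ltnS => /h.
Qed.

Lemma measurable_meeting_ge n : measurable [set w : PT | meeting_ge w n].
Proof.
case: n => [|n].
  by rewrite (_ : [set _ | _] = setT)//; apply/seteqP; split.
have := measurable_meeting_gt n; congr measurable.
by apply/seteqP; split=> w /=; case: (meeting_geP w n).
Qed.

Lemma Gabs_le_sum w : exists n, Gabs w <= \sum_(0 <= i < n)
  `|f (w (i * L)%N).1 - f (w (i * L)%N).2| * \1_[set w : PT | meeting_ge w (i * L)] w.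
Proof.
rewrite /Gabs; case E : (meeting w) => [t|]; last by exists 0%N; rewrite big_geq.
exists (t %/ L).+1; rewrite !big_mkord; apply: ler_sum => i _.
rewrite indicE mem_set ?mulr1//= => j ji.
have [_] := (first_time_Some _ _).1 E; apply.
apply: (leq_trans ji); apply: leq_trans (leq_divM t L).
by rewrite leq_mul2r -ltnS ltn_ord orbT.
Qed.

Lemma meeting_value_le_sum w : exists n, meeting_value w <= \sum_(0 <= i < n)
  1 * \1_[set w : PT | meeting_ge w i.+1] w.
Proof.
rewrite /meeting_value; case E : (meeting w) => [t|]; last by exists 0%N; rewrite big_geq.
exists t; rewrite (eq_big_nat _ _ (F2 := fun=> 1)).
  by rewrite big_const_nat subn0 iter_addr addr0.
move=> i /andP[_ it]; rewrite mul1r indicE mem_set//=.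
apply/meeting_geP/time_gt_first_time => j ji.
by have [_] := (first_time_Some _ _).1 E; apply; exact: leq_ltn_trans it.
Qed.

End path_functionals.

Lemma powRD_le2 (R : realType) (e x y : R) : 1 <= e -> 0 <= x -> 0 <= y ->
  (x + y) `^ e <= 2 `^ e * (x `^ e + y `^ e).
Proof.
move=> e1 x0 y0; have e0 : 0 <= e by rewrite (le_trans _ e1).
wlog xy : x y x0 y0 / x <= y => [hw|].
  by have [/hw|/ltW/hw] := leP x y; [exact|rewrite addrC [x `^ e + _]addrC; exact].
apply: (@le_trans _ _ ((2 * y) `^ e)).
  by rewrite ge0_ler_powR ?nnegrE ?addr_ge0 ?mulr_ge0// mulrDl mul1r lerD2r.
by rewrite powRM// ler_wpM2l ?powR_ge0// lerDr powR_ge0.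
Qed.

Lemma powRB_le2 (R : realType) (e x y : R) : 1 <= e ->
  `|x - y| `^ e <= 2 `^ e * (`|x| `^ e + `|y| `^ e).
Proof.
move=> e1; have e0 : 0 <= e by rewrite (le_trans _ e1).
apply: le_trans (powRD_le2 e1 (normr_ge0 x) (normr_ge0 y)).
by rewrite ge0_ler_powR ?nnegrE ?addr_ge0// ler_normB.
Qed.

(** * Tails and moments for the coupled pair *)

Section coupled_pair.
Local Open Scope ereal_scope.
Context d (T : measurableType d) (R : realType).
Variables (Q : R.-pker T ~> T) (Qb : R.-pker (T * T)%type ~> (T * T)%type).
Variables (V : T -> R) (lambda b : R).
Hypotheses (mV : measurable_fun setT V) (V1 : forall x, (1 <= V x)%R).
Hypotheses (lambda01 : (0 < lambda < 1)%R) (b0 : (0 <= b)%R).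
Hypothesis QV : forall x, \int[Q x]_y (V y)%:E <= (lambda * V x + b)%:E.
Hypothesis cQ : coupling Q Qb.
Context dC (OC : measurableType dC) (C : R.-pker (T * T)%type ~> OC)
  (WC : nat -> OC -> T * T).
Hypothesis CP : forall xz, markov_chain (C xz) Qb \d_xz WC.
Variables (M rho : R).
Hypotheses (M0 : (0 <= M)%R) (rho01 : (0 < rho < 1)%R).
Hypothesis Ctail : forall (x z : T) (t : nat),
  C (x, z) [set w | time_gt (meeting (WC ^~ w)) t]
  <= (M * (V x + V z) * rho ^+ t)%:E.

Local Notation PT := (path_space (T * T)%type).
Let B := (b / (1 - lambda))%R.

Let B0 : (0 <= B)%R.
Proof. by have /andP[_ l1] := lambda01; rewrite divr_ge0// subr_ge0 ltW. Qed.

Let C1 xz : C xz setT = 1. Proof. exact: prob_kernel. Qed.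

Let CA xz := markov_chain_adapted (C1 xz) (CP xz).

Lemma measurable_WC : measurable_fun setT (fun w => WC ^~ w : PT).
Proof. by apply: measurable_path; have [] := CP (point, point). Qed.

Let VD2 x z : (2 <= V x + V z)%R.
Proof. by rewrite lerD. Qed.

Let mdiag : measurable (@diag d T). Proof. by case: cQ. Qed.

Lemma coupled_fst xz n (F : T -> \bar R) :
  measurable_fun setT F -> (forall y, 0 <= F y) ->
  \int[C xz]_w F (WC n w).1 = \int[kiter Q n xz.1]_y F y.
Proof.
move=> mF F0.
have Qfst x E : measurable E -> Qb x (fst @^-1` E) = Q x.1 E.
  case: cQ => _ h _ _; case: x => x y mE; rewrite -(h x y E mE); congr (Qb _ _);
    by apply/seteqP; split=> // u [].
have A1 := adapted_chain_image (CA xz) measurable_fst Qfst.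
rewrite (adapted_chain_marginal A1 n mF F0)/=.
rewrite (@integral_law _ _ _ _ _ _ \d_xz (WC 0%N)
  (fun u => \int[kiter Q n u.1]_y F y)).
- rewrite integral_dirac ?diracT ?mul1e//.
  exact: (measurableT_comp (measurable_integral_kernel _ mF F0) measurable_fst).
- by case: (CP xz).
- by case: (CP xz).
- exact: (measurableT_comp (measurable_integral_kernel _ mF F0) measurable_fst).
- by move=> u; exact: integral_ge0.
Qed.

Lemma coupled_snd xz n (F : T -> \bar R) :
  measurable_fun setT F -> (forall y, 0 <= F y) ->
  \int[C xz]_w F (WC n w).2 = \int[kiter Q n xz.2]_y F y.
Proof.
move=> mF F0.
have Qsnd x E : measurable E -> Qb x (snd @^-1` E) = Q x.2 E.
  case: cQ => _ _ h _; case: x => x y mE; rewrite -(h x y E mE); congr (Qb _ _);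
    by apply/seteqP; split=> // u [].
have A1 := adapted_chain_image (CA xz) measurable_snd Qsnd.
rewrite (adapted_chain_marginal A1 n mF F0)/=.
rewrite (@integral_law _ _ _ _ _ _ \d_xz (WC 0%N)
  (fun u => \int[kiter Q n u.2]_y F y)).
- rewrite integral_dirac ?diracT ?mul1e//.
  exact: (measurableT_comp (measurable_integral_kernel _ mF F0) measurable_snd).
- by case: (CP xz).
- by case: (CP xz).
- exact: (measurableT_comp (measurable_integral_kernel _ mF F0) measurable_snd).
- by move=> u; exact: integral_ge0.
Qed.

Let VC x z n :
  \int[C (x, z)]_w (V (WC n w).1 + V (WC n w).2)%:E <= (V x + V z + 2 * B)%:E.
Proof.
have mVE : measurable_fun setT (EFin \o V) by exact/measurable_EFinP.
have VE0 y : 0 <= (V y)%:E by rewrite lee_fin (le_trans _ (V1 y)).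
have mW : measurable_fun setT (WC n) by case: (CP (x, z)).
under eq_integral do rewrite EFinD.
rewrite ge0_integralD//; last 2 first.
- exact: (measurableT_comp mVE (measurableT_comp measurable_fst mW)).
- exact: (measurableT_comp mVE (measurableT_comp measurable_snd mW)).
rewrite (coupled_fst (x, z) n mVE VE0) (coupled_snd (x, z) n mVE VE0).
have -> : (V x + V z + 2 * B = (V x + B) + (V z + B))%R by ring.
by rewrite EFinD leeD//; exact: (drift_kiter mV V1 lambda01 b0 QV).
Qed.

(* The extra factor [rho^-1] absorbs the shift between meeting after time [n]
   and meeting at time [n] or later. *)
Lemma meeting_ge_tail x z n : C (x, z) [set w | meeting_ge (WC ^~ w) n] <=
  ((1 + M / rho) * (V x + V z) * rho ^+ n)%:E.
Proof.
have /andP[r0 r1] := rho01.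
have VV0 : (0 <= V x + V z)%R by rewrite (le_trans _ (VD2 x z)).
case: n => [|n].
  rewrite (_ : [set _ | _] = setT); last by apply/seteqP; split.
  rewrite C1 lee_fin expr0 mulr1 -[leLHS]mulr1 ler_pM//.
    by rewrite lerDl divr_ge0// ltW.
  by rewrite (le_trans _ (VD2 x z))// ler1n.
have -> : [set w | meeting_ge (WC ^~ w) n.+1] =
    [set w | time_gt (meeting (WC ^~ w)) n].
  by apply/seteqP; split=> w /=; case: (meeting_geP (WC ^~ w) n).
rewrite (le_trans (Ctail _ _ _))// lee_fin exprS.
have -> : ((1 + M / rho) * (V x + V z) * (rho * rho ^+ n) =
    (rho + M) * (V x + V z) * rho ^+ n)%R by field; rewrite gt_eqF.
by rewrite !ler_wpM2r ?exprn_ge0 ?(ltW r0)// lerDr ltW.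
Qed.

Let mge n : measurable [set w | meeting_ge (WC ^~ w) n].
Proof.
have := measurable_WC measurableT (measurable_meeting_ge mdiag n).
by rewrite setTI.
Qed.

Lemma meeting_value_moment : exists2 K : R, (0 <= K)%R & forall x z,
  \int[C (x, z)]_w (meeting_value R (WC ^~ w) `^ 2)%:E <= (K * (V x + V z))%:E.
Proof.
have le12 : (1 <= 2 :> R)%R by rewrite ler1n.
have lt23 : (2 < 3 :> R)%R by rewrite ltr_nat.
(* The meeting time is a sum of ones, so any exponent above 2 would do in place of 3; the second
   moment is the one that the computation time calls for. *)
have [c [s [c0 _ moment]]] := @geometric_sum_moment _ OC R 2 3 rho le12 lt23 rho01.
have /andP[r0 r1] := rho01.
pose K := (1 + M / rho)%R.
have K1 : (1 <= K)%R by rewrite lerDl divr_ge0// ltW.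
have K0 : (0 <= K)%R by rewrite (le_trans _ K1).
exists (c * K)%R; first by rewrite mulr_ge0.
move=> x z; have VV1 : (1 <= V x + V z)%R by rewrite (le_trans _ (VD2 x z))// ler1n.
have VV0 : (0 <= V x + V z)%R by rewrite (le_trans _ VV1).
have KV0 : (0 <= K * (V x + V z))%R by rewrite mulr_ge0.
have := moment (C (x, z)) (K * (V x + V z))%R 0%N (fun _ _ => 1%R)
  (fun i => [set w | meeting_ge (WC ^~ w) i.+1]) (fun w => meeting_value R (WC ^~ w))
  KV0.
rewrite expr0 mulr1 -mulrA; apply => //.
- move=> i; rewrite powR1 integral_cst// [X in _ * X]C1 mule1 lee_fin.
  by rewrite -[leLHS]mulr1 ler_pM.
- move=> i; rewrite add0n (le_trans (meeting_ge_tail x z i.+1))// lee_fin.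
  rewrite ler_wpM2l// exprS ler_piMl ?exprn_ge0//; exact: ltW.
- by move=> w; exact: meeting_value_ge0.
- by move=> w; exact: (meeting_value_le_sum R (WC ^~ w)).
Qed.

(** The event of never meeting lies in events whose probability is at most a constant times
    [rho ^+ n], for every [n]. *)
Lemma meeting_finite x z : {ae C (x, z), forall w, meeting (WC ^~ w) <> None}.
Proof.
have mall : measurable [set w | forall n, meeting_ge (WC ^~ w) n].
  rewrite (_ : [set _ | _] = \bigcap_n [set w | meeting_ge (WC ^~ w) n]).
    exact: bigcapT_measurable.
  by apply/seteqP; split=> w /= h n => [_|]; exact: h.
exists [set w | forall n, meeting_ge (WC ^~ w) n]; split.
- exact: mall.
- apply/eqP; rewrite eq_le measure_ge0 andbT.
  have /andP[r0 r1] := rho01.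
  have u0 : ((1 + M / rho) * (V x + V z) * rho ^+ n)%:E @[n --> \oo] --> 0.
    apply: cvg_EFin; first exact: nearW.
    by apply: cvg_geometric; rewrite gtr0_norm.
  rewrite -(cvg_lim _ u0)//; apply: lime_ge; first by apply/cvg_ex; exists 0.
  apply: nearW => n; apply: le_trans (meeting_ge_tail x z n).
  by apply: le_measure; rewrite ?inE//; move=> w /= h; exact: h.
- by move=> w /= /contrapT /first_time_None h n i _; exact: h.
Qed.

Section moments_of_G.
Variables (f : T -> R) (L : nat) (e Cf m : R).
Hypotheses (mf : measurable_fun setT f) (L1 : (1 <= L)%N).
Hypotheses (m1 : (1 <= m)%R) (me : (m < e)%R) (Cf0 : (0 <= Cf)%R).
Hypothesis fV : forall x, (`|f x| `^ e <= Cf * V x)%R.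

(** The drift bounds the e-th moment of each difference of [f], and the random number of terms
    lowers the exponent from [e] to [m]: this is the role of [delta] in (A5). The bound is linear in
    [V x + V z], hence can be averaged along the chain. *)
Lemma Gabs_moment : exists2 K : R, (0 <= K)%R & forall x z,
  \int[C (x, z)]_w (Gabs f L (WC ^~ w) `^ m)%:E <= (K * (V x + V z))%:E.
Proof.
have /andP[r0 r1] := rho01.
have [c [s [c0 _ moment]]] := @geometric_sum_moment _ OC R m e rho m1 me rho01.
have e1 : (1 <= e)%R by rewrite (le_trans m1)// ltW.
pose K := (2 `^ e * Cf * (1 + B) + (1 + M / rho))%R.
have Mr0 : (0 <= 1 + M / rho)%R by rewrite addr_ge0// divr_ge0// ltW.
have CB0 : (0 <= 2 `^ e * Cf * (1 + B))%R.
  by rewrite !mulr_ge0 ?powR_ge0// addr_ge0.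
have K0 : (0 <= K)%R by rewrite addr_ge0.
exists (c * K)%R; first by rewrite mulr_ge0.
move=> x z; have VV0 : (0 <= V x + V z)%R by rewrite (le_trans _ (VD2 x z)).
have KV0 : (0 <= K * (V x + V z))%R by rewrite mulr_ge0.
have mfW i : measurable_fun setT (fun w => f (WC i w).1 - f (WC i w).2)%R.
  have mW : measurable_fun setT (WC i) by case: (CP (x, z)).
  apply: measurable_funB; apply: (measurableT_comp mf).
    exact: (measurableT_comp measurable_fst mW).
  exact: (measurableT_comp measurable_snd mW).
have := moment (C (x, z)) (K * (V x + V z))%R 0%N
  (fun i w => `|f (WC (i * L)%N w).1 - f (WC (i * L)%N w).2|%R)
  (fun i => [set w | meeting_ge (WC ^~ w) (i * L)]) (fun w => Gabs f L (WC ^~ w))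
  KV0.
rewrite expr0 mulr1 -mulrA; apply => //.
- by move=> i; exact: measurableT_comp.
- move=> i; apply: (@le_trans _ _ (\int[C (x, z)]_w
      ((2 `^ e * Cf)%:E * (V (WC (i * L)%N w).1 + V (WC (i * L)%N w).2)%:E))).
    apply: ge0_le_integral_nonmeas => w; first by rewrite lee_fin powR_ge0.
    rewrite -EFinM lee_fin (le_trans (powRB_le2 _ _ e1))// -mulrA.
    by rewrite ler_wpM2l ?powR_ge0// mulrDr lerD.
  rewrite ge0_integralZl_EFin//; last 3 first.
  - by move=> w _; rewrite lee_fin (le_trans _ (VD2 _ _)).
  - have mW : measurable_fun setT (WC (i * L)%N) by case: (CP (x, z)).
    apply/measurable_EFinP; apply: measurable_funD; apply: (measurableT_comp mV).
      exact: (measurableT_comp measurable_fst mW).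
    exact: (measurableT_comp measurable_snd mW).
  - by rewrite mulr_ge0 ?powR_ge0.
  rewrite (le_trans (lee_wpmul2l _ (VC x z (i * L)%N)))//.
    by rewrite lee_fin mulr_ge0 ?powR_ge0.
  rewrite -EFinM lee_fin [leRHS]mulrDl -[leLHS]addr0 lerD ?mulr_ge0//.
  rewrite -[leRHS]mulrA ler_wpM2l ?mulr_ge0 ?powR_ge0// [leRHS]mulrDl mul1r lerD2l.
  by rewrite [leRHS]mulrC ler_wpM2r.
- move=> i; rewrite add0n (le_trans (meeting_ge_tail x z (i * L)))// lee_fin.
  rewrite ler_pM ?mulr_ge0 ?exprn_ge0 ?(ltW r0)//.
    by rewrite ler_wpM2r// lerDr.
  by rewrite ler_wiXn2l ?(ltW r0) ?(ltW r1)// leq_pmulr.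
- by move=> w; exact: Gabs_ge0.
- by move=> w; exact: (Gabs_le_sum f L (WC ^~ w)).
Qed.

End moments_of_G.

End coupled_pair.

(** * Functions dominated by V *)

Section real_integrals.
Context d (T : measurableType d) (R : realType).
Implicit Types (mu : {measure set T -> \bar R}).

Lemma Rintegral_EFin mu (f : T -> R) : mu.-integrable setT (EFin \o f) ->
  (\int[mu]_x (f x)%:E = (\int[mu]_x f x)%:E)%E.
Proof. by move=> fi; rewrite /Rintegral fineK//; exact: integrable_fin_num. Qed.

Lemma dominated_cvg_Rintegral mu (f_ : nat -> T -> R) (f g : T -> R) :
  (forall n, measurable_fun setT (f_ n)) -> measurable_fun setT f ->
  {ae mu, forall x, f_ n x @[n --> \oo] --> f x} ->
  mu.-integrable setT (EFin \o g) -> {ae mu, forall x n, `|f_ n x| <= g x} ->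
  (\int[mu]_x f_ n x) @[n --> \oo] --> \int[mu]_x f x.
Proof.
move=> mf_ mf ff gi fg.
have ff' : {ae mu, forall x, setT x ->
    (fun n => (f_ n x)%:E) @ \oo --> (EFin \o f) x}.
  by apply: filterS ff => x fx _; apply: cvg_EFin => //; exact: nearW.
have fg' : {ae mu, forall x n, setT x -> (`|(f_ n x)%:E| <= (EFin \o g) x)%E}.
  by apply: filterS fg => x fx n _; exact: fx.
have [fi _ cvgf] := @dominated_convergence _ _ _ mu setT measurableT
  (fun n x => (f_ n x)%:E) (EFin \o f) (EFin \o g)
  (fun n => (measurable_EFinP _ _).2 (mf_ n)) ((measurable_EFinP _ _).2 mf) ff' gi fg'.
by apply: fine_cvg; rewrite -Rintegral_EFin.
Qed.

Lemma measurable_Rintegral_kernel d' (S : measurableType d') (k : R.-ker S ~> T)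
    (f : T -> R) : measurable_fun setT f ->
  measurable_fun setT (fun x => \int[k x]_y f y).
Proof.
move=> mf; apply: (measurableT_comp (fine_measurable measurableT)).
rewrite (_ : (fun x => _) = (fun x => (\int[k x]_y (f^\+%R y)%:E -
    \int[k x]_y (f^\-%R y)%:E)%E)); last first.
  apply/funext => x; rewrite integralE; congr (_ - _)%E; apply: eq_integral => y _.
    by rewrite funeposE /funrpos EFin_max.
  by rewrite funenegE /funrneg EFin_max.
apply: emeasurable_funB; apply: measurable_integral_kernel.
- exact/measurable_EFinP/measurable_funrpos.
- by move=> y; rewrite lee_fin funrpos_ge0.
- exact/measurable_EFinP/measurable_funrneg.
- by move=> y; rewrite lee_fin funrneg_ge0.
Qed.

(** Jensen's inequality up to the factor [2 ^ m], read off from [powR_integral_le]. *)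
Lemma Rintegral_powR_le mu (f : T -> R) (m A : R) : (mu setT <= 1)%E ->
  mu.-integrable setT (EFin \o f) -> 1 <= m -> 0 < A ->
  (\int[mu]_x (`|f x| `^ m)%:E <= A%:E)%E ->
  (\int[mu]_x `|f x|) `^ m <= 2 `^ m * A.
Proof.
move=> mu1 fi m1 A0 fA.
have mf : measurable_fun setT f by apply/measurable_EFinP/(measurable_int mu fi).
have m0 : 0 < m by rewrite (lt_le_trans ltr01).
have -> : A = (A `^ m^-1) `^ m by rewrite -powRrM mulVf ?gt_eqF// powRr1// ltW.
rewrite -powRM ?powR_ge0// ge0_ler_powR ?nnegrE ?mulr_ge0 ?powR_ge0 ?(ltW m0)//.
  exact: Rintegral_ge0.
rewrite -lee_fin -Rintegral_EFin; last exact: (integrable_norm fi).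
exact: (powR_integral_le mu1 mf m1 A0 fA).
Qed.

End real_integrals.

Lemma Rintegral_sum d (T : measurableType d) (R : realType)
    (mu : {measure set T -> \bar R}) n (u : nat -> T -> R) :
  (forall i, mu.-integrable setT (EFin \o u i)) ->
  \int[mu]_x \sum_(0 <= i < n) u i x = \sum_(0 <= i < n) \int[mu]_x u i x.
Proof.
move=> iu; have iS l : mu.-integrable setT
    (EFin \o (fun x => \sum_(0 <= i < l) u i x)).
  rewrite (_ : _ \o _ = fun x => \sum_(0 <= i < l) (u i x)%:E)%E.
    by apply: integrable_sum => // i _; exact: iu.
  by apply/funext => x; rewrite /= sumEFin.
elim: n => [|n IH].
  rewrite big_geq//; under eq_Rintegral do rewrite big_geq//.
  by rewrite Rintegral_cst// mul0r.
by rewrite big_nat_recr//= -IH -RintegralD//; apply: eq_Rintegral => x _;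
  rewrite big_nat_recr.
Qed.

Lemma powR_integrable d (T : measurableType d) (R : realType)
    (mu : {measure set T -> \bar R}) (g : T -> R) (k K : R) :
  (mu setT <= 1)%E -> measurable_fun setT g -> 1 <= k ->
  (\int[mu]_x (`|g x| `^ k)%:E <= K%:E)%E ->
  mu.-integrable setT (EFin \o g) /\ \int[mu]_x `|g x| <= 1 + K.
Proof.
move=> mu1 mg k1 gK.
have mgk : measurable_fun setT (fun y => (`|g y| `^ k)%:E).
  apply/measurable_EFinP; apply: (measurableT_comp (measurable_powR k)).
  exact: measurableT_comp.
have le1 : (\int[mu]_x `|(g x)%:E| <= (1 + K)%:E)%E.
  apply: (@le_trans _ _ (\int[mu]_y (1 + (`|g y| `^ k)%:E))%E).
    apply: ge0_le_integral_nonmeas => y //=; rewrite -EFinD lee_fin.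
    by rewrite -[leLHS]powRr1// powR_le1D.
  rewrite ge0_integralD//.
  by rewrite integral_cst// mul1e EFinD leeD.
have ig : mu.-integrable setT (EFin \o g).
  apply/integrableP; split; first exact/measurable_EFinP.
  exact: (le_lt_trans le1 (ltry _)).
split => //; rewrite -lee_fin -Rintegral_EFin//.
exact: (integrable_norm ig).
Qed.

(** Young's inequality stands in for Hoelder's: bounds [A] and [B] linear in [V x] give a bound
    linear in [V x], with no fractional powers. *)
Lemma young_moment d (T : measurableType d) (R : realType)
    (mu : {measure set T -> \bar R}) (g h : T -> R) (k a m A B : R) :
  (mu setT <= 1)%E -> measurable_fun setT g -> measurable_fun setT h ->
  (forall u v : R, 0 <= u -> 0 <= v -> (u * v) `^ k <= u `^ a + v `^ m) ->
  (\int[mu]_x (`|g x| `^ a)%:E <= A%:E)%E ->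
  (\int[mu]_x (`|h x| `^ m)%:E <= B%:E)%E ->
  (\int[mu]_x (`|g x * h x| `^ k)%:E <= (A + B)%:E)%E.
Proof.
move=> mu1 mg mh young gA hB.
apply: (@le_trans _ _ (\int[mu]_x ((`|g x| `^ a)%:E + (`|h x| `^ m)%:E))%E).
  apply: ge0_le_integral_nonmeas => y; first by rewrite lee_fin powR_ge0.
  by rewrite -EFinD lee_fin normrM young.
rewrite ge0_integralD// ?EFinD ?leeD//.
- apply/measurable_EFinP; apply: (measurableT_comp (measurable_powR a)).
  exact: measurableT_comp.
- apply/measurable_EFinP; apply: (measurableT_comp (measurable_powR m)).
  exact: measurableT_comp.
Qed.

Lemma geometric_dominated_series (R : realType) (a : nat -> R) (K s : R) :
  0 <= K -> 0 < s < 1 -> (forall i, `|a i| <= K * s ^+ i) ->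
  cvgn (series a) /\ forall n, `|series a n| <= K / (1 - s).
Proof.
move=> K0 /andP[s0 s1] aK; have s1' : `|s| < 1 by rewrite gtr0_norm.
split.
  have g0 n : 0 <= geometric K s n by rewrite mulr_ge0// exprn_ge0// ltW.
  apply: normed_cvg.
  exact: (series_le_cvg (fun n => normr_ge0 (a n)) g0 aK
    (is_cvg_geometric_series (a := K) s1')).
move=> n; apply: le_trans (ler_norm_sum _ _ _) _.
apply: le_trans (geometric_le_lim n K0 s0 s1').
by apply: ler_sum => i _; exact: aK.
Qed.

Section dominated_functions.
Context d (T : measurableType d) (R : realType) (V : T -> R).
Hypotheses (mV : measurable_fun setT V) (V1 : forall x, 1 <= V x).

Implicit Types (phi psi : T -> R) (c : R) (x : T) (n : nat).

Definition dominated (phi : T -> R) :=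
  measurable_fun setT phi /\ exists c, forall x, `|phi x| <= c * V x.

Let V0 x : 0 <= V x. Proof. exact: le_trans (V1 x). Qed.

Let mVE : measurable_fun setT (EFin \o V).
Proof. exact/measurable_EFinP. Qed.

Let VE0 x : (0 <= (V x)%:E)%E.
Proof. by rewrite lee_fin. Qed.

Lemma dominated_gt0 phi : dominated phi ->
  exists2 c, 0 < c & forall x, `|phi x| <= c * V x.
Proof.
move=> [_ [c phic]]; exists (`|c| + 1) => [|x]; first by rewrite ltr_wpDl.
by rewrite (le_trans (phic x))// ler_wpM2r// (le_trans (ler_norm c))// lerDl.
Qed.

Lemma dominated_integrable (mu : {measure set T -> \bar R}) phi :
  (\int[mu]_x (V x)%:E < +oo)%E -> dominated phi ->
  mu.-integrable setT (EFin \o phi).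
Proof.
move=> muV dphi; have [mphi _] := dphi; have [c c0 phic] := dominated_gt0 dphi.
apply/integrableP; split; first exact/measurable_EFinP.
apply: (@le_lt_trans _ _ (\int[mu]_x (c%:E * (V x)%:E))%E).
  by apply: ge0_le_integral_nonmeas => x; rewrite ?lee_fin//= -EFinM lee_fin.
rewrite (ge0_integralZl_EFin _ _ (fun x _ => VE0 x) mVE (ltW c0))//.
by rewrite lte_mul_pinfty// lee_fin ltW.
Qed.

Lemma dominatedD phi psi : dominated phi -> dominated psi ->
  dominated (fun x => phi x + psi x).
Proof.
move=> [mphi [c phic]] [mpsi [c' psic]]; split; first exact: measurable_funD.
by exists (c + c') => x; rewrite (le_trans (ler_normD _ _))// mulrDl lerD.
Qed.

Lemma dominatedZ a phi : dominated phi -> dominated (fun x => a * phi x).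
Proof.
move=> [mphi [c phic]]; split; first exact: measurable_funM.
by exists (`|a| * c) => x; rewrite normrM -mulrA ler_wpM2l.
Qed.

Lemma dominatedB phi psi : dominated phi -> dominated psi ->
  dominated (fun x => phi x - psi x).
Proof.
move=> dphi dpsi; have := dominatedD dphi (dominatedZ (-1) dpsi).
by congr dominated; apply/funext => x; rewrite mulN1r.
Qed.

Lemma dominated_cst a : dominated (fun=> a).
Proof. by split=> //; exists `|a| => x; rewrite ler_peMr. Qed.

Lemma dominated_sum n (phi : nat -> T -> R) : (forall i, dominated (phi i)) ->
  dominated (fun x => \sum_(0 <= i < n) phi i x).
Proof.
move=> dphi; elim: n => [|n IH].
  by under eq_fun do rewrite big_geq//; exact: dominated_cst.
by under eq_fun do rewrite big_nat_recr//=; exact: dominatedD.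
Qed.

Section transition_operators.
Variables (Q : R.-pker T ~> T) (lambda b : R).
Hypotheses (lambda01 : 0 < lambda < 1) (b0 : 0 <= b).
Hypothesis QV : forall x, (\int[Q x]_y (V y)%:E <= (lambda * V x + b)%:E)%E.

Definition Pn n (phi : T -> R) x : R := \int[kiter Q n x]_y phi y.

Let B := b / (1 - lambda).

Let B0 : 0 <= B.
Proof. by have /andP[_ l1] := lambda01; rewrite divr_ge0// subr_ge0 ltW. Qed.

Lemma kiterV_lty n x : (\int[kiter Q n x]_y (V y)%:E < +oo)%E.
Proof. by apply: le_lt_trans (drift_kiter mV V1 lambda01 b0 QV n x) _; exact: ltry. Qed.

Lemma dominated_kiter n x phi : dominated phi ->
  (kiter Q n x).-integrable setT (EFin \o phi).
Proof. exact/dominated_integrable/kiterV_lty. Qed.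

Lemma Pn_EFin n phi x : dominated phi ->
  (\int[kiter Q n x]_y (phi y)%:E = (Pn n phi x)%:E)%E.
Proof. by move=> dphi; rewrite Rintegral_EFin//; exact: dominated_kiter. Qed.

Lemma Pn_norm n phi c x : measurable_fun setT phi -> 0 <= c ->
  (forall y, `|phi y| <= c * V y) -> `|Pn n phi x| <= c * (1 + B) * V x.
Proof.
move=> mphi c0 phic; have dphi : dominated phi by split=> //; exists c.
have dphin : dominated (fun y => `|phi y|).
  by split; [exact: measurableT_comp|exists c => y; rewrite normr_id].
rewrite (le_trans (le_normr_Rintegral _ (dominated_kiter _ _ dphi)))//.
rewrite -[X in X <= _]/(Pn n (fun y => `|phi y|) x) -lee_fin -Pn_EFin//.
apply: (@le_trans _ _ (\int[kiter Q n x]_y (c%:E * (V y)%:E))%E).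
  by apply: ge0_le_integral_nonmeas => y; rewrite ?lee_fin//= -EFinM lee_fin.
rewrite (ge0_integralZl_EFin _ _ (fun x _ => VE0 x) mVE c0)//.
rewrite (le_trans (lee_wpmul2l _ (drift_kiter mV V1 lambda01 b0 QV n x)))//.
rewrite -EFinM lee_fin -mulrA ler_wpM2l// mulrDl mul1r lerD2l.
by rewrite ler_peMr.
Qed.

Lemma measurable_Pn n phi : measurable_fun setT phi ->
  measurable_fun setT (Pn n phi).
Proof. exact: measurable_Rintegral_kernel. Qed.

Lemma dominated_Pn n phi : dominated phi -> dominated (Pn n phi).
Proof.
move=> dphi; have [mphi _] := dphi; have [c c0 phic] := dominated_gt0 dphi.
split; first exact: measurable_Pn.
by exists (c * (1 + B)) => x; apply: Pn_norm => //; exact: ltW.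
Qed.

Lemma Pn0 phi x : measurable_fun setT phi -> Pn 0 phi x = phi x.
Proof.
move=> mphi; rewrite /Pn /Rintegral integral_kiter0//.
exact/measurable_EFinP.
Qed.

Lemma PnS n phi x : dominated phi -> Pn n.+1 phi x = \int[Q x]_y Pn n phi y.
Proof.
move=> dphi; have [mphi _] := dphi; rewrite /Pn /Rintegral.
have dis F : measurable_fun setT F -> (forall y, 0 <= F y)%E ->
    measurable_fun setT (fun y => \int[kiter Q n y]_u F u)%E /\
    (\int[kiter Q n.+1 x]_u F u = \int[Q x]_y \int[kiter Q n y]_u F u)%E.
  move=> mF F0; split; last exact: integral_kiterS.
  exact: measurable_integral_kernel.
have [_ ->] := integral_disintegration (h := id) (g := fun _ => id) dis mphi
  (dominated_kiter n.+1 x dphi) (fun y => dominated_kiter n y dphi).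
by congr fine; apply: eq_integral => y _; rewrite Pn_EFin.
Qed.

Lemma Pn1 phi x : dominated phi -> Pn 1 phi x = \int[Q x]_y phi y.
Proof.
move=> dphi; rewrite PnS//; apply: eq_Rintegral => y _; rewrite Pn0//.
by case: dphi.
Qed.

Lemma PnD m n phi x : dominated phi -> Pn (m + n) phi x = Pn m (Pn n phi) x.
Proof.
move=> dphi; have [mphi _] := dphi; elim: m x => [|m IH] x.
  by rewrite Pn0//; exact: measurable_Pn.
rewrite addSn !PnS//; last exact: dominated_Pn.
by apply: eq_Rintegral => y _; exact: IH.
Qed.

Lemma PnB n phi psi x : dominated phi -> dominated psi ->
  Pn n (fun y => phi y - psi y) x = Pn n phi x - Pn n psi x.
Proof. by move=> dphi dpsi; rewrite /Pn RintegralB//; exact: dominated_kiter. Qed.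

Lemma Pn_cst n a x : Pn n (fun=> a) x = a.
Proof. by rewrite /Pn Rintegral_cst// kiter_setT mulr1. Qed.

Lemma Pn_sum n N (phi : nat -> T -> R) x : (forall i, dominated (phi i)) ->
  Pn n (fun y => \sum_(0 <= i < N) phi i y) x = \sum_(0 <= i < N) Pn n (phi i) x.
Proof.
by move=> dphi; apply: Rintegral_sum => i; exact: dominated_kiter.
Qed.

(** The iterates of a function inherit the control of its m-th power, and with it integrability
    against the score. *)
Lemma Pn_powR m n phi c : 1 <= m -> measurable_fun setT phi -> 0 <= c ->
  (forall x, `|phi x| `^ m <= c * V x) ->
  exists2 c', 0 <= c' & forall x, `|Pn n phi x| `^ m <= c' * V x.
Proof.
move=> m1 mphi c0 phic; have m0 : 0 <= m by rewrite (le_trans _ m1).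
have dphi : dominated phi.
  split=> //; exists (1 + c) => x; rewrite mulrDl mul1r.
  rewrite -[leLHS]powRr1// (le_trans (powR_le1D ler01 m1 (normr_ge0 _)))//.
  by rewrite lerD.
exists (2 `^ m * ((c + 1) * (1 + B))).
  by rewrite !mulr_ge0 ?powR_ge0 ?addr_ge0.
(* [c + 1] in place of [c], since the moment inequality asks for a positive bound. *)
move=> x; have A0 : 0 < (c + 1) * (1 + B) * V x.
  rewrite mulr_gt0 ?(lt_le_trans ltr01 (V1 x))// mulr_gt0//.
    by rewrite ltr_wpDl.
  by rewrite ltr_wpDr.
rewrite -mulrA; apply: le_trans (Rintegral_powR_le _ (dominated_kiter n x dphi) m1 A0 _).
- rewrite ge0_ler_powR ?nnegrE ?Rintegral_ge0//.
  exact: le_normr_Rintegral (dominated_kiter n x dphi).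
- by rewrite kiter_setT.
- apply: (@le_trans _ _ (\int[kiter Q n x]_y (c%:E * (V y)%:E))%E).
    by apply: ge0_le_integral_nonmeas => y; rewrite ?lee_fin ?powR_ge0//= -EFinM lee_fin.
  rewrite (ge0_integralZl_EFin _ _ (fun x _ => VE0 x) mVE c0)//.
  rewrite (le_trans (lee_wpmul2l _ (drift_kiter mV V1 lambda01 b0 QV n x)))//.
  rewrite -EFinM lee_fin -mulrA ler_pM ?addr_ge0 ?lerDl// mulrDl mul1r lerD2l.
  by rewrite ler_peMr.
Qed.

(** Dominated convergence under [kiter Q n x]. It is applied twice, each time to partial sums whose
    residuals telescope: in [Poisson_sqrt] and in [Gmean_Poisson]. *)
Lemma Poisson_limit n (u_ : nat -> T -> R) (u t : T -> R) c :
  (forall N, measurable_fun setT (u_ N)) ->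
  (forall N x, `|u_ N x| <= c * V x) ->
  (forall x, u_ N x @[N --> \oo] --> u x) ->
  (forall x, u_ N x - Pn n (u_ N) x @[N --> \oo] --> t x) ->
  forall x, u x - Pn n u x = t x.
Proof.
move=> mu_ u_c u_u u_t x; apply/esym/(cvg_unique _ (u_t x)) => //.
apply: cvgB => //; apply: (@dominated_cvg_Rintegral _ _ _ _ _ _ (fun x => c * V x)) => //.
- by apply: (measurable_fun_cvg mu_) => y _; exact: u_u.
- exact/aeW.
- apply: dominated_kiter; split; first exact: measurable_funM.
  by exists `|c| => y; rewrite normrM [`|V y|]ger0_norm.
- exact/aeW.
Qed.

End transition_operators.

End dominated_functions.

(** * Poisson equations *)

(** A path that leaves the diagonal does so at some step; each of these countably many events is
    null by the last clause of [coupling]. *)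
Lemma diag_absorbing d (T : measurableType d) (R : realType)
    (Q : R.-pker T ~> T) (Qb : R.-pker (T * T)%type ~> (T * T)%type)
    dO (O : measurableType dO) (Pr : {measure set O -> \bar R}) Gs
    (W : nat -> O -> T * T) :
  coupling Q Qb -> adapted_chain Pr Gs Qb W ->
  {ae Pr, forall w, forall i j, (i <= j)%N -> diag (W i w) -> diag (W j w)}.
Proof.
move=> [mdiag _ _ Qdiag] WP; have [_ sG _ WG QW] := WP.
pose N i := W i @^-1` @diag d T `&` W i.+1 @^-1` (~` @diag d T).
have mW i B : measurable B -> measurable (W i @^-1` B).
  by move=> mB; apply: (sG i).2; exact: WG.
have mN i : measurable (N i).
  by apply: measurableI; apply: mW => //; exact: measurableC.
have N0 i : Pr (N i) = 0%E.
  rewrite QW; [|exact: WG|exact: measurableC].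
  rewrite integral_mkcond integral0_eq// => w _; rewrite patchE.
  case: ifPn => // /set_mem; rewrite /diag /=.
  by case: (W i w) => x y /= ->; exact: Qdiag.
exists (\bigcup_i N i); split.
- exact: bigcup_measurable.
- apply/eqP; rewrite eq_le measure_ge0 andbT.
  apply: le_trans (measure_sigma_subadditive _ _ _ (@subset_refl _ _)) _ => //.
    exact: bigcup_measurable.
  by rewrite eseries0// => i _ _; exact: N0.
move=> w /= nall; apply: contrapT => nN; apply: nall => i j ij Wi.
elim: j ij => [|j IH]; first by rewrite leqn0 => /eqP <-.
rewrite leq_eqVlt => /predU1P[<-//|]; rewrite ltnS => /IH Wj.
by apply: contrapT => Wj1; apply: nN; exists j.
Qed.

Section Poisson_equations.
Context d (T : measurableType d) (R : realType).
Variables (Q : R.-pker T ~> T) (Qb : R.-pker (T * T)%type ~> (T * T)%type).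
Variables (V : T -> R) (lambda b : R).
Hypotheses (mV : measurable_fun setT V) (V1 : forall x, 1 <= V x).
Hypotheses (lambda01 : 0 < lambda < 1) (b0 : 0 <= b).
Hypothesis QV : forall x, (\int[Q x]_y (V y)%:E <= (lambda * V x + b)%:E)%E.
Variables (pi0 : probability T R) (R1 s1 : R).
Hypothesis invpi : invariant Q pi0.
Hypotheses (R10 : 0 <= R1) (s101 : 0 < s1 < 1).
Hypothesis ergV : forall g : T -> R, measurable_fun setT g -> (forall y, `|g y| <= V y) ->
  forall x n, (0 < n)%N ->
  `|Pn Q n g x - \int[pi0]_y g y| <= R1 * V x * s1 ^+ n.
Hypothesis ergS : forall g : T -> R, measurable_fun setT g ->
  (forall y, `|g y| <= Num.sqrt (V y)) -> forall x n, (0 < n)%N ->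
  `|Pn Q n g x - \int[pi0]_y g y| <= R1 * Num.sqrt (V x) * s1 ^+ n.

Let B := b / (1 - lambda).
Let V0 x : 0 <= V x. Proof. exact: le_trans (V1 x). Qed.

Let B0 : 0 <= B.
Proof. by have /andP[_ l1] := lambda01; rewrite divr_ge0// subr_ge0 ltW. Qed.

Lemma piV_le : (\int[pi0]_x (V x)%:E <= B%:E)%E.
Proof. exact: (drift_invariant mV V1 lambda01 b0 QV invpi). Qed.

Lemma piV_lty : (\int[pi0]_x (V x)%:E < +oo)%E.
Proof. by apply: le_lt_trans piV_le _; exact: ltry. Qed.

Lemma invariant_Pn n phi : dominated V phi ->
  \int[pi0]_x Pn Q n phi x = \int[pi0]_x phi x.
Proof.
elim: n phi => [|n IH] phi dphi.
  by apply: eq_Rintegral => x _; rewrite Pn0//; exact: dphi.1.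
under eq_Rintegral do rewrite -addn1 (PnD mV V1 lambda01 b0 QV n 1 _ dphi).
rewrite IH; last exact: (dominated_Pn mV V1 lambda01 b0 QV).
have iQ x : (Q x).-integrable setT (EFin \o phi).
  apply: (dominated_integrable mV V1) dphi.
  exact: le_lt_trans (QV x) (ltry _).
have dis F : measurable_fun setT F -> (forall y, 0 <= F y)%E ->
    measurable_fun setT (fun x => \int[Q x]_y F y)%E /\
    (\int[pi0]_x F x = \int[pi0]_x \int[Q x]_y F y)%E.
  move=> mF F0; split; first exact: measurable_integral_kernel.
  by rewrite (invariant_integral invpi).
have [_ E] := integral_disintegration (h := id) (g := fun _ => id) dis dphi.1
  (dominated_integrable mV V1 piV_lty dphi) iQ.
rewrite /Rintegral E; congr fine; apply: eq_integral => x _.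
by rewrite (Pn1 mV V1 lambda01 b0 QV)// Rintegral_EFin.
Qed.

Lemma ergodic_dominated (phi : T -> R) c : measurable_fun setT phi -> 0 < c ->
  (forall x, `|phi x| <= c * V x) -> forall x n, (0 < n)%N ->
  `|Pn Q n phi x - \int[pi0]_y phi y| <= c * R1 * V x * s1 ^+ n.
Proof.
move=> mphi c0 phic x n n0.
have dphi : dominated V phi by split=> //; exists c.
have := ergV (g := fun y => c^-1 * phi y) _ _ x n0.
rewrite {1}/Pn RintegralZl//; last exact: (dominated_kiter mV V1 lambda01 b0 QV n x dphi).
rewrite RintegralZl//; last exact: (dominated_integrable mV V1 piV_lty dphi).
rewrite -mulrBr normrM ger0_norm ?invr_ge0 ?(ltW c0)// => h.
rewrite -!mulrA [R1 * _]mulrA -ler_pdivrMl// h//.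
- exact: measurable_funM.
- move=> y; rewrite normrM ger0_norm ?invr_ge0 ?(ltW c0)//.
  by rewrite ler_pdivrMl.
Qed.

Lemma ergodic_cvg phi x : dominated V phi ->
  Pn Q n phi x @[n --> \oo] --> \int[pi0]_y phi y.
Proof.
move=> dphi; have [mphi _] := dphi; have [c c0 phic] := dominated_gt0 V1 dphi.
have /andP[s0 s1'] := s101.
have u0 : c * R1 * V x * s1 ^+ n @[n --> \oo] --> 0.
  by apply: cvg_geometric; rewrite gtr0_norm.
apply/subr_cvg0/norm_cvg0P; apply: (squeeze_cvgr _ _ u0); last exact: cvg_cst.
near=> n; rewrite normr_ge0/=; apply: ergodic_dominated => //.
by near: n; exact: nbhs_infty_gt.
Unshelve. all: by end_near.
Qed.

Let sqrtV x : Num.sqrt (V x) <= V x.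
Proof. exact: sqrtr_le. Qed.

(** The solution is the series of [Pn Q i u - pu]. That [c] serves every [u] at once matters: in
    [invariant_Lipschitz] the function [u] varies with the parameter. *)
Lemma Poisson_sqrt : exists2 c, 0 <= c & forall u : T -> R, measurable_fun setT u ->
  (forall y, `|u y| <= Num.sqrt (V y)) ->
  exists uh : T -> R, [/\ measurable_fun setT uh,
    forall x, `|uh x| <= c * Num.sqrt (V x) &
    forall x, uh x - Pn Q 1 uh x = u x - \int[pi0]_y u y].
Proof.
have /andP[s0 s1'] := s101.
(* The ergodic bound starts at time 1; [1 + B] takes care of the term at time 0, where [B] bounds
   the stationary mean of [V]. *)
pose c := (1 + B + R1) / (1 - s1).
have c00 : 0 <= 1 + B + R1 by rewrite !addr_ge0.
exists c; first by rewrite divr_ge0// subr_ge0 ltW.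
move=> u mu uV; set pu := \int[pi0]_y u y.
have du : dominated V u by split=> //; exists 1 => x; rewrite mul1r (le_trans (uV x)).
have puB : `|pu| <= B.
  have iu := dominated_integrable mV V1 piV_lty du.
  rewrite (le_trans (le_normr_Rintegral _ iu))// -lee_fin -Rintegral_EFin.
    apply: le_trans piV_le; apply: ge0_le_integral_nonmeas => x; rewrite lee_fin//.
    exact: le_trans (uV x) _.
  exact: integrable_norm iu.
have sV1 x : 1 <= Num.sqrt (V x) by rewrite -sqrtr1 ler_wsqrtr.
pose a x i := Pn Q i u x - pu.
have aK x i : `|a x i| <= (1 + B + R1) * Num.sqrt (V x) * s1 ^+ i.
  case: i => [|i].
    rewrite /a Pn0// expr0 mulr1 (le_trans (ler_normB _ _))//.
    rewrite -[leLHS]addr0 [leRHS]mulrDl lerD ?mulr_ge0 ?sqrtr_ge0//.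
    by rewrite mulrDl mul1r lerD// (le_trans puB)// ler_peMr.
  rewrite (le_trans (ergS mu uV x (ltn0Sn i)))//.
  by rewrite !ler_wpM2r ?exprn_ge0 ?sqrtr_ge0 ?(ltW s0)// lerDr addr_ge0.
have KV0 x : 0 <= (1 + B + R1) * Num.sqrt (V x) by rewrite mulr_ge0 ?sqrtr_ge0.
have cvga x := geometric_dominated_series (KV0 x) s101 (aK x).
pose u_ N x := series (a x) N.
have u_c N x : `|u_ N x| <= c * Num.sqrt (V x).
  by rewrite (le_trans ((cvga x).2 N))// /c mulrAC.
have da i : dominated V (fun x => a x i).
  by apply: dominatedB (dominated_cst V1 pu); exact: (dominated_Pn mV V1 lambda01 b0 QV).
pose uh x := limn (series (a x)).
have u_uh x : u_ N x @[N --> \oo] --> uh x by exact: (cvga x).1.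
have du_ N : dominated V (u_ N) by exact: dominated_sum.
have mu_ N : measurable_fun setT (u_ N) by case: (du_ N).
exists uh; split.
- by apply: (measurable_fun_cvg mu_) => x _; exact: u_uh.
- move=> x; have h : `|u_ N x| @[N --> \oo] --> `|uh x| by apply: cvg_norm; exact: u_uh.
  rewrite -(cvg_lim _ h)//; apply: limr_le; first by apply/cvg_ex; exists `|uh x|.
  by apply: nearW => N; exact: u_c.
apply: (Poisson_limit mV V1 lambda01 b0 QV (c := c) mu_ _ u_uh) => [N x|x].
  rewrite (le_trans (u_c N x))// ler_wpM2l//.
  by rewrite divr_ge0// subr_ge0 ltW.
have -> : (fun N => u_ N x - Pn Q 1 (u_ N) x) = (fun N => u x - Pn Q N u x).
  apply/funext => N; rewrite (Pn_sum mV V1 lambda01 b0 QV)// /u_ /series/= -sumrB.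
  rewrite (eq_bigr (fun i => Pn Q i u x - Pn Q i.+1 u x)); last first.
    move=> i _; rewrite /a (PnB mV V1 lambda01 b0 QV) ?Pn_cst//; last 2 first.
    - exact: (dominated_Pn mV V1 lambda01 b0 QV).
    - exact: dominated_cst.
    by rewrite -(PnD mV V1 lambda01 b0 QV)// add1n; ring.
  by rewrite (telescope_sumr_eq (fun i => - Pn Q i u x)) ?Pn0//;
    [ring|move=> i _; ring].
by apply: cvgB; [exact: cvg_cst|exact: ergodic_cvg].
Qed.

End Poisson_equations.

Section Poisson_coupling.
Context d (T : measurableType d) (R : realType).
Variables (Q : R.-pker T ~> T) (Qb : R.-pker (T * T)%type ~> (T * T)%type).
Variables (V : T -> R) (lambda b : R).
Hypotheses (mV : measurable_fun setT V) (V1 : forall x, 1 <= V x).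
Hypotheses (lambda01 : 0 < lambda < 1) (b0 : 0 <= b).
Hypothesis QV : forall x, (\int[Q x]_y (V y)%:E <= (lambda * V x + b)%:E)%E.
Hypothesis cQ : coupling Q Qb.
Context dC (OC : measurableType dC) (C : R.-pker (T * T)%type ~> OC)
  (WC : nat -> OC -> T * T).
Hypothesis CP : forall xz, markov_chain (C xz) Qb \d_xz WC.
Variables (M rho : R).
Hypotheses (M0 : 0 <= M) (rho01 : 0 < rho < 1).
Hypothesis Ctail : forall (x z : T) (t : nat),
  (C (x, z) [set w | time_gt (meeting (WC ^~ w)) t]
  <= (M * (V x + V z) * rho ^+ t)%:E)%E.
Variables (pi0 : probability T R) (R1 s1 : R).
Hypothesis invpi : invariant Q pi0.
Hypotheses (R10 : 0 <= R1) (s101 : 0 < s1 < 1).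
Hypothesis ergV : forall g : T -> R, measurable_fun setT g ->
  (forall y, `|g y| <= V y) -> forall x n, (0 < n)%N ->
  `|Pn Q n g x - \int[pi0]_y g y| <= R1 * V x * s1 ^+ n.
Variables (f : T -> R) (L : nat) (e Cf m : R) (z : T).
Hypotheses (mf : measurable_fun setT f) (L1 : (1 <= L)%N).
Hypotheses (m1 : 1 <= m) (me : m < e) (Cf0 : 0 <= Cf).
Hypothesis fV : forall x, `|f x| `^ e <= Cf * V x.

Local Notation PT := (path_space (T * T)%type).
Local Notation mpath := (measurable_WC CP).

Let V0 x : 0 <= V x. Proof. exact: le_trans (V1 x). Qed.

Lemma f_dominated : dominated V f.
Proof.
split=> //; exists (1 + Cf) => x; rewrite mulrDl mul1r.
have e1 : 1 <= e by rewrite (le_trans m1)// ltW.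
rewrite -[leLHS]powRr1// (le_trans (powR_le1D ler01 e1 (normr_ge0 _)))//.
by rewrite lerD.
Qed.

Definition Gmean (x : T) : R := \int[C (x, z)]_w Gval f L (WC ^~ w).

Let mGv : measurable_fun setT (fun w => Gval f L (WC ^~ w)).
Proof.
by apply: (measurableT_comp (measurable_Gval L mf _) mpath); case: cQ.
Qed.

Let mGa : measurable_fun setT (fun w => Gabs f L (WC ^~ w)).
Proof.
by apply: (measurableT_comp (measurable_Gabs L mf _) mpath); case: cQ.
Qed.

Lemma Gabs_mean_bound : exists2 K, 0 < K & forall x,
  (\int[C (x, z)]_w (Gabs f L (WC ^~ w) `^ m)%:E <= (K * V x)%:E)%E.
Proof.
have [K K0 GK] := Gabs_moment mV V1 lambda01 b0 QV cQ CP M0 rho01 Ctail mf L1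
  m1 me Cf0 fV.
exists (K * (1 + V z) + 1).
  by rewrite ltr_wpDl ?mulr_ge0 ?addr_ge0.
move=> x; apply: (le_trans (GK x z)); rewrite lee_fin mulrDl mul1r.
rewrite -[leLHS]addr0 lerD// -mulrA ler_wpM2l// mulrDl mul1r lerD2l.
by rewrite ler_peMr.
Qed.

Lemma Gabs_integrable x :
  (C (x, z)).-integrable setT (fun w => (Gabs f L (WC ^~ w))%:E).
Proof.
have [K K0 GK] := Gabs_mean_bound.
apply/integrableP; split; first exact/measurable_EFinP.
have mGm : measurable_fun setT (fun w => (Gabs f L (WC ^~ w) `^ m)).
  exact: (measurableT_comp (measurable_powR m)).
apply: (@le_lt_trans _ _ (\int[C (x, z)]_w (1 + (Gabs f L (WC ^~ w) `^ m)%:E))%E).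
  apply: ge0_le_integral_nonmeas => w //=; rewrite -EFinD lee_fin.
  rewrite ger0_norm ?Gabs_ge0// -[leLHS]powRr1 ?Gabs_ge0//.
  by apply: powR_le1D; rewrite ?Gabs_ge0.
rewrite ge0_integralD//; [|by move=> w _; rewrite lee_fin powR_ge0|exact/measurable_EFinP].
rewrite integral_cst// mul1e [X in (X + _)%E]prob_kernel.
by rewrite lte_add_pinfty ?ltry// (le_lt_trans (GK x))// ltry.
Qed.

Lemma measurable_Gmean : measurable_fun setT Gmean.
Proof.
have mxz : measurable_fun setT (fun x : T => (x, z)) by exact: measurable_fun_pair.
exact: (measurable_Rintegral_kernel (kernel_pre C mxz) mGv).
Qed.

Let Gabs_mean x : R := \int[C (x, z)]_w Gabs f L (WC ^~ w).

Let Gmean_le x : `|Gmean x| <= Gabs_mean x.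
Proof.
have iG : (C (x, z)).-integrable setT (fun w => (Gval f L (WC ^~ w))%:E).
  apply: le_integrable (Gabs_integrable x) => //; first exact/measurable_EFinP.
  move=> w _; rewrite /= lee_fin (le_trans (normr_Gval f L _))//.
  exact: ler_norm.
rewrite (le_trans (le_normr_Rintegral _ iG))//.
apply: le_Rintegral => //.
- exact: integrable_norm iG.
- exact: Gabs_integrable.
- by move=> w _; exact: normr_Gval.
Qed.

Lemma Gabs_mean_powR : exists2 K, 0 <= K & forall x, Gabs_mean x `^ m <= K * V x.
Proof.
have [K K0 GK] := Gabs_mean_bound.
exists (2 `^ m * K); first by rewrite mulr_ge0 ?powR_ge0// ltW.
move=> x; have A0 : 0 < K * V x by rewrite mulr_gt0// (lt_le_trans ltr01).
rewrite -mulrA; apply: le_trans (Rintegral_powR_le _ (Gabs_integrable x) m1 A0 _).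
- rewrite /Gabs_mean; under [X in _ <= X `^ _]eq_Rintegral do
    rewrite ger0_norm ?Gabs_ge0//.
  exact: lexx.
- by rewrite prob_kernel.
- by under eq_integral do rewrite ger0_norm ?Gabs_ge0//; exact: GK.
Qed.

Lemma Gmean_powR : exists2 K, 0 <= K & forall x, `|Gmean x| `^ m <= K * V x.
Proof.
have [K K0 GK] := Gabs_mean_powR; exists K => // x.
rewrite (le_trans _ (GK x))// ge0_ler_powR ?nnegrE ?(le_trans _ m1)//.
by apply: Rintegral_ge0 => w _; exact: Gabs_ge0.
Qed.

(** Truncated after [N] terms, the sum in [G] has a mean [u_ N] that involves the two marginal
    chains only; its residual telescopes to [f - Pn Q (N * L) f], the terms in [z] being constants.
    The truncated sums converge to [G] because the pair almost surely stays on the diagonal once it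
    has met. *)
Lemma Gmean_Poisson x : Gmean x - Pn Q L Gmean x = f x - \int[pi0]_y f y.
Proof.
have [K K0 GK] := Gabs_mean_powR.
have df := f_dominated.
pose a i (w : OC) := f (WC (i * L)%N w).1 - f (WC (i * L)%N w).2.
have mW i : measurable_fun setT (WC i) by case: (CP (x, z)).
have mf1 i : measurable_fun setT (fun w => f (WC i w).1).
  exact: (measurableT_comp mf (measurableT_comp measurable_fst (mW i))).
have mf2 i : measurable_fun setT (fun w => f (WC i w).2).
  exact: (measurableT_comp mf (measurableT_comp measurable_snd (mW i))).
have int1 y i : (C (y, z)).-integrable setT (fun w => (f (WC i w).1)%:E) /\
    \int[C (y, z)]_w f (WC i w).1 = Pn Q i f y.
  split; last first.
    congr fine; apply: (integral_transfer (h2 := id)) => // F mF F0.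
    exact: (coupled_fst cQ CP (y, z) i mF F0).
  apply/integrableP; split; first exact/measurable_EFinP.
  rewrite (coupled_fst cQ CP (y, z) i (F := fun u => `|(f u)%:E|%E))//; last first.
    by apply: measurableT_comp => //; exact/measurable_EFinP.
  by have /integrableP[] := dominated_kiter mV V1 lambda01 b0 QV i y df.
have int2 y i : (C (y, z)).-integrable setT (fun w => (f (WC i w).2)%:E) /\
    \int[C (y, z)]_w f (WC i w).2 = Pn Q i f z.
  split; last first.
    congr fine; apply: (integral_transfer (h2 := id)) => // F mF F0.
    exact: (coupled_snd cQ CP (y, z) i mF F0).
  apply/integrableP; split; first exact/measurable_EFinP.
  rewrite (coupled_snd cQ CP (y, z) i (F := fun u => `|(f u)%:E|%E))//; last first.
    by apply: measurableT_comp => //; exact/measurable_EFinP.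
  by have /integrableP[] := dominated_kiter mV V1 lambda01 b0 QV i z df.
pose u_ N y := \int[C (y, z)]_w (\sum_(0 <= i < N) a i w).
have u_E N y : u_ N y = \sum_(0 <= i < N) (Pn Q (i * L) f y - Pn Q (i * L) f z).
  rewrite /u_; elim: N => [|N IH].
    rewrite big_geq//; under eq_Rintegral do rewrite big_geq//.
    by rewrite Rintegral_cst// mul0r.
  rewrite big_nat_recr//= -IH.
  have ia i : (C (y, z)).-integrable setT (EFin \o a i).
    have := integrableB measurableT (int1 y (i * L)%N).1 (int2 y (i * L)%N).1.
    by apply: eq_integrable.
  have isum n : (C (y, z)).-integrable setT
      (EFin \o (fun w => \sum_(0 <= i < n) a i w)).
    have -> : EFin \o (fun w => \sum_(0 <= i < n) a i w) =
        (fun w => \sum_(0 <= i < n) (a i w)%:E)%E.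
      by apply/funext => w; rewrite /= sumEFin.
    by apply: (integrable_sum measurableT) => i _; exact: ia.
  under eq_Rintegral do rewrite big_nat_recr//=.
  rewrite RintegralD//; congr (_ + _).
  have [i1 e1] := int1 y (N * L)%N; have [i2 e2] := int2 y (N * L)%N.
  by rewrite -e1 -e2 -(RintegralB measurableT i1 i2).
have ae y : {ae C (y, z), forall w,
    (\sum_(0 <= i < N) a i w) @[N --> \oo] --> Gval f L (WC ^~ w) /\
    forall N, `|\sum_(0 <= i < N) a i w| <= Gabs f L (WC ^~ w)}.
  have C1 : C (y, z) setT = 1%E by exact: prob_kernel.
  have abs := diag_absorbing cQ (markov_chain_adapted C1 (CP (y, z))).
  have fin := meeting_finite V1 cQ CP M0 rho01 Ctail y z.
  apply: filterS2 abs fin => w absw.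
  rewrite /Gval /Gabs; case E : (meeting (WC ^~ w)) => [t|//] _.
  (* [t %/ L < i] means [t < i * L]: the term [i] is read after the meeting. *)
  have at0 i : (t %/ L < i)%N -> a i w = 0.
    move=> ti; have Wt : diag (WC t w) := ((first_time_Some _ _).1 E).1.
    have := absw t (i * L)%N; rewrite /a => -> //; first by rewrite subrr.
    by rewrite ltnW// -ltn_divLR// (leq_trans _ L1).
  have big0 N : (t %/ L < N)%N -> \sum_(0 <= i < N) a i w =
      \sum_(0 <= i < (t %/ L).+1) a i w.
    move=> tN; rewrite (big_cat_nat (n := (t %/ L).+1))//= [X in _ + X]big_nat_cond.
    rewrite [X in _ + X]big1 ?addr0// => i; rewrite andbT => /andP[ti _].
    exact: at0.
  split.
    by apply: cvg_near_cst; near=> N; apply: big0; near: N; exact: nbhs_infty_gt.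
  move=> N; apply: (le_trans (ler_norm_sum _ _ _)).
  have [tN|Nt] := ltnP (t %/ L) N.
    rewrite (big_cat_nat (n := (t %/ L).+1))//= [X in _ + X]big_nat_cond.
    rewrite [X in _ + X]big1 ?addr0// => i; rewrite andbT => /andP[ti _].
    by rewrite at0// normr0.
  rewrite [leRHS](big_cat_nat (n := N))//= ?ltnS// ?(leq_trans Nt)//.
  by rewrite lerDl sumr_ge0.
have ma i : measurable_fun setT (a i) by exact: measurable_funB.
have msum N : measurable_fun setT (fun w => \sum_(0 <= i < N) a i w).
  exact: measurable_sum.
have u_u y : u_ N y @[N --> \oo] --> Gmean y.
  apply: (dominated_cvg_Rintegral msum mGv _ (Gabs_integrable y)).
    by apply: filterS (ae y) => w [].
  by apply: filterS (ae y) => w [].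
have u_c N y : `|u_ N y| <= (1 + K) * V y.
  have ia : (C (y, z)).-integrable setT (EFin \o (fun w => \sum_(0 <= i < N) a i w)).
    apply/integrableP; split; first exact/measurable_EFinP.
    have /integrableP[_] := Gabs_integrable y; apply: le_lt_trans.
    apply: ae_ge0_le_integral => //.
    - by apply: measurableT_comp => //; exact/measurable_EFinP.
    - by apply: measurableT_comp => //; exact/measurable_EFinP.
    - apply: filterS (ae y) => w [_ h] _ /=; rewrite lee_fin (le_trans (h N))//.
      exact: ler_norm.
  apply: (@le_trans _ _ (Gabs_mean y)).
    rewrite (le_trans (le_normr_Rintegral _ ia))//.
    rewrite -lee_fin -!Rintegral_EFin; last 2 first.
    - exact: Gabs_integrable.
    - exact: (integrable_norm ia).
    apply: ae_ge0_le_integral => //.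
    - exact/measurable_EFinP/measurableT_comp.
    - by move=> w _; rewrite lee_fin Gabs_ge0.
    - exact/measurable_EFinP.
    - by apply: filterS (ae y) => w [_ h] _; rewrite lee_fin.
  have g0 : 0 <= Gabs_mean y by apply: Rintegral_ge0 => w _; exact: Gabs_ge0.
  rewrite -[leLHS]powRr1// (le_trans (powR_le1D ler01 m1 g0))// mulrDl mul1r.
  by rewrite lerD.
have du_ N : dominated V (u_ N).
  rewrite (_ : u_ N = fun y => \sum_(0 <= i < N) (Pn Q (i * L) f y - Pn Q (i * L) f z)).
    apply: dominated_sum => // i; apply: dominatedB; last exact: dominated_cst.
    exact: (dominated_Pn mV V1 lambda01 b0 QV).
  by apply/funext => y; exact: u_E.
apply: (Poisson_limit (t := fun y => f y - \int[pi0]_v f v) mV V1 lambda01 b0 QV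
  (fun N => (du_ N).1) u_c u_u) => y.
have -> : (fun N => u_ N y - Pn Q L (u_ N) y) = (fun N => f y - Pn Q (N * L) f y).
  apply/funext => N; rewrite u_E.
  have -> : u_ N = fun y => \sum_(0 <= i < N) (Pn Q (i * L) f y - Pn Q (i * L) f z).
    by apply/funext => y'; exact: u_E.
  have dPn n := dominated_Pn mV V1 lambda01 b0 QV n df.
  rewrite (Pn_sum mV V1 lambda01 b0 QV); last first.
    by move=> i; apply: dominatedB => //; exact: dominated_cst.
  rewrite -sumrB (eq_bigr (fun i => Pn Q (i * L) f y - Pn Q (i.+1 * L) f y)); last first.
    move=> i _; rewrite (PnB mV V1 lambda01 b0 QV) ?Pn_cst//; last exact: dominated_cst.
    by rewrite -(PnD mV V1 lambda01 b0 QV)// mulSn; ring.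
  by rewrite (telescope_sumr_eq (fun i => - Pn Q (i * L) f y)) ?mul0n ?Pn0//;
    [ring|move=> i _; ring].
apply: cvgB; first exact: cvg_cst.
have NL : (N * L)%N @[N --> \oo] --> \oo.
  apply/cvgnyPge => A; near=> N; apply: (@leq_trans N); last exact: leq_pmulr.
  by near: N; exact: nbhs_infty_ge.
exact: (cvg_comp (fun N => N * L)%N (fun n => Pn Q n f y) NL
  (ergodic_cvg mV V1 lambda01 b0 QV invpi s101 ergV y df)).
Unshelve. all: by end_near.
Qed.

End Poisson_coupling.

(** * Derivative of the invariant mean *)

Section densities.
Local Open Scope ereal_scope.
Context d (T : measurableType d) (R : realType)
  (m m' : {measure set T -> \bar R}) (p : T -> R).
Hypotheses (mp : measurable_fun setT p) (p0 : forall x, (0 <= p x)%R).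
Hypothesis pm : forall B, measurable B -> m' B = \int[m]_(x in B) (p x)%:E.

Import HBNNSimple.

Lemma ge0_integral_density (F : T -> \bar R) :
  measurable_fun setT F -> (forall x, 0 <= F x) ->
  \int[m']_x F x = \int[m]_x ((p x)%:E * F x).
Proof.
move=> mF F0; pose h := nnsfun_approx measurableT mF.
have hF x : (h n x)%:E @[n --> \oo] --> F x by exact: cvg_nnsfun_approx.
have nd_h x : {homo (fun n => (h n x)%:E) : a b / (a <= b)%N >-> a <= b}.
  by move=> a c ac; rewrite lee_fin; exact/lefP/nd_nnsfun_approx.
have mh n : measurable_fun setT (fun x => (h n x)%:E) by exact/measurable_EFinP.
have mpE : measurable_fun setT (fun x => (p x)%:E) by exact/measurable_EFinP.
have pE0 x : 0 <= (p x)%:E by rewrite lee_fin.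
transitivity (limn (fun n => \int[m']_x (h n x)%:E)).
  rewrite -monotone_convergence//.
  - by apply: eq_integral => x _; apply/esym/cvg_lim => //; exact: hF.
  - by move=> n x _; rewrite lee_fin.
transitivity (limn (fun n => \int[m]_x ((p x)%:E * (h n x)%:E))); last first.
  rewrite -monotone_convergence//.
  - by apply: eq_integral => x _; apply/cvg_lim => //; apply: cvgeZl => //; exact: hF.
  - by move=> n; exact: emeasurable_funM.
  - by move=> n x _; rewrite mule_ge0 ?lee_fin.
  - by move=> x _ a c ac; rewrite lee_wpmul2l//; exact: nd_h.
congr (limn _); apply/funext => n.
have mi r : measurable_fun setT (fun x => (\1_(h n @^-1` [set r]) x : R)%:E).
  by apply/measurable_EFinP; exact: measurable_indic.
have r0 r : (exists x, h n x = r) -> (0 <= r)%R by move=> [x <-].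
transitivity (\sum_(r \in range (h n)) \int[m']_x (r * \1_(h n @^-1` [set r]) x)%:E).
  rewrite -ge0_integral_fsum//.
  - by apply: eq_integral => x _; rewrite fimfunE -fsumEFin.
  - by move=> r; under eq_fun do rewrite EFinM; exact: measurable_funeM.
  - by move=> r x _; rewrite EFinM nnfun_muleindic_ge0.
transitivity (\sum_(r \in range (h n))
    \int[m]_x ((p x)%:E * (r * \1_(h n @^-1` [set r]) x)%:E)); last first.
  rewrite -ge0_integral_fsum//.
  - apply: eq_integral => x _; rewrite [in RHS]fimfunE -fsumEFin//.
    rewrite ge0_mule_fsumr// => r; rewrite EFinM; exact: nnfun_muleindic_ge0.
  - move=> r; apply: emeasurable_funM => //.
    by under eq_fun do rewrite EFinM; exact: measurable_funeM.
  - by move=> r x _; rewrite mule_ge0// EFinM nnfun_muleindic_ge0.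
apply: eq_fsbigr => r /set_mem [x _ hx].
have rr : (0 <= r)%R by apply: r0; exists x.
have mE : measurable (h n @^-1` [set r]) by [].
under eq_integral do rewrite EFinM.
have i0 y : 0 <= (\1_(h n @^-1` [set r]) y : R)%:E by rewrite lee_fin.
rewrite (ge0_integralZl_EFin _ _ (fun y _ => i0 y) (mi r) rr)//.
rewrite integral_indic// setIT pm//.
under [RHS]eq_integral do rewrite EFinM muleCA.
have pi0 y : 0 <= (p y)%:E * (\1_(h n @^-1` [set r]) y : R)%:E.
  by rewrite mule_ge0.
rewrite (ge0_integralZl_EFin _ _ (fun y _ => pi0 y) (emeasurable_funM mpE (mi r)) rr)//.
congr (_ * _); rewrite integral_mkcond; apply: eq_integral => y _.
by rewrite patchE indicE; case: ifPn => _; rewrite ?mule1 ?mule0.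
Qed.

Lemma integral_density (F : T -> R) : measurable_fun setT F ->
  \int[m']_x (F x)%:E = \int[m]_x (p x * F x)%:E.
Proof.
move=> mF; rewrite [LHS]integralE [RHS]integralE.
have mFE : measurable_fun setT (EFin \o F) by exact/measurable_EFinP.
rewrite !ge0_integral_density//; last 2 first.
- exact: measurable_funeneg.
- exact: measurable_funepos.
congr (_ - _); apply: eq_integral => x _.
  rewrite !funeposE -[0 in RHS]/(0%:E) -!EFin_max -EFinM; congr EFin.
  by rewrite maxr_pMr// mulr0.
rewrite !funenegE -!EFinN -!EFin_max -EFinM; congr EFin.
by rewrite maxr_pMr// mulr0 mulrN.
Qed.

Lemma integrable_density (F : T -> R) : measurable_fun setT F ->
  m'.-integrable setT (EFin \o F) ->
  m.-integrable setT (fun x => (p x * F x)%:E).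
Proof.
move=> mF /integrableP[_ iF]; apply/integrableP; split.
  by apply/measurable_EFinP; exact: measurable_funM.
rewrite ge0_integral_density// in iF; last first.
  by apply: measurableT_comp => //; exact/measurable_EFinP.
apply: le_lt_trans iF; rewrite le_eqVlt; apply/orP; left; apply/eqP.
by apply: eq_integral => x _; rewrite EFinM abseM gee0_abs// lee_fin.
Qed.

End densities.

Lemma is_derive_quotient (R : realType) (g : R -> R) (u l : R) :
  (fun t => (g t - g u) / (t - u)) @ u^' --> l -> is_derive u 1 g l.
Proof.
move=> gl; have shift0 : (fun h : R => h + u) @ 0^' --> u^'.
  move=> A /nbhs_ballP[r /= r0 rA]; apply/nbhs_ballP; exists r => // h /= hr h0.
  apply: rA; first by move: hr; rewrite /ball/= sub0r opprD addrCA subrr addr0.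
  by rewrite -subr_eq0 addrK.
have := cvg_comp _ _ shift0 gl; rewrite /comp/= => cvgq.
have cvgD : h^-1 *: ((g \o shift u) (h *: 1) - g u) @[h --> 0^'] --> l.
  apply: cvg_trans cvgq; apply: near_eq_cvg; near=> h.
  by rewrite /= addrK [h *: 1]mulr1 mulrC.
by apply: DeriveDef; [apply/cvg_ex; exists l|exact/cvg_lim].
Unshelve. all: by end_near.
Qed.

Section C1_functions.
Context (R : realType) (a e : R) (g dg : R -> R).
Hypotheses (e0 : 0 < e).
Hypothesis gC1 : C1_on [set t | `|t - a| <= e] g dg.

Let nearI u : `|u - a| < e -> \forall t \near u, `|t - a| <= e.
Proof.
move=> ua; have eu : 0 < e - `|u - a| by rewrite subr_gt0.
near=> t; have -> : t - a = (t - u) + (u - a) by ring.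
rewrite (le_trans (ler_normD _ _))// -lerBrDr ltW// distrC.
Unshelve. all: by end_near.
Qed.

(** At an interior point the limit within the interval is a two-sided one. *)
Lemma C1_on_cvg u : `|u - a| < e ->
  (fun t => (g t - g u) / (t - u)) @ u^' --> dg u.
Proof.
move=> ua; apply: cvg_trans (gC1.1 u (ltW ua)).
apply: cvg_app => A /= IA.
have nI : \forall t \near u^', `|t - a| <= e by apply: nbhs_dnbhs; exact: nearI.
exact: (filterS2 _ (fun t h It => h It) IA nI).
Qed.

Lemma C1_on_is_derive u : `|u - a| < e -> is_derive u 1 g (dg u).
Proof. by move=> ua; apply: is_derive_quotient; exact: C1_on_cvg. Qed.

(** By compactness of the closed interval. It makes the set under the supremum in [omega] bounded,
    so that [omega] is indeed an upper bound. *)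
Lemma C1_on_bounded : exists K, forall t, `|t - a| <= e -> `|dg t| <= K.
Proof.
have ae : a - e <= a + e by rewrite lerD2l (le_trans _ (ltW e0))// oppr_le0 ltW.
have Iab : [set t | `|t - a| <= e] = `[a - e, a + e]%classic.
  by apply/seteqP; split=> t /=; rewrite in_itv/= ler_distl.
have cdg : {within `[a - e, a + e], continuous (fun t => `|dg t|)}.
  have := gC1.2; rewrite Iab => cdg t.
  by apply: cvg_norm; exact: cdg.
have [c _ cmax] := EVT_max ae cdg.
by exists `|dg c| => t ta; apply: cmax; rewrite in_itv/= -ler_distl.
Qed.

Lemma C1_on_MVT t : `|t - a| < e ->
  exists2 c, `|c - a| < e & g t - g a = dg c * (t - a).
Proof.
move=> ta; have [ea|ae|->] := ltgtP t a; last first.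
- by exists a; rewrite ?subrr ?normr0// mulr0.
- have der c : c \in `[a, t] -> `|c - a| < e.
    rewrite in_itv/= => /andP[ac ct]; rewrite ger0_norm ?subr_ge0//.
    by rewrite (le_lt_trans _ ta)// ger0_norm ?subr_ge0 ?lerD2r ?(ltW ae).
  have [c cI ->] := MVT ae (fun c cI => C1_on_is_derive (der c
      (subset_itv_oo_cc cI))) (derivable_within_continuous (fun c cI =>
      @ex_derive _ _ _ _ _ _ _ (C1_on_is_derive (der c cI)))).
  by exists c => //; apply: der; exact: subset_itv_oo_cc.
have der c : c \in `[t, a] -> `|c - a| < e.
  rewrite in_itv/= => /andP[tc ca]; rewrite distrC ger0_norm ?subr_ge0//.
  by rewrite (le_lt_trans _ ta)// distrC ger0_norm ?subr_ge0 ?lerD2l ?lerN2 ?(ltW ea).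
have [c cI E] := MVT ea (fun c cI => C1_on_is_derive (der c
    (subset_itv_oo_cc cI))) (derivable_within_continuous (fun c cI =>
    @ex_derive _ _ _ _ _ _ _ (C1_on_is_derive (der c cI)))).
exists c; first by apply: der; exact: subset_itv_oo_cc.
by rewrite -opprB E; ring.
Qed.

End C1_functions.

Lemma measurable_Rintegral_kernel2 d d' (S : measurableType d)
    (T : measurableType d') (R : realType) (k : R.-pker S ~> T) (F : S * T -> R) :
  measurable_fun setT F -> measurable_fun setT (fun x => \int[k x]_y F (x, y)).
Proof.
move=> mF; apply: (measurableT_comp (fine_measurable measurableT)).
rewrite (_ : (fun x => _) = (fun x => (\int[k x]_y (F^\+%R (x, y))%:E -
    \int[k x]_y (F^\-%R (x, y))%:E)%E)); last first.
  apply/funext => x; rewrite integralE; congr (_ - _)%E; apply: eq_integral => y _.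
    by rewrite funeposE /funrpos EFin_max.
  by rewrite funenegE /funrneg EFin_max.
apply: emeasurable_funB.
  apply: (@measurable_kfcomp _ _ _ _ _ k (fun xy => (F^\+%R xy)%:E)).
    exact/measurable_EFinP/measurable_funrpos.
  by move=> xy; rewrite lee_fin funrpos_ge0.
apply: (@measurable_kfcomp _ _ _ _ _ k (fun xy => (F^\-%R xy)%:E)).
  exact/measurable_EFinP/measurable_funrneg.
by move=> xy; rewrite lee_fin funrneg_ge0.
Qed.

(** * Perturbation of the kernel and of its invariant law *)

Section derivative_of_the_invariant_mean.
Context d (T : measurableType d) (R : realType).
Variables (theta0 eps : R) (P : R -> R.-pker T ~> T) (pi : R -> probability T R).
Variables (p dp : R -> T -> T -> R).
Variables (V : T -> R) (lambda b : R).
Hypotheses (mV : measurable_fun setT V) (V1 : forall x, 1 <= V x).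
Hypotheses (lambda01 : 0 < lambda < 1) (b0 : 0 <= b).

Implicit Types (phi h f : T -> R) (c : R).

Let close theta := `|theta - theta0| < eps.

Hypothesis QV : forall theta, close theta -> forall x,
  (\int[P theta x]_y (V y)%:E <= (lambda * V x + b)%:E)%E.
Hypothesis invpi : forall theta, close theta -> invariant (P theta) (pi theta).
Hypothesis eps0 : 0 < eps.
Hypothesis mp : forall theta, close theta ->
  measurable_fun setT (fun xy : T * T => p theta xy.1 xy.2).
Hypothesis p_ge0 : forall theta, close theta -> forall x y, 0 <= p theta x y.
Hypothesis pP : forall theta, close theta -> forall x B, measurable B ->
  (P theta x B = \int[P theta0 x]_(y in B) (p theta x y)%:E)%E.
Hypothesis C1 : forall x y, C1_on [set theta | `|theta - theta0| <= eps]
  (fun theta => p theta x y) (fun theta => dp theta x y).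
Variables (R1 s1 : R).
Hypotheses (R10 : 0 <= R1) (s101 : 0 < s1 < 1).
Hypothesis ergV : forall g : T -> R, measurable_fun setT g ->
  (forall y, `|g y| <= V y) -> forall x n, (0 < n)%N ->
  `|Pn (P theta0) n g x - \int[pi theta0]_y g y| <= R1 * V x * s1 ^+ n.
Hypothesis ergS : forall g : T -> R, measurable_fun setT g ->
  (forall y, `|g y| <= Num.sqrt (V y)) -> forall x n, (0 < n)%N ->
  `|Pn (P theta0) n g x - \int[pi theta0]_y g y| <= R1 * Num.sqrt (V x) * s1 ^+ n.
Variables (a m Cw : R).
Hypotheses (a0 : 0 <= a) (Cw0 : 0 <= Cw) (m1 : 1 <= m).
Hypothesis wV : forall x, (Omega theta0 P dp eps a x <= (Cw * V x)%:E)%E.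
Hypothesis sqr_le_a : forall u : R, 0 <= u -> u ^+ 2 <= 1 + u `^ a.
Hypothesis sqrM_le : forall u v : R, 0 <= u -> 0 <= v ->
  (u * v) ^+ 2 <= 2 + u `^ a + v `^ m.

Let close0 : close theta0. Proof. by rewrite /close subrr normr0. Qed.

Let V0 x : 0 <= V x. Proof. exact: le_trans (V1 x). Qed.

Let B := b / (1 - lambda).

Let B0 : 0 <= B.
Proof. by have /andP[_ l1] := lambda01; rewrite divr_ge0// subr_ge0 ltW. Qed.

Let sqrtV x : Num.sqrt (V x) <= V x.
Proof. exact: sqrtr_le. Qed.

(* The value at [theta0] is the limit of the difference quotients. *)
Definition quotient theta x y : R :=
  if theta == theta0 then dp theta0 x y
  else (p theta x y - p theta0 x y) / (theta - theta0).

Let dp_le_omega theta x y : close theta -> `|dp theta x y| <= omega theta0 dp eps x y.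
Proof.
move=> ct; apply: ub_le_sup; last by exists theta.
have [K Kdp] := C1_on_bounded eps0 (C1 x y).
by exists K => _ [t /= tc <-]; apply: Kdp; exact: ltW.
Qed.

Lemma quotient_le_omega theta x y : close theta ->
  `|quotient theta x y| <= omega theta0 dp eps x y.
Proof.
move=> ct; rewrite /quotient; case: eqVneq => [_|tt0]; first exact: dp_le_omega.
have [c cc ->] := C1_on_MVT eps0 (C1 x y) ct.
by rewrite mulfK ?subr_eq0//; exact: dp_le_omega.
Qed.

Lemma quotient_cvg (u : nat -> R) x y : u n @[n --> \oo] --> theta0 ->
  quotient (u n) x y @[n --> \oo] --> dp theta0 x y.
Proof.
move=> uu; have ct : `|theta0 - theta0| < eps by rewrite subrr normr0.
have := C1_on_cvg (C1 x y) ct => /cvgrPdist_lt h.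
apply/cvgrPdist_lt => r r0; have := h _ r0 => /nbhs_ballP[z /= z0 hz].
have : \forall n \near \oo, ball theta0 z (u n).
  by apply: uu; exact: nbhsx_ballx.
apply: filterS => n un; rewrite /quotient; case: eqVneq => [_|nt0].
  by rewrite subrr normr0.
exact: hz.
Qed.

(** Away from [theta0] the quotient is built from densities; at [theta0] it is a pointwise limit of
    such quotients along a sequence. *)
Lemma measurable_quotient theta : close theta ->
  measurable_fun setT (fun xy : T * T => quotient theta xy.1 xy.2).
Proof.
have mq t : close t -> t != theta0 ->
    measurable_fun setT (fun xy : T * T => quotient t xy.1 xy.2).
  move=> ct tt0; rewrite /quotient (negbTE tt0).
  by apply: measurable_funM => //; apply: measurable_funB; exact: mp.
move=> ct; have [->|] := eqVneq theta theta0; last exact: mq.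
(* [n.+2] keeps [u n] strictly within [eps] of [theta0], where the density is known to be
   measurable. *)
pose u n := theta0 + eps / n.+2%:R.
have uu : u n @[n --> \oo] --> theta0.
  rewrite -[X in _ --> X]addr0; apply: cvgD; first exact: cvg_cst.
  rewrite -(mulr0 eps); apply: cvgM; first exact: cvg_cst.
  by have := @cvg_harmonic R; rewrite -cvg_shiftS.
have u0 n : close (u n) /\ u n != theta0.
  have en : 0 < eps / n.+2%:R by rewrite divr_gt0.
  split; last by rewrite /u -subr_eq0 addrAC subrr add0r gt_eqF.
  rewrite /close /u addrAC subrr add0r gtr0_norm// ltr_pdivrMr//.
  by rewrite ltr_pMr// ltr1n.
apply: (measurable_fun_cvg (fun n => mq _ (u0 n).1 (u0 n).2)) => xy _.
by rewrite /quotient eqxx; exact: quotient_cvg.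
Qed.

Let measurable_section (F : T * T -> R) x : measurable_fun setT F ->
  measurable_fun setT (fun y => F (x, y)).
Proof. by move=> mF; apply: (measurableT_comp mF); exact: measurable_fun_pair. Qed.

(* The first-order operator: [P theta = P theta0 + (theta - theta0) * dP theta]. *)
Definition dP theta (phi : T -> R) x : R :=
  \int[P theta0 x]_y (quotient theta x y * phi y).

Let kiter1_lty theta x : close theta ->
  (\int[P theta x]_y (V y)%:E < +oo)%E.
Proof. by move=> ct; apply: le_lt_trans (QV ct x) _; exact: ltry. Qed.

Let dominated_P theta x phi : close theta -> dominated V phi ->
  (P theta x).-integrable setT (EFin \o phi).
Proof. by move=> ct; apply: dominated_integrable => //; exact: kiter1_lty. Qed.

Let integrable_p theta x phi : close theta -> dominated V phi ->
  (P theta0 x).-integrable setT (fun y => (p theta x y * phi y)%:E).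
Proof.
move=> ct dphi; apply: (integrable_density _ (p_ge0 ct x) (pP ct x)).
- exact: (measurable_section x (mp ct)).
- by case: dphi.
- exact: dominated_P.
Qed.

Let P_density theta x phi : close theta -> dominated V phi ->
  \int[P theta x]_y phi y = \int[P theta0 x]_y (p theta x y * phi y).
Proof.
move=> ct dphi; congr fine.
apply: (integral_density (measurable_section x (mp ct)) (p_ge0 ct x) (pP ct x)).
by case: dphi.
Qed.

Lemma Pn_perturbation theta x phi : close theta -> dominated V phi ->
  Pn (P theta) 1 phi x = Pn (P theta0) 1 phi x + (theta - theta0) * dP theta phi x.
Proof.
move=> ct dphi.
have [->|tt0] := eqVneq theta theta0; first by rewrite subrr mul0r addr0.
rewrite (Pn1 mV V1 lambda01 b0 (QV ct))// (Pn1 mV V1 lambda01 b0 (QV close0))//.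
rewrite (P_density x ct dphi) (P_density x close0 dphi) /dP.
have qE y : quotient theta x y * phi y =
    (theta - theta0)^-1 * (p theta x y * phi y - p theta0 x y * phi y).
  by rewrite /quotient (negbTE tt0); ring.
under [X in _ = _ + _ * X]eq_Rintegral do rewrite qE.
rewrite RintegralZl//; last first.
  have := integrableB measurableT (integrable_p x ct dphi) (integrable_p x close0 dphi).
  by apply: eq_integrable.
rewrite RintegralB//; [|exact: integrable_p|exact: integrable_p].
by rewrite mulrA mulfV ?subr_eq0// mul1r addrC subrK.
Qed.

Let piV theta : close theta -> (\int[pi theta]_x (V x)%:E <= B%:E)%E.
Proof. by move=> ct; exact: (drift_invariant mV V1 lambda01 b0 (QV ct) (invpi ct)). Qed.

Let dominated_pi theta phi : close theta -> dominated V phi ->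
  (pi theta).-integrable setT (EFin \o phi).
Proof.
move=> ct; apply: dominated_integrable => //.
by apply: le_lt_trans (piV ct) _; exact: ltry.
Qed.

(* [pi theta u - pi theta0 u = pi theta (P theta - P theta0) phi] for a solution
   [phi] of the Poisson equation for [u]. *)
Lemma invariant_perturbation theta u phi : close theta -> dominated V u ->
  dominated V phi ->
  (forall x, phi x - Pn (P theta0) 1 phi x = u x - \int[pi theta0]_y u y) ->
  \int[pi theta]_x u x - \int[pi theta0]_x u x =
  (theta - theta0) * \int[pi theta]_x dP theta phi x.
Proof.
move=> ct du dphi uphi.
have dPt := dominated_Pn mV V1 lambda01 b0 (QV ct) 1 dphi.
have dP0 := dominated_Pn mV V1 lambda01 b0 (QV close0) 1 dphi.
have [->|tt0] := eqVneq theta theta0; first by rewrite !subrr mul0r.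
have ddP : dominated V (dP theta phi).
  have := dominatedZ (theta - theta0)^-1 (dominatedB dPt dP0).
  congr dominated; apply/funext => x; rewrite (Pn_perturbation x ct dphi).
  by rewrite addrAC subrr add0r mulKf// subr_eq0.
rewrite -RintegralZl//; last exact: dominated_pi.
transitivity (\int[pi theta]_x (Pn (P theta) 1 phi x - Pn (P theta0) 1 phi x)).
  rewrite RintegralB//;
    [|exact: dominated_pi|exact: dominated_pi].
  rewrite (invariant_Pn mV V1 lambda01 b0 (QV ct) (invpi ct))// -RintegralB//; [|exact: dominated_pi|exact: dominated_pi].
  under [RHS]eq_Rintegral do rewrite uphi.
  rewrite RintegralB//; [|exact: dominated_pi|]; last first.
    by apply: dominated_pi => //; exact: dominated_cst.
  by rewrite Rintegral_cst// [X in fine X]probability_setT mulr1.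
apply: eq_Rintegral => x _; rewrite (Pn_perturbation x ct dphi).
by rewrite addrAC subrr add0r.
Qed.

Let quotient_moment theta x : close theta ->
  (\int[P theta0 x]_y (`|quotient theta x y| `^ a)%:E <= (Cw * V x)%:E)%E.
Proof.
move=> ct; apply: le_trans (wV x).
apply: ge0_le_integral_nonmeas => y; rewrite lee_fin ?powR_ge0//.
have w0 : 0 <= omega theta0 dp eps x y.
  by rewrite (le_trans _ (quotient_le_omega x y ct)).
by rewrite ge0_ler_powR ?nnegrE// quotient_le_omega.
Qed.

Let PV1 x : (\int[P theta0 x]_y (V y)%:E <= ((1 + b) * V x)%:E)%E.
Proof.
have /andP[l0 l1] := lambda01.
apply: le_trans (QV close0 x) _; rewrite lee_fin mulrDl lerD//.
  by rewrite ler_wpM2r// ltW.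
by rewrite ler_peMr.
Qed.

Let mVE : measurable_fun setT (EFin \o V).
Proof. exact/measurable_EFinP. Qed.

Let VE0 x : (0 <= (V x)%:E)%E.
Proof. by rewrite lee_fin. Qed.

(* An upper bound for [quotient], of which we only control the [a]-th moment. *)
Let sqr_moment (D phi : T -> R) c x : measurable_fun setT D ->
  measurable_fun setT phi -> 0 <= c ->
  (forall y, 0 <= D y) ->
  (\int[P theta0 x]_y (D y `^ a)%:E <= (Cw * V x)%:E)%E ->
  (forall y, `|phi y| `^ m <= c * V y) ->
  (\int[P theta0 x]_y (`|D y * phi y| `^ 2)%:E <=
    ((2 + Cw + c * (1 + b)) * V x)%:E)%E.
Proof.
move=> mD mphi c0 D0 DV phic.
apply: (@le_trans _ _ (\int[P theta0 x]_y (2%:E + (D y `^ a)%:E + c%:E * (V y)%:E))%E).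
  apply: ge0_le_integral_nonmeas => y; first by rewrite lee_fin powR_ge0.
  rewrite -EFinM -!EFinD lee_fin powR_mulrn// normrM (ger0_norm (D0 y)).
  by rewrite (le_trans (sqrM_le (D0 y) (normr_ge0 _)))// lerD2l.
have mDa : measurable_fun setT (fun y => (D y `^ a)%:E).
  by apply/measurable_EFinP; exact: (measurableT_comp (measurable_powR a)).
have Da0 y : (0 <= (D y `^ a)%:E)%E by rewrite lee_fin powR_ge0.
have cV0 y : (0 <= c%:E * (V y)%:E)%E by rewrite mule_ge0.
have D20 y : (0 <= 2%:E + (D y `^ a)%:E)%E by rewrite adde_ge0.
rewrite ge0_integralD//; [|exact: emeasurable_funD|exact: measurable_funeM].
rewrite ge0_integralD//.
rewrite (ge0_integralZl_EFin _ _ (fun x _ => VE0 x) mVE c0)//.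
rewrite integral_cst// [X in (_ * X + _ + _)%E]prob_kernel mule1.
have -> : (2 + Cw + c * (1 + b)) * V x =
    2 * V x + Cw * V x + c * ((1 + b) * V x) by ring.
rewrite [leRHS]EFinD leeD//; last by rewrite EFinM lee_wpmul2l// lee_fin.
by rewrite [leRHS]EFinD leeD// lee_fin ler_peMr.
Qed.

Let integrable_of_sqr (g : T -> R) x K : measurable_fun setT g ->
  (\int[P theta0 x]_y (`|g y| `^ 2)%:E <= (K * V x)%:E)%E ->
  (P theta0 x).-integrable setT (EFin \o g).
Proof.
move=> mg gK; have l1 : (P theta0 x setT <= 1)%E by rewrite prob_kernel.
by have [] := powR_integrable l1 mg _ gK; rewrite ?ler1n.
Qed.

Let quotient_phi theta phi c x : close theta -> measurable_fun setT phi ->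
  0 <= c -> (forall y, `|phi y| `^ m <= c * V y) ->
  measurable_fun setT (fun y => quotient theta x y * phi y) /\
  (\int[P theta0 x]_y (`|quotient theta x y * phi y| `^ 2)%:E <=
    ((2 + Cw + c * (1 + b)) * V x)%:E)%E.
Proof.
move=> ct mphi c0 phic; have mq := measurable_section x (measurable_quotient ct).
split; first exact: measurable_funM.
rewrite (eq_integral (fun y => (`| `|quotient theta x y| * phi y| `^ 2)%:E)).
  apply: sqr_moment phic => //; last exact: quotient_moment.
  exact: measurableT_comp.
by move=> y _; rewrite !normrM normr_id.
Qed.

(** The second moment of [quotient * phi] is at most a multiple of [V], so its mean is at most a
    multiple of [sqrt V], uniformly in the parameter. The half power left over is taken up by the
    second use of [dP], in [dP_bound]. *)
Lemma dP_sqrt_bound phi c : measurable_fun setT phi -> 0 <= c ->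
  (forall y, `|phi y| `^ m <= c * V y) ->
  exists2 K, 0 < K & forall theta x, close theta ->
    `|dP theta phi x| <= K * Num.sqrt (V x).
Proof.
move=> mphi c0 phic; pose A := 2 + Cw + c * (1 + b).
have A0 : 0 < A by rewrite !ltr_wpDr ?mulr_ge0 ?addr_ge0.
exists (2 * Num.sqrt A); first by rewrite mulr_gt0// sqrtr_gt0.
move=> theta x ct; have [mq q2] := quotient_phi x ct mphi c0 phic.
have iq := integrable_of_sqr mq q2.
have AV0 : 0 < A * V x by rewrite mulr_gt0// (lt_le_trans ltr01).
rewrite (le_trans (le_normr_Rintegral _ iq))// -lee_fin -Rintegral_EFin; last first.
  exact: (integrable_norm iq).
have := powR_integral_le _ mq _ AV0 q2; rewrite ler1n => /(_ _ isT).
rewrite powR12_sqrt ?(ltW AV0)// sqrtrM ?(ltW A0)// mulrA; apply.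
by rewrite prob_kernel.
Qed.

(** Meant for a Poisson solution [phi] bounded by [sqrt V]. Here [u * v <= u^2 + v^2] yields a bound
    by [V], which suffices since the integrals of [V] under the laws [pi theta] share the bound
    [B]. *)
Lemma dP_bound phi c : measurable_fun setT phi -> 0 <= c ->
  (forall y, `|phi y| <= c * Num.sqrt (V y)) ->
  forall theta x, close theta ->
    `|dP theta phi x| <= (1 + Cw + c ^+ 2 * (1 + b)) * V x.
Proof.
move=> mphi c0 phic theta x ct.
have mq := measurable_section x (measurable_quotient ct).
have mqa : measurable_fun setT (fun y => (`|quotient theta x y| `^ a)%:E).
  apply/measurable_EFinP; apply: (measurableT_comp (measurable_powR a)).
  exact: measurableT_comp.
have key : (\int[P theta0 x]_y `|quotient theta x y * phi y|%:E <=
    ((1 + Cw + c ^+ 2 * (1 + b)) * V x)%:E)%E.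
  apply: (@le_trans _ _ (\int[P theta0 x]_y
      (1 + (`|quotient theta x y| `^ a)%:E + (c ^+ 2)%:E * (V y)%:E))%E).
    apply: ge0_le_integral_nonmeas => y; first by rewrite lee_fin.
    rewrite -EFinM -!EFinD lee_fin normrM.
    apply: (@le_trans _ _ (`|quotient theta x y| ^+ 2 + `|phi y| ^+ 2)).
      have := sqr_ge0 (`|quotient theta x y| - `|phi y|).
      have := mulr_ge0 (normr_ge0 (quotient theta x y)) (normr_ge0 (phi y)).
      by rewrite sqrrB; lra.
    rewrite lerD//; first exact: sqr_le_a.
    rewrite -(sqr_sqrtr (V0 y)) -exprMn lerXn2r ?nnegrE//.
    by rewrite mulr_ge0 ?sqrtr_ge0.
  have q20 y : (0 <= 1 + (`|quotient theta x y| `^ a)%:E)%E.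
    by rewrite adde_ge0// lee_fin powR_ge0.
  have cV0 y : (0 <= (c ^+ 2)%:E * (V y)%:E)%E by rewrite mule_ge0 ?lee_fin ?sqr_ge0.
  rewrite ge0_integralD//; [|exact: emeasurable_funD|exact: measurable_funeM].
  rewrite ge0_integralD//.
  rewrite (ge0_integralZl_EFin _ _ (fun x _ => VE0 x) mVE (sqr_ge0 c))//.
  rewrite integral_cst// [X in (_ * X + _ + _)%E]prob_kernel mule1.
  have -> : (1 + Cw + c ^+ 2 * (1 + b)) * V x =
      V x + Cw * V x + c ^+ 2 * ((1 + b) * V x) by ring.
  rewrite [leRHS]EFinD leeD//; last first.
    by rewrite [leRHS]EFinM lee_wpmul2l ?lee_fin ?sqr_ge0.
  by rewrite [leRHS]EFinD leeD ?lee_fin// quotient_moment.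
have iq : (P theta0 x).-integrable setT (EFin \o (fun y => quotient theta x y * phi y)).
  apply/integrableP; split; first by apply/measurable_EFinP; exact: measurable_funM.
  by apply: le_lt_trans key _; exact: ltry.
rewrite (le_trans (le_normr_Rintegral _ iq))// -lee_fin -Rintegral_EFin//.
exact: (integrable_norm iq).
Qed.

Lemma measurable_dP theta phi : close theta -> measurable_fun setT phi ->
  measurable_fun setT (dP theta phi).
Proof.
move=> ct mphi; apply: (measurable_Rintegral_kernel2 (P theta0)
  (F := fun xy => quotient theta xy.1 xy.2 * phi xy.2)).
apply: measurable_funM; first exact: measurable_quotient.
exact: measurableT_comp.
Qed.

(** Uniformity in [u] is essential: the bound is applied to a multiple of [dP theta h], which moves
    with [theta]. The constant is the bound on [dP] of the Poisson solution times the common bound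
    on the integrals of [V]. *)
Lemma invariant_Lipschitz : exists2 K, 0 <= K & forall theta (u : T -> R),
  close theta -> measurable_fun setT u ->
  (forall y, `|u y| <= Num.sqrt (V y)) ->
  `|\int[pi theta]_x u x - \int[pi theta0]_x u x| <= K * `|theta - theta0|.
Proof.
have [c c0 sol] := Poisson_sqrt mV V1 lambda01 b0 (QV close0) (invpi close0) R10
  s101 ergV ergS.
pose K := 1 + Cw + c ^+ 2 * (1 + b).
have K0 : 0 <= K by rewrite !addr_ge0 ?mulr_ge0 ?sqr_ge0 ?addr_ge0.
exists (K * B); first by rewrite mulr_ge0.
move=> theta u ct mu uV; have [phi [mphi phic uphi]] := sol u mu uV.
have du : dominated V u by split=> //; exists 1 => x; rewrite mul1r (le_trans (uV x)).
have dphi : dominated V phi.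
  by split=> //; exists c => x; rewrite (le_trans (phic x))// ler_wpM2l.
have dPK := dP_bound mphi c0 phic.
have ddP : dominated V (dP theta phi).
  by split; [exact: measurable_dP|exists K => x; exact: dPK].
rewrite (invariant_perturbation ct du dphi uphi) normrM mulrC ler_wpM2r//.
have idP := dominated_pi ct ddP.
rewrite (le_trans (le_normr_Rintegral _ idP))// -lee_fin -Rintegral_EFin; last first.
  exact: (integrable_norm idP).
apply: (@le_trans _ _ (\int[pi theta]_x (K%:E * (V x)%:E))%E).
  apply: ge0_le_integral_nonmeas => x; first by rewrite lee_fin.
  by rewrite -EFinM lee_fin dPK.
rewrite (ge0_integralZl_EFin _ _ (fun x _ => VE0 x) mVE K0)//.
by rewrite EFinM lee_wpmul2l ?lee_fin ?piV.
Qed.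

(** Dominated convergence twice: under [P theta0 x] for each [x], then under [pi theta0]. *)
Lemma dP_cvg (u : nat -> R) phi c : (forall n, close (u n)) ->
  u n @[n --> \oo] --> theta0 -> measurable_fun setT phi -> 0 <= c ->
  (forall y, `|phi y| `^ m <= c * V y) ->
  \int[pi theta0]_x dP (u n) phi x @[n --> \oo] --> \int[pi theta0]_x dP theta0 phi x.
Proof.
move=> cu uu mphi c0 phic.
have [K K0 dPK] := dP_sqrt_bound mphi c0 phic.
apply: (dominated_cvg_Rintegral (g := fun x => K * V x)).
- by move=> n; exact: measurable_dP.
- exact: measurable_dP.
- apply: aeW => x.
  (* [omega] would be the natural majorant but is not known to be measurable; the supremum along the
     sequence is measurable and lies below [omega], hence inherits the bound on the a-th moment. *)
  pose D y := sups (fun n => `|quotient (u n) x y|) 0%N.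
  have mq n : measurable_fun setT (fun y => quotient (u n) x y).
    exact: (measurable_section x (measurable_quotient (cu n))).
  have ub y : has_ubound (range (fun n => `|quotient (u n) x y|)).
    by exists (omega theta0 dp eps x y) => _ [n _ <-]; exact: quotient_le_omega.
  have mD : measurable_fun setT D.
    apply: (@measurable_fun_sups _ _ _ setT (fun n y => `|quotient (u n) x y|)).
      by move=> y _; exact: ub.
    by move=> n; exact: measurableT_comp.
  have qD n y : `|quotient (u n) x y| <= D y.
    apply: ub_le_sup; last by exists n.
    by have [M Mq] := ub y; exists M => _ [k _ <-]; apply: Mq; exists k.
  have D0 y : 0 <= D y by rewrite (le_trans _ (qD 0%N y)).
  have Dw y : D y <= omega theta0 dp eps x y.
    apply: ge_sup; first by exists `|quotient (u 0%N) x y|; exists 0%N.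
    by move=> _ [n _ <-]; exact: quotient_le_omega.
  have DV : (\int[P theta0 x]_y (D y `^ a)%:E <= (Cw * V x)%:E)%E.
    apply: le_trans (wV x).
    apply: ge0_le_integral_nonmeas => y; rewrite lee_fin ?powR_ge0//.
    by rewrite ge0_ler_powR ?nnegrE// (le_trans (D0 y)).
  have mDphi : measurable_fun setT (fun y => D y * phi y) by exact: measurable_funM.
  have iD := integrable_of_sqr mDphi (sqr_moment mD mphi c0 D0 DV phic).
  apply: (dominated_cvg_Rintegral (g := fun y => `|D y * phi y|)).
  + by move=> n; exact: measurable_funM.
  + apply: measurable_funM => //.
    exact: (measurable_section x (measurable_quotient close0)).
  + apply: aeW => y; apply: cvgM; last exact: cvg_cst.
    by rewrite {2}/quotient eqxx; exact: quotient_cvg.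
  + exact: (integrable_norm iD).
  + by apply: aeW => y n; rewrite !normrM (ger0_norm (D0 y)) ler_wpM2r.
- apply: dominated_pi => //; split; first exact: measurable_funM.
  by exists K => x; rewrite ger0_norm// mulr_ge0// ltW.
- apply: aeW => x n; rewrite (le_trans (dPK _ _ (cu n)))// ler_wpM2l//.
  exact: ltW.
Qed.

Lemma is_derive_invariant_mean f h c : dominated V f ->
  measurable_fun setT h -> 0 <= c -> (forall y, `|h y| `^ m <= c * V y) ->
  (forall x, h x - Pn (P theta0) 1 h x = f x - \int[pi theta0]_y f y) ->
  is_derive theta0 1 (fun theta => \int[pi theta]_x f x)
    (\int[pi theta0]_x dP theta0 h x).
Proof.
move=> df mh c0 hc hf.
have dh : dominated V h.
  split=> //; exists (1 + c) => x; rewrite mulrDl mul1r.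
  rewrite -[leLHS]powRr1// (le_trans (powR_le1D ler01 m1 (normr_ge0 _)))//.
  by rewrite lerD.
have [K K0 dPK] := dP_sqrt_bound mh c0 hc.
have [M M0 Lip] := invariant_Lipschitz.
have ddP theta : close theta -> dominated V (dP theta h).
  move=> ct; split; first exact: measurable_dP.
  by exists K => x; rewrite (le_trans (dPK _ _ ct))// ler_wpM2l// ltW.
pose F theta := \int[pi theta]_x dP theta h x.
have FL theta : close theta ->
    `|F theta - \int[pi theta0]_x dP theta h x| <= K * M * `|theta - theta0|.
  (* Rescaling by [K^-1] brings [dP theta h] below [sqrt V], as the Lipschitz bound requires. *)
  move=> ct; have := Lip theta (fun x => K^-1 * dP theta h x) ct _ _.
  rewrite !RintegralZl//; [|exact/dominated_pi/ddP|exact/dominated_pi/ddP].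
  rewrite -mulrBr normrM ger0_norm ?invr_ge0 ?(ltW K0)// ler_pdivrMl// mulrA; apply.
    by apply: measurable_funM => //; exact: measurable_dP.
  move=> y; rewrite normrM ger0_norm ?invr_ge0 ?(ltW K0)// ler_pdivrMl//.
  exact: dPK.
(* [F] is controlled within distance [eps] of [theta0] only. [G] extends it by a constant, so that
   continuity can be tested on arbitrary sequences. *)
pose G theta := if `|theta - theta0| < eps then F theta else F theta0.
have GF : G theta @[theta --> theta0] --> F theta0.
  apply/(@cvg_nbhsP _ R^o) => u uu.
  pose v n := if `|u n - theta0| < eps then u n else theta0.
  have cv n : close (v n) by rewrite /v; case: ifP.
  have Gv n : G (u n) = F (v n).
    by rewrite /G /v; case: ifP.
  have vv : v n @[n --> \oo] --> theta0.
    have uc : \forall n \near \oo, `|u n - theta0| < eps.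
      exact: (@cvgr_distC_lt _ R^o _ _ _ u theta0 uu eps eps0).
    apply: cvg_trans (uu); apply: near_eq_cvg; near=> n.
    by rewrite /v ifT//; near: n.
  under eq_fun do rewrite Gv.
  have := dP_cvg cv vv mh c0 hc => h1.
  have h2 : F (v n) - \int[pi theta0]_x dP (v n) h x @[n --> \oo] --> 0.
    apply/norm_cvg0P; apply: (squeeze_cvgr (f := cst 0)
      (h := fun n => K * M * `|v n - theta0|)).
    - by near=> n; rewrite normr_ge0/= FL.
    - exact: cvg_cst.
    - rewrite -(mulr0 (K * M)); apply: cvgM; first exact: cvg_cst.
      apply/norm_cvg0P; rewrite -(subrr theta0).
      by apply: (@cvgB _ R^o) => //; exact: cvg_cst.
  have -> : (fun n => F (v n)) = (fun n => F (v n) -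
      \int[pi theta0]_x dP (v n) h x + \int[pi theta0]_x dP (v n) h x).
    by apply/funext => n; rewrite subrK.
  by rewrite -[F theta0]add0r; exact: (@cvgD _ R^o).
apply: is_derive_quotient.
have nc : \forall t \near theta0, close t.
  by apply/nbhs_ballP; exists eps => //= t; rewrite /ball/= distrC.
apply: cvg_trans (cvg_trans (cvg_app G (@nbhs_dnbhs _ theta0)) GF).
apply: near_eq_cvg; near=> t.
have ct : close t.
  by near: t; apply: nbhs_dnbhs.
have tt0 : t != theta0 by near: t; exact: nbhs_dnbhs_neq.
rewrite /G ifT// (invariant_perturbation ct df dh hf) mulrC mulKf// subr_eq0//.
Unshelve. all: by end_near.
Qed.

End derivative_of_the_invariant_mean.

(** * One block *)

Section conditional_expectations.
Local Open Scope ereal_scope.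
Context dO d1 d2 (O : measurableType dO)
  (S1 : measurableType d1) (S2 : measurableType d2) (R : realType)
  (Pr : {measure set O -> \bar R}) (G : set (set O)).
Hypotheses (Pr1 : Pr setT = 1) (sG : sigma_algebra setT G)
  (Gm : G `<=` measurable).
Variables (U : O -> S1) (Q : R.-pker S1 ~> S2) (Z : O -> S2).
Hypotheses (mU : measurable_fun setT U) (mZ : measurable_fun setT Z).
Hypothesis QZ : cond_law Pr G U Q Z.

Local Notation OG := (g_sigma_algebraType G).

Let GK (B : set OG) : measurable B -> G (id @^-1` B).
Proof. by rewrite measurable_g_measurableTypeE. Qed.

Lemma cond_law_integral_adapted_ge0 (F : OG * S2 -> \bar R) :
  measurable_fun setT F -> (forall x, 0 <= F x) ->
  \int[Pr]_w F (w, Z w) = \int[Pr]_w \int[Q (U w)]_y F (w, y).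
Proof.
move=> mF F0.
exact: (@cond_law_integral_ge0 _ _ _ _ _ OG _ _ _ Pr G Pr1
  Gm U Q Z id mU mZ GK QZ F mF F0).
Qed.

Lemma cond_law_integral_adapted (F : OG * S2 -> R) :
  measurable_fun setT F ->
  Pr.-integrable setT (fun w => (F (w, Z w))%:E) ->
  (forall w, (Q (U w)).-integrable setT (fun y => (F (w, y))%:E)) ->
  Pr.-integrable setT (fun w => \int[Q (U w)]_y (F (w, y))%:E) /\
  \int[Pr]_w (F (w, Z w))%:E = \int[Pr]_w \int[Q (U w)]_y (F (w, y))%:E.
Proof.
move=> mF iF iQ.
exact: (@cond_law_integral _ _ _ _ _ OG _ _ _ Pr G Pr1
  Gm U Q Z id mU mZ GK QZ F mF iF iQ).
Qed.

Lemma cond_law_Rintegral (g : OG -> R) (phi : S2 -> R) :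
  measurable_fun setT g -> measurable_fun setT phi ->
  Pr.-integrable setT (fun w => (g w * phi (Z w))%:E) ->
  (forall w, (Q (U w)).-integrable setT (EFin \o phi)) ->
  Pr.-integrable setT (fun w => (g w * \int[Q (U w)]_y phi y)%:E) /\
  (\int[Pr]_w (g w * phi (Z w)) =
  \int[Pr]_w (g w * \int[Q (U w)]_y phi y))%R.
Proof.
move=> mg mphi iphi iQ; pose F (wy : OG * S2) := (g wy.1 * phi wy.2)%R.
have mF : measurable_fun setT F.
  by apply: measurable_funM; exact: measurableT_comp.
have iF w : (Q (U w)).-integrable setT (fun y => (F (w, y))%:E).
  rewrite /F/=; apply: eq_integrable (integrableZl measurableT (g w) (iQ w)) => //.
have [] := cond_law_integral_adapted mF iphi iF.
have FE w : \int[Q (U w)]_y (F (w, y))%:E = (g w * \int[Q (U w)]_y phi y)%:E.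
  by rewrite EFinM -Rintegral_EFin//= -integralZl.
under eq_fun do rewrite FE.
move=> i1 e; split => //; rewrite /Rintegral; congr fine.
by rewrite [LHS]e.
Qed.

End conditional_expectations.

Section iterated_kernels.
Local Open Scope ereal_scope.
Context d (S : measurableType d) (R : realType).

(** [kiter] is typed as a subprobability kernel; this copy carries the proof that its mass is 1, as
    [cond_law] takes a probability kernel. *)
Definition kiter_prob (Q : R.-pker S ~> S) n (x : S) :
  {measure set S -> \bar R} := kiter Q n x.

Section instances.
Variables (Q : R.-pker S ~> S) (n : nat).

HB.instance Definition _ := isKernel.Build _ _ _ _ _ (kiter_prob Q n)
  (measurable_kernel (kiter Q n)).

HB.instance Definition _ := Kernel_isProbability.Build _ _ _ _ _
  (kiter_prob Q n) (kiter_setT Q n).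

End instances.

Lemma adapted_chain_kiter_law dO (O : measurableType dO)
    (Pr : {measure set O -> \bar R}) Gs (Q : R.-pker S ~> S) W m n :
  adapted_chain Pr Gs Q W ->
  cond_law Pr (Gs m) (W m) (kiter_prob Q n) (W (m + n)%N).
Proof.
move=> WP A B GA mB; have [_ sG _ _ _] := WP.
have mA : measurable A by exact: (sG m).2.
have mW := adapted_chain_measurable WP.
have mF : measurable_fun setT (fun x => (\1_B x)%:E : \bar R).
  by apply/measurable_EFinP; exact: measurable_indic.
have F0 x : 0 <= (\1_B x)%:E :> \bar R by rewrite lee_fin.
have h := adapted_chain_kiter WP n GA mF F0.
rewrite -[LHS](_ : \int[Pr]_(w in A) (\1_B (W (m + n)%N w))%:E = _); last first.
  have -> : (fun w => (\1_B (W (m + n)%N w))%:E : \bar R) =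
     (fun w => (\1_(W (m + n)%N @^-1` B) w)%:E) by apply/funext.
  rewrite integral_indic//.
    by rewrite setIC.
  by rewrite -[X in measurable X]setTI; exact: mW.
rewrite h.
apply: eq_integral => w _ /=; rewrite integral_indic// setIT//.
Qed.

End iterated_kernels.

Section block_experiment.
Local Open Scope ereal_scope.
Context d (T : measurableType d) (R : realType).
Variables (Q : R.-pker T ~> T) (Qb : R.-pker (T * T)%type ~> (T * T)%type).
Variables (z : T) (L : nat).
Context dC (OC : measurableType dC) (C : R.-pker (T * T)%type ~> OC)
  (WC : nat -> OC -> T * T).
Hypothesis CP : forall xz, markov_chain (C xz) Qb \d_xz WC.

Local Notation PT := (path_space T).
Local Notation PTT := (path_space (T * T)%type).
Local Notation mWC := (measurable_WC CP).

Lemma fresh_run_law dO (O : measurableType dO) (Pr : {measure set O -> \bar R})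
    (G : set (set O)) (U : O -> T * T) (W : nat -> O -> T * T) :
  Pr setT = 1 -> G `<=` measurable -> fresh_run Pr Qb G U W ->
  cond_law Pr G U (kernel_law C mWC) (fun w => W ^~ w : PTT).
Proof.
move=> Pr1 Gm FR A B GA mB; have WP := fresh_run_adapted Pr1 Gm FR.
have [_ W0 _] := FR.
have := adapted_chain_law WP CP mWC (A := A) (B := B).
rewrite (_ : W 0%N = U); last exact/funext.
by apply=> //; apply: sub_sigma_algebra; left.
Qed.

(* Conditioning first on all of [G], then on [Gs 0]. *)
Lemma fresh_run_integral dO (O : measurableType dO)
    (Pr : {measure set O -> \bar R}) Gs (G : set (set O)) (X : nat -> O -> T)
    (W : nat -> O -> T * T) (A : set O) (B : set (PT * PTT)) :
  adapted_chain Pr Gs Q X -> sigma_algebra setT G -> G `<=` measurable ->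
  (forall n D, measurable D -> G (X n @^-1` D)) ->
  fresh_run Pr Qb G (fun w => (X L w, z)) W -> G A -> measurable B ->
  Pr (A `&` (fun w => (X ^~ w, W ^~ w) : PT * PTT) @^-1` B) =
  \int[Pr]_w ((\1_A w)%:E *
    \int[kernel_law C mWC (X L w, z)]_y (\1_B (X ^~ w, y))%:E).
Proof.
move=> WP sG Gm GX FR GA mB; have [Pr1 _ _ _ _] := WP.
have mX := adapted_chain_measurable WP; have [mW _ _] := FR.
have mA : G.-sigma.-measurable A by rewrite measurable_g_measurableTypeE.
have mXG : measurable_fun setT (fun w : g_sigma_algebraType G => X ^~ w : PT).
  apply: measurable_path => n _ D mD; rewrite setTI measurable_g_measurableTypeE//.
  exact: GX.
have mU : measurable_fun setT (fun w => (X L w, z)).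
  exact/measurable_fun_pair.
have mWp := measurable_path mW.
pose F (wy : g_sigma_algebraType G * PTT) : \bar R :=
  (\1_A wy.1)%:E * (\1_B (X ^~ wy.1, wy.2))%:E.
have mF : measurable_fun setT F.
  apply: emeasurable_funM; apply/measurable_EFinP.
    exact: (measurableT_comp (measurable_indic mA)).
  apply: (measurableT_comp (measurable_indic mB)).
  apply/measurable_fun_pair => //.
  exact: (measurableT_comp mXG measurable_fst).
have F0 wy : 0 <= F wy by rewrite mule_ge0.
have h := cond_law_integral_adapted_ge0 Pr1 sG Gm mU mWp
  (fresh_run_law Pr1 Gm FR) mF F0.
transitivity (\int[Pr]_w F (w, W ^~ w)).
  rewrite -[RHS](_ : \int[Pr]_w (\1_(A `&`
     (fun w => (X ^~ w, W ^~ w) : PT * PTT) @^-1` B) w)%:E = _).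
    rewrite integral_indic ?setIT//; apply: measurableI; first exact: Gm.
    rewrite -[X in measurable X]setTI; apply: measurable_fun_pair => //.
    exact: measurable_path.
  by apply: eq_integral => w _; rewrite indicI/= EFinM.
rewrite h; apply: eq_integral => w _ /=.
rewrite /F/= ge0_integralZl_EFin//.
  exact: mWC.
apply/measurable_EFinP; apply: (measurableT_comp (measurable_indic mB)).
exact/measurable_fun_pair.
Qed.

Context dE (OE : measurableType dE) (E : R.-pker T ~> OE) (XE : nat -> OE -> T)
  (WE : nat -> OE -> T * T).
Hypothesis BE : block_family Q Qb z L E XE WE.

Let E1 x : E x setT = 1.
Proof. exact: prob_kernel. Qed.

Let sfm : sigma_fam setT XE `<=` measurable.
Proof.
have [[mX _ _] _] := BE z.
apply: generated_sub_measurable.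
by move=> _ [i _ [B mB <-]]; exact: mX.
Qed.

Lemma block_chain x : adapted_chain (E x) (fun n => sigma_fam `I_n.+1 XE) Q XE.
Proof. by have [h _] := BE x; exact: markov_chain_adapted h. Qed.

Lemma measurable_block : measurable_fun setT
  (fun w => (XE ^~ w, WE ^~ w) : PT * PTT).
Proof.
have [[mX _ _] [mW _ _]] := BE z.
by apply/measurable_fun_pair; exact: measurable_path.
Qed.

(** The auxiliary pair is integrated out first, which leaves a function [psi] of the path of [X].
    The law of this path given [Gs 0] is the one under [E], and the same computation under [E] puts
    the pair back. *)
Lemma block_law dO (O : measurableType dO)
    (Pr : {measure set O -> \bar R}) Gs (G : set (set O)) (X : nat -> O -> T)
    (W : nat -> O -> T * T) :
  adapted_chain Pr Gs Q X -> sigma_algebra setT G -> G `<=` measurable ->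
  (forall n D, measurable D -> G (X n @^-1` D)) -> Gs 0%N `<=` G ->
  fresh_run Pr Qb G (fun w => (X L w, z)) W ->
  cond_law Pr (Gs 0%N) (X 0%N) (kernel_law E measurable_block)
    (fun w => (X ^~ w, W ^~ w) : PT * PTT).
Proof.
move=> WP sG Gm GX GsG FR A B GA mB; have [Pr1 sGs _ _ _] := WP.
rewrite (fresh_run_integral WP sG Gm GX FR (GsG _ GA) mB).
pose psi (x : PT) := \int[kernel_law C mWC (x L, z)]_y (\1_B (x, y))%:E.
have mU : measurable_fun setT (fun x : PT => (x L, z)).
  by apply/measurable_fun_pair => //; exact: measurable_path_coord.
have mpsi : measurable_fun setT psi.
  apply: (measurable_fun_integral_finite_kernel
    (fun xy : PT * PTT => (\1_B xy)%:E) (kernel_pre (kernel_law C mWC) mU)).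
    by move=> xy; rewrite lee_fin.
  by apply/measurable_EFinP; exact: measurable_indic.
have psi0 x : 0 <= psi x by apply: integral_ge0 => y _; rewrite lee_fin.
have mXE : measurable_fun setT (fun w => XE ^~ w : PT).
  by have [[mX _ _] _] := BE z; exact: measurable_path.
have h := cond_law_integral_set Pr1 (sGs 0%N).1 (sGs 0%N).2
  (adapted_chain_measurable WP 0%N) (measurable_path (adapted_chain_measurable WP))
  (adapted_chain_law WP (fun x => (BE x).1) mXE) GA mpsi psi0.
transitivity (\int[Pr]_(w in A) psi (X ^~ w)).
  rewrite [RHS]integral_mkcond; apply: eq_integral => w _.
  rewrite patchE indicE; case: ifPn => _; first by rewrite mul1e.
  by rewrite mul0e.
rewrite h; apply: eq_integral => w _.
have GXE n D : measurable D -> sigma_fam setT XE (XE n @^-1` D).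
  by move=> mD; apply: sub_sigma_algebra; exists n => //; exists D => //; rewrite setTI.
have sXE : sigma_algebra setT (sigma_fam setT XE) by exact: smallest_sigma_algebra.
have GT : sigma_fam setT XE setT by exact: sigma_algebra_setT.
have := fresh_run_integral (block_chain (X 0%N w)) sXE sfm GXE
  (BE (X 0%N w)).2 GT mB.
rewrite setTI => /= h2.
transitivity (E (X 0%N w)
  ((fun w' => (XE ^~ w', WE ^~ w') : PT * PTT) @^-1` B)); last by [].
rewrite h2 ge0_integral_pushforward ?setTI//.
  apply: eq_integral => w' _.
  by rewrite indicT mul1e.
Qed.

End block_experiment.

Section chains_with_initial_law.
Context d (T : measurableType d) (R : realType).
Variables (Q : R.-pker T ~> T) (V : T -> R) (lambda b : R).
Hypotheses (mV : measurable_fun setT V) (V1 : forall x, 1 <= V x).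
Hypotheses (lambda01 : 0 < lambda < 1) (b0 : 0 <= b).
Hypothesis QV : forall x, (\int[Q x]_y (V y)%:E <= (lambda * V x + b)%:E)%E.
Context dO (O : measurableType dO) (Pr : {measure set O -> \bar R})
  (Gs : nat -> set (set O)) (W : nat -> O -> T) (mu : {measure set T -> \bar R}).
Hypothesis WP : adapted_chain Pr Gs Q W.
Hypothesis W0 : forall B, measurable B -> Pr (W 0%N @^-1` B) = mu B.
Variable v0 : R.
Hypothesis muV : (\int[mu]_x (V x)%:E <= v0%:E)%E.

Let B := b / (1 - lambda).

Let B0 : 0 <= B.
Proof. by case/andP: lambda01 => l0 l1; rewrite divr_ge0// subr_ge0 ltW. Qed.

Let V0 x : 0 <= V x.
Proof. exact: le_trans (V1 x). Qed.

Let mVE : measurable_fun setT (EFin \o V).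
Proof. exact/measurable_EFinP. Qed.

Let VE0 x : (0 <= (V x)%:E)%E.
Proof. by rewrite lee_fin. Qed.

Let mu1 : mu setT = 1%E.
Proof. by have [Pr1 _ _ _ _] := WP; rewrite -W0// preimage_setT. Qed.

Let muVlty : (\int[mu]_x (V x)%:E < +oo)%E.
Proof. exact: le_lt_trans muV (ltry _). Qed.

Lemma chain_drift n : (\int[Pr]_w (V (W n w))%:E <= (v0 + B)%:E)%E.
Proof.
rewrite (adapted_chain_marginal WP n mVE VE0).
rewrite (integral_law (F := fun x => \int[kiter Q n x]_y (V y)%:E)%E
  (adapted_chain_measurable WP 0%N) W0); last 2 first.
- exact: measurable_integral_kernel.
- by move=> x; exact: integral_ge0.
apply: (@le_trans _ _ (\int[mu]_x ((V x)%:E + B%:E))%E).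
  apply: ge0_le_integral => //.
  - by move=> x _; exact: integral_ge0.
  - exact: measurable_integral_kernel.
  - exact: emeasurable_funD.
  - by move=> x _; exact: drift_kiter.
rewrite ge0_integralD// integral_cst// mu1 mule1 EFinD.
by rewrite leeD2r.
Qed.

Lemma chain_integrable n phi : dominated V phi ->
  Pr.-integrable setT (fun w => (phi (W n w))%:E).
Proof.
move=> [mphi [c phic]].
have mW := adapted_chain_measurable WP n.
apply: (dominated_integrable (V := V \o W n) _ _ _ (_ : dominated _ (phi \o W n))).
- exact: measurableT_comp.
- by move=> w; exact: V1.
- exact: (le_lt_trans (chain_drift n) (ltry _)).
- split; first exact: measurableT_comp.
  by exists c => w; exact: phic.
Qed.

Lemma chain_mean n phi : dominated V phi ->
  \int[Pr]_w phi (W n w) = \int[mu]_x Pn Q n phi x.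
Proof.
move=> dphi; have [Pr1 sG _ _ _] := WP.
have mW := adapted_chain_measurable WP.
have mphi := dphi.1.
have i1 : Pr.-integrable setT (fun w => ((cst 1 w : R) * phi (W n w))%:E).
  by under eq_fun do rewrite mul1r; exact: chain_integrable.
have [_] := cond_law_Rintegral Pr1 (sG 0%N).1 (sG 0%N).2 (mW 0%N) (mW n)
  (adapted_chain_kiter_law (m := 0%N) n WP) (measurable_cst _) mphi i1
  (fun w => dominated_kiter mV V1 lambda01 b0 QV n (W 0%N w) dphi).
under eq_Rintegral do rewrite mul1r.
move=> ->; under eq_Rintegral do rewrite mul1r.
congr fine; apply: (integral_transfer (h1 := W 0%N) (h2 := id)).
  by move=> F mF F0; rewrite (integral_law (mW 0%N) W0).
exact: measurable_Pn.
Qed.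

Variables (pi0 : probability T R) (R1 s1 : R).
Hypothesis invpi : invariant Q pi0.
Hypothesis s101 : 0 < s1 < 1.
Hypothesis ergV : forall g : T -> R, measurable_fun setT g ->
  (forall y, `|g y| <= V y) -> forall x n, (0 < n)%N ->
  `|Pn Q n g x - \int[pi0]_y g y| <= R1 * V x * s1 ^+ n.

(** Ergodicity holds for each starting state; the limit passes through the initial law by dominated
    convergence, the drift giving a multiple of [V] as majorant. *)
Lemma chain_mean_cvg phi : dominated V phi ->
  \int[Pr]_w phi (W n w) @[n --> \oo] --> \int[pi0]_x phi x.
Proof.
move=> dphi; under eq_fun do rewrite chain_mean//.
have -> : \int[pi0]_x phi x = \int[mu]_x (\int[pi0]_x phi x).
  by rewrite Rintegral_cst// mu1/= mulr1.
have [c c0 phic] := dominated_gt0 V1 dphi.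
apply: (dominated_cvg_Rintegral (g := fun x => c * (1 + B) * V x)) => //.
- by move=> n; exact: measurable_Pn dphi.1.
- by apply: aeW => x; exact: (ergodic_cvg mV V1 lambda01 b0 QV invpi s101 ergV).
- apply: (dominated_integrable mV V1) => //; apply: dominatedZ.
  by split=> //; exists 1 => x; rewrite mul1r ger0_norm.
- by apply: aeW => x n; apply: (Pn_norm mV V1) phic => //; [exact: dphi.1|exact: ltW].
Qed.

End chains_with_initial_law.

(** * The score operator and the mean of one block *)

Section score_operator.
Context d (T : measurableType d) (R : realType).
Variables (Q : R.-pker T ~> T) (V : T -> R) (lambda b : R).
Hypotheses (mV : measurable_fun setT V) (V1 : forall x, 1 <= V x).
Hypotheses (lambda01 : 0 < lambda < 1) (b0 : 0 <= b).
Hypothesis QV : forall x, (\int[Q x]_y (V y)%:E <= (lambda * V x + b)%:E)%E.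
Variables (s : T -> T -> R) (a m k Cs : R).
Hypothesis ms : measurable_fun setT (fun xy : T * T => s xy.1 xy.2).
Hypotheses (m1 : 1 <= m) (k1 : 1 <= k) (Cs0 : 0 <= Cs).
Hypothesis young : forall u v : R, 0 <= u -> 0 <= v ->
  (u * v) `^ k <= u `^ a + v `^ m.
Hypothesis sV : forall x, (\int[Q x]_y (`|s x y| `^ a)%:E <= (Cs * V x)%:E)%E.

Let V0 x : 0 <= V x.
Proof. exact: le_trans (V1 x). Qed.

Let mVE : measurable_fun setT (EFin \o V).
Proof. exact/measurable_EFinP. Qed.

Let VE0 x : (0 <= (V x)%:E)%E.
Proof. by rewrite lee_fin. Qed.

Lemma measurable_score_section x : measurable_fun setT (s x).
Proof. exact: (measurableT_comp ms (measurable_pair1 x)). Qed.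

(** This is [dP theta0] with [s] for the derivative of the density. *)
Definition score_operator (phi : T -> R) x : R := \int[Q x]_y (s x y * phi y).

Lemma powR_dominated (phi : T -> R) c : measurable_fun setT phi ->
  (forall x, `|phi x| `^ m <= c * V x) -> dominated V phi.
Proof.
move=> mphi phic; split=> //; exists (1 + c) => x; rewrite mulrDl mul1r.
rewrite -[leLHS]powRr1// (le_trans (powR_le1D ler01 m1 (normr_ge0 _)))//.
by rewrite lerD.
Qed.

Section one_function.
Variables (phi : T -> R) (c : R).
Hypotheses (mphi : measurable_fun setT phi) (c0 : 0 <= c).
Hypothesis phic : forall x, `|phi x| `^ m <= c * V x.

Let phi_moment x : (\int[Q x]_y (`|phi y| `^ m)%:E <= (c * (1 + b) * V x)%:E)%E.
Proof.
apply: (@le_trans _ _ (\int[Q x]_y (c%:E * (V y)%:E))%E).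
  apply: ge0_le_integral_nonmeas => y; first by rewrite lee_fin powR_ge0.
  by rewrite -EFinM lee_fin.
rewrite (ge0_integralZl_EFin _ _ (fun x _ => VE0 x) mVE c0)//.
rewrite -mulrA [leRHS]EFinM lee_wpmul2l ?lee_fin//.
rewrite (le_trans (QV x))// lee_fin.
case/andP: lambda01 => l0 l1.
rewrite mulrDl lerD// ?mul1r ?ler_piMl ?(ltW l1)//.
by rewrite ler_peMr.
Qed.

Lemma score_operator_integrable x :
  (Q x).-integrable setT (fun y => (s x y * phi y)%:E).
Proof.
have Q1 : (Q x setT <= 1)%E by rewrite prob_kernel.
have msx := measurable_score_section x.
by have [] := powR_integrable Q1 (measurable_funM msx mphi) k1
  (young_moment Q1 msx mphi young (sV x) (phi_moment x)).
Qed.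

Lemma dominated_score_operator : dominated V (score_operator phi).
Proof.
split.
  apply: (measurable_Rintegral_kernel2 Q
    (F := fun xy => s xy.1 xy.2 * phi xy.2)).
  by apply: measurable_funM => //; exact: measurableT_comp.
exists (1 + (Cs + c * (1 + b))) => x.
have Q1 : (Q x setT <= 1)%E by rewrite prob_kernel.
have msx := measurable_score_section x.
have [ix le1] := powR_integrable Q1 (measurable_funM msx mphi) k1
  (young_moment Q1 msx mphi young (sV x) (phi_moment x)).
rewrite (le_trans (le_normr_Rintegral _ ix))// (le_trans le1)//.
by rewrite mulrDl mul1r -mulrDl lerD2r.
Qed.

End one_function.

Section Poisson_sum.
Variables (g : T -> R) (Cg : R).
Hypotheses (mg : measurable_fun setT g) (Cg0 : 0 <= Cg).
Hypothesis gV : forall x, `|g x| `^ m <= Cg * V x.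

Let dg : dominated V g. Proof. exact: powR_dominated gV. Qed.

Let dPg i : dominated V (Pn Q i g).
Proof. exact: (dominated_Pn mV V1 lambda01 b0 QV). Qed.

Definition Poisson_sum n x : R := \sum_(0 <= i < n) Pn Q i g x.

Lemma dominated_Poisson_sum n : dominated V (Poisson_sum n).
Proof. exact: dominated_sum. Qed.

Lemma Poisson_sumE n x :
  Poisson_sum n x - Pn Q 1 (Poisson_sum n) x = g x - Pn Q n g x.
Proof.
rewrite /Poisson_sum (Pn_sum mV V1 lambda01 b0 QV)//.
rewrite -sumrB -[X in X - _](Pn0 Q x mg) -[RHS]opprB.
rewrite -(telescope_sumr (fun i => Pn Q i g x) (leq0n n)) -sumrN.
apply: eq_bigr => i _.
by rewrite -(PnD mV V1 lambda01 b0 QV)// opprB.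
Qed.

Lemma Poisson_sum_powR n : exists2 c, 0 <= c &
  forall x, `|Poisson_sum n x| `^ m <= c * V x.
Proof.
elim: n => [|n [c c0 nc]].
  exists 0 => // x; rewrite /Poisson_sum big_geq// normr0 powR0 ?mul0r//.
  by rewrite gt_eqF// (lt_le_trans ltr01).
have [c' c'0 nc'] := Pn_powR mV V1 lambda01 b0 QV n m1 mg Cg0 gV.
exists (2 `^ m * (c + c')); first by rewrite mulr_ge0 ?powR_ge0 ?addr_ge0.
move=> x; rewrite /Poisson_sum big_nat_recr//= -[X in _ + X]opprK.
rewrite (le_trans (powRB_le2 _ _ m1))// normrN -mulrA ler_wpM2l ?powR_ge0//.
by rewrite mulrDl; apply: lerD; [exact: nc|exact: nc'].
Qed.

Lemma score_operator_Poisson_sum n x :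
  score_operator (Poisson_sum n) x = \sum_(0 <= i < n) score_operator (Pn Q i g) x.
Proof.
have mP i : measurable_fun setT (Pn Q i g) by case: (dPg i).
have iP i : (Q x).-integrable setT (fun y => (s x y * Pn Q i g y)%:E).
  have [c' c'0 nc'] := Pn_powR mV V1 lambda01 b0 QV i m1 mg Cg0 gV.
  exact: score_operator_integrable nc' x.
rewrite -Rintegral_sum//; apply: eq_Rintegral => y _.
by rewrite /Poisson_sum big_distrr.
Qed.

End Poisson_sum.

End score_operator.

Lemma adapted_chain_adapted d (S : measurableType d) (R : realType)
    dO (O : measurableType dO) (Pr : {measure set O -> \bar R}) Gs
    (Q : R.-pker S ~> S) (W : nat -> O -> S) i n :
  adapted_chain Pr Gs Q W -> (i <= n)%N ->
  measurable_fun setT (W i : g_sigma_algebraType (Gs n) -> S).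
Proof.
move=> WP ni _ B mB; have [_ sG _ GW _] := WP.
rewrite setTI (measurable_g_measurableTypeE (sG n).1).
exact: (adapted_chain_filtration WP ni (GW i B mB)).
Qed.

Lemma powR_sum_le (R : realType) (a : R) n : 1 <= a -> exists2 c, 0 <= c &
  forall u : nat -> R, (forall i, 0 <= u i) ->
  (\sum_(0 <= i < n) u i) `^ a <= c * \sum_(0 <= i < n) u i `^ a.
Proof.
move=> a1; elim: n => [|n [c c0 IH]].
  exists 0 => // u u0; rewrite !big_geq// powR0 ?mulr0//.
  by rewrite gt_eqF// (lt_le_trans ltr01).
exists (2 `^ a * (c + 1)); first by rewrite mulr_ge0 ?powR_ge0 ?addr_ge0.
move=> u u0; rewrite !big_nat_recr//=.
have S0 : 0 <= \sum_(0 <= i < n) u i by apply: sumr_ge0.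
rewrite (le_trans (powRD_le2 a1 S0 (u0 n)))// -mulrA ler_wpM2l ?powR_ge0//.
rewrite mulrDl mul1r lerD//; last by rewrite lerDr sumr_ge0// => i _; rewrite powR_ge0.
by rewrite (le_trans (IH _ u0))// ler_wpM2l// lerDl powR_ge0.
Qed.

Section block_moments.
Context d (T : measurableType d) (R : realType).
Variables (Q : R.-pker T ~> T) (Qb : R.-pker (T * T)%type ~> (T * T)%type).
Variables (V : T -> R) (lambda b : R).
Hypotheses (mV : measurable_fun setT V) (V1 : forall x, 1 <= V x).
Hypotheses (lambda01 : 0 < lambda < 1) (b0 : 0 <= b).
Hypothesis QV : forall x, (\int[Q x]_y (V y)%:E <= (lambda * V x + b)%:E)%E.
Hypothesis cQ : coupling Q Qb.
Context dC (OC : measurableType dC) (C : R.-pker (T * T)%type ~> OC)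
  (WC : nat -> OC -> T * T).
Hypothesis CP : forall xz, markov_chain (C xz) Qb \d_xz WC.
Variables (M rho : R).
Hypotheses (M0 : 0 <= M) (rho01 : 0 < rho < 1).
Hypothesis Ctail : forall (x z : T) (t : nat),
  (C (x, z) [set w | time_gt (meeting (WC ^~ w)) t]
  <= (M * (V x + V z) * rho ^+ t)%:E)%E.
Variables (f : T -> R) (L : nat) (e Cf m : R) (z : T).
Hypotheses (mf : measurable_fun setT f) (L1 : (1 <= L)%N).
Hypotheses (m1 : 1 <= m) (me : m < e) (Cf0 : 0 <= Cf).
Hypothesis fV : forall x, `|f x| `^ e <= Cf * V x.
Variables (s : T -> T -> R) (a k Cs : R).
Hypothesis ms : measurable_fun setT (fun xy : T * T => s xy.1 xy.2).
Hypotheses (a1 : 1 <= a) (k1 : 1 <= k) (Cs0 : 0 <= Cs).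
Hypothesis young : forall u v : R, 0 <= u -> 0 <= v ->
  (u * v) `^ k <= u `^ a + v `^ m.
Hypothesis sV : forall x, (\int[Q x]_y (`|s x y| `^ a)%:E <= (Cs * V x)%:E)%E.
Context dE (OE : measurableType dE) (E : R.-pker T ~> OE) (XE : nat -> OE -> T)
  (WE : nat -> OE -> T * T).
Hypothesis BE : block_family Q Qb z L E XE WE.

Local Notation g := (Gmean C WC f L z).
Local Notation PT := (path_space T).
Local Notation PTT := (path_space (T * T)%type).

Let B := b / (1 - lambda).

Let B0 : 0 <= B.
Proof. by case/andP: lambda01 => l0 l1; rewrite divr_ge0// subr_ge0 ltW. Qed.

Let V0 x : 0 <= V x.
Proof. exact: le_trans (V1 x). Qed.

Let mVE : measurable_fun setT (EFin \o V).
Proof. exact/measurable_EFinP. Qed.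

Let VE0 x : (0 <= (V x)%:E)%E.
Proof. by rewrite lee_fin. Qed.

Let mdiag : measurable (@diag d T). Proof. by case: cQ. Qed.

Let mg : measurable_fun setT g.
Proof. exact: (measurable_Gmean cQ CP L z mf). Qed.

Definition score_sum (x : nat -> T) : R := \sum_(0 <= i < L) s (x i) (x i.+1).

(** The block starts at time 0 of the first path; later blocks are read through shifted paths, see
    [block_of]. *)
Definition blockH (w : PT * PTT) : R := Hval f s L w.1 0 w.2.

Lemma measurable_score_sum : measurable_fun setT (score_sum : PT -> R).
Proof.
apply: measurable_sum => i.
apply: (measurableT_comp (f := fun xy : T * T => s xy.1 xy.2) ms
  (g := fun w : PT => (w i, w i.+1))).
by apply/measurable_fun_pair; exact: measurable_path_coord.
Qed.

Lemma measurable_blockH : measurable_fun setT blockH.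
Proof.
apply: measurable_funM; first exact: (measurableT_comp measurable_score_sum measurable_fst).
exact: (measurableT_comp (measurable_Gval L mf mdiag) measurable_snd).
Qed.

Section started_at.
Variable x : T.

Let XP := block_chain BE x.
Let Pr1 : E x setT = 1%E. Proof. by rewrite prob_kernel. Qed.
Let Ex1 : (E x setT <= 1)%E. Proof. by rewrite Pr1. Qed.
Let mX := adapted_chain_measurable XP.
Let XE0 A : measurable A -> E x (XE 0%N @^-1` A) = \d_x A.
Proof. by have [[_ h _] _] := BE x; exact: h. Qed.

Let dV : (\int[\d_x]_y (V y)%:E <= (V x)%:E)%E.
Proof. by rewrite integral_dirac// diracT mul1e. Qed.

Let drift n := chain_drift mV V1 lambda01 b0 QV XP XE0 dV n.

Let V1B : V x + B <= (1 + B) * V x.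
Proof. by rewrite mulrDl mul1r lerD2l ler_peMr. Qed.

Lemma block_drift n : (\int[E x]_w (V (XE n w))%:E <= ((1 + B) * V x)%:E)%E.
Proof. by rewrite (le_trans (drift n))// lee_fin. Qed.

Lemma block_score_moment i :
  (\int[E x]_w (`|s (XE i w) (XE i.+1 w)| `^ a)%:E <=
   (Cs * (1 + B) * V x)%:E)%E.
Proof.
have [_ sG _ _ QX] := XP.
pose F (wy : g_sigma_algebraType (sigma_fam `I_i.+1 XE) * T) :=
  (`|s (XE i wy.1) wy.2| `^ a)%:E : \bar R.
have mF : measurable_fun setT F.
  apply/measurable_EFinP; apply: (measurableT_comp (measurable_powR a)).
  apply: measurableT_comp => //.
  apply: (measurableT_comp (f := fun xy : T * T => s xy.1 xy.2) ms
    (g := fun wy : g_sigma_algebraType (sigma_fam `I_i.+1 XE) * T =>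
      (XE i wy.1, wy.2))).
  apply/measurable_fun_pair => //.
  exact: (measurableT_comp (adapted_chain_adapted XP (leqnn i)) measurable_fst).
have F0 wy : (0 <= F wy)%E by rewrite lee_fin powR_ge0.
have := cond_law_integral_adapted_ge0 Pr1 (sG i).1 (sG i).2 (mX i) (mX i.+1) (QX i) mF F0.
rewrite /F/= => ->.
apply: (@le_trans _ _ (\int[E x]_w (Cs%:E * (V (XE i w))%:E))%E).
  apply: ge0_le_integral_nonmeas => w.
    by apply: integral_ge0 => y _; rewrite lee_fin powR_ge0.
  by rewrite -EFinM.
rewrite ge0_integralZl_EFin//; last exact: (measurableT_comp mVE).
rewrite -mulrA [leRHS]EFinM lee_wpmul2l ?lee_fin//.
exact: block_drift.
Qed.

End started_at.

Lemma score_sum_moment : exists2 K, 0 <= K & forall x,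
  (\int[E x]_w (`|score_sum (XE ^~ w)| `^ a)%:E <= (K * V x)%:E)%E.
Proof.
have [c c0 sumc] := powR_sum_le L a1.
exists (c * (Cs * (1 + B) *+ L)).
  by rewrite mulr_ge0// mulrn_wge0// mulr_ge0// addr_ge0.
move=> x; have mX := adapted_chain_measurable (block_chain BE x).
have mt i : measurable_fun setT (fun w => (`|s (XE i w) (XE i.+1 w)| `^ a)%:E).
  apply/measurable_EFinP; apply: (measurableT_comp (measurable_powR a)).
  apply: measurableT_comp => //.
  apply: (measurableT_comp (f := fun xy : T * T => s xy.1 xy.2) ms
    (g := fun w => (XE i w, XE i.+1 w))).
  exact/measurable_fun_pair.
apply: (@le_trans _ _ (\int[E x]_w (c%:E *
    \sum_(0 <= i < L) (`|s (XE i w) (XE i.+1 w)| `^ a)%:E))%E).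
  apply: ge0_le_integral_nonmeas => w; first by rewrite lee_fin powR_ge0.
  rewrite sumEFin -EFinM lee_fin.
  apply: le_trans (sumc (fun i => `|s (XE i w) (XE i.+1 w)|) _) => //.
  rewrite ge0_ler_powR ?nnegrE ?sumr_ge0 ?(le_trans ler01 a1)//.
  exact: ler_norm_sum.
rewrite ge0_integralZl_EFin//; last 2 first.
- by move=> w _; apply: sume_ge0 => i _; rewrite lee_fin powR_ge0.
- exact: emeasurable_sum.
rewrite -mulrA [leRHS]EFinM lee_wpmul2l ?lee_fin//.
rewrite ge0_integral_sum//.
rewrite mulrnAl -[in leRHS](subn0 L) -sumr_const_nat -sumEFin.
by apply: lee_sum => i _; exact: block_score_moment.
Qed.

Lemma block_Gval_moment : exists2 K, 0 <= K & forall x,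
  (\int[E x]_w (`|Gval f L (WE ^~ w)| `^ m)%:E <= (K * V x)%:E)%E.
Proof.
have [K K0 GK] := Gabs_mean_bound mV V1 lambda01 b0 QV cQ CP M0 rho01 Ctail
  z mf L1 m1 me Cf0 fV.
exists (K * (1 + B)); first by rewrite mulr_ge0 ?(ltW K0)// addr_ge0.
move=> x; have XP := block_chain BE x; have mX := adapted_chain_measurable XP.
have [Pr1 _ _ _ _] := XP; have [[_ _ _] FR] := BE x; have [mW _ _] := FR.
have sXE : sigma_algebra setT (sigma_fam setT XE) by exact: smallest_sigma_algebra.
have GT : sigma_fam setT XE setT by exact: sigma_algebra_setT.
have Gm : sigma_fam setT XE `<=` measurable.
  apply: generated_sub_measurable.
  by move=> _ [i _ [A mA <-]]; exact: mX.
pose F (y : PTT) := (`|Gval f L y| `^ m)%:E : \bar R.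
have mF : measurable_fun setT F.
  apply/measurable_EFinP; apply: (measurableT_comp (measurable_powR m)).
  apply: measurableT_comp => //; exact: measurable_Gval.
have F0 y : (0 <= F y)%E by rewrite lee_fin powR_ge0.
have mU : measurable_fun setT (fun w => (XE L w, z)).
  exact/measurable_fun_pair.
have := cond_law_integral_set Pr1 sXE Gm mU (measurable_path mW)
  (fresh_run_law CP Pr1 Gm FR) GT mF F0.
rewrite {1}/F => ->.
apply: (@le_trans _ _ (\int[E x]_w (K%:E * (V (XE L w))%:E))%E).
  apply: ge0_le_integral_nonmeas => w; first exact: integral_ge0.
  rewrite ge0_integral_pushforward//; last exact: measurable_WC.
  rewrite -EFinM; apply: le_trans (GK _).
  apply: ge0_le_integral_nonmeas => w'; first exact: F0.
  rewrite lee_fin ge0_ler_powR ?nnegrE ?(le_trans ler01 m1)//.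
    exact: Gabs_ge0.
  exact: normr_Gval.
rewrite ge0_integralZl_EFin//; last 2 first.
- exact: (measurableT_comp mVE).
- exact: ltW.
rewrite -mulrA [leRHS]EFinM lee_wpmul2l ?lee_fin ?(ltW K0)//.
exact: block_drift.
Qed.

Lemma block_moment : exists2 K, 0 <= K & forall x,
  (\int[E x]_w (`|blockH (XE ^~ w, WE ^~ w)| `^ k)%:E <= (K * V x)%:E)%E.
Proof.
have [K K0 sK] := score_sum_moment.
have [K' K'0 GK'] := block_Gval_moment.
exists (K + K'); first exact: addr_ge0.
move=> x; have mX := adapted_chain_measurable (block_chain BE x).
have [_ [mW _ _]] := BE x.
rewrite mulrDl; apply: young_moment young (sK x) (GK' x).
- by rewrite prob_kernel.
- exact: (measurableT_comp measurable_score_sum (measurable_path mX)).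
- exact: (measurableT_comp (measurable_Gval L mf mdiag) (measurable_path mW)).
Qed.

Lemma block_integrable x :
  (E x).-integrable setT (fun w => (blockH (XE ^~ w, WE ^~ w))%:E).
Proof.
have [K K0 HK] := block_moment.
have mH := measurableT_comp measurable_blockH (measurable_block BE).
have Ex1 : (E x setT <= 1)%E by rewrite prob_kernel.
by have [] := powR_integrable Ex1 mH k1 (HK x).
Qed.

Definition block_mean x : R := \int[E x]_w blockH (XE ^~ w, WE ^~ w).

Lemma dominated_block_mean : dominated V block_mean.
Proof.
split.
  apply: measurable_Rintegral_kernel.
  exact: (measurableT_comp measurable_blockH (measurable_block BE)).
have [K K0 HK] := block_moment; exists (1 + K) => x.
have mH := measurableT_comp measurable_blockH (measurable_block BE).
have Ex1 : (E x setT <= 1)%E by rewrite prob_kernel.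
have [iH le1] := powR_integrable Ex1 mH k1 (HK x).
rewrite (le_trans (le_normr_Rintegral _ iH))// (le_trans le1)//.
by rewrite mulrDl mul1r lerD2r.
Qed.

Let gpow := Gmean_powR mV V1 lambda01 b0 QV cQ CP M0 rho01 Ctail z mf L1 m1 me
  Cf0 fV.

Lemma Gmean_law x :
  (kernel_law C (measurable_WC CP) (x, z)).-integrable setT
    (EFin \o (Gval f L : PTT -> R)) /\
  \int[kernel_law C (measurable_WC CP) (x, z)]_y Gval f L y = g x.
Proof.
have mGv := measurable_Gval L mf mdiag.
split.
  have [K K0 GK] := Gabs_mean_bound mV V1 lambda01 b0 QV cQ CP M0 rho01 Ctail
    z mf L1 m1 me Cf0 fV.
  have l1 : (kernel_law C (measurable_WC CP) (x, z) setT <= 1)%E.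
    by rewrite prob_kernel.
  have [] := powR_integrable l1 mGv m1 (K := K * V x) _ => //.
  rewrite ge0_integral_pushforward//; first last.
  - by apply/measurable_EFinP; apply: (measurableT_comp (measurable_powR m));
      exact: measurableT_comp.
  - exact: measurable_WC.
  apply: le_trans (GK _).
  apply: ge0_le_integral_nonmeas => w'; first by rewrite lee_fin powR_ge0.
  rewrite lee_fin ge0_ler_powR ?nnegrE ?(le_trans ler01 m1)//.
    exact: Gabs_ge0.
  exact: normr_Gval.
congr fine; apply: (integral_transfer (h1 := id) (h2 := fun w => WC ^~ w : PTT)).
  move=> F mF F0; rewrite ge0_integral_pushforward//; exact: measurable_WC.
exact: mGv.
Qed.

Section mean_of_one_block.
Variable x : T.

Let XP := block_chain BE x.
Let Ex1 : (E x setT <= 1)%E. Proof. by rewrite prob_kernel. Qed.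
Let mX := adapted_chain_measurable XP.

Let dg : dominated V g.
Proof. by have [c c0 gc] := gpow; exact: (powR_dominated V1 m1 mg gc). Qed.

Let mscore i : measurable_fun setT (fun w => s (XE i w) (XE i.+1 w)).
Proof.
apply: (measurableT_comp (f := fun xy : T * T => s xy.1 xy.2) ms
  (g := fun w => (XE i w, XE i.+1 w))).
exact/measurable_fun_pair.
Qed.

Let score_integrable i n (phi : T -> R) c : measurable_fun setT phi ->
  (forall y, `|phi y| `^ m <= c * V y) -> 0 <= c ->
  (E x).-integrable setT
    (fun w => (s (XE i w) (XE i.+1 w) * phi (XE n w))%:E).
Proof.
move=> mphi phic c0.
have phiK : (\int[E x]_w (`|phi (XE n w)| `^ m)%:E <= (c * ((1 + B) * V x))%:E)%E.
  apply: (@le_trans _ _ (\int[E x]_w (c%:E * (V (XE n w))%:E))%E).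
    apply: ge0_le_integral_nonmeas => w; first by rewrite lee_fin powR_ge0.
    by rewrite -EFinM lee_fin.
  rewrite ge0_integralZl_EFin//; last exact: (measurableT_comp mVE).
  by rewrite EFinM lee_wpmul2l ?lee_fin//; exact: block_drift.
have mphiX : measurable_fun setT (fun w => phi (XE n w)).
  exact: measurableT_comp.
have := young_moment Ex1 (mscore i) mphiX young (block_score_moment x i) phiK.
move/(powR_integrable Ex1 (measurable_funM (mscore i) mphiX) k1).
by case.
Qed.

(** Conditioning at time [i.+1] replaces [g] by its n-step mean, conditioning at time [i] produces
    the score operator, and averaging over [XE i] applies [Pn Q i]. *)
Lemma block_mean_term i n :
  \int[E x]_w (s (XE i w) (XE i.+1 w) * g (XE (i.+1 + n)%N w)) =
  Pn Q i (score_operator Q s (Pn Q n g)) x.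
Proof.
have [Pr1 sG _ GX QX] := XP.
have [c c0 gc] := gpow.
have [c' c'0 gc'] := Pn_powR mV V1 lambda01 b0 QV n m1 mg c0 gc.
have mPg : measurable_fun setT (Pn Q n g) by exact: measurable_Pn.
have mS : measurable_fun setT
    (fun w : g_sigma_algebraType (sigma_fam `I_i.+2 XE) => s (XE i w) (XE i.+1 w)).
  apply: (measurableT_comp (f := fun xy : T * T => s xy.1 xy.2) ms
    (g := fun w : g_sigma_algebraType (sigma_fam `I_i.+2 XE) =>
      (XE i w, XE i.+1 w))).
  apply/measurable_fun_pair; apply: adapted_chain_adapted XP _ => //.
have [_ ->] := cond_law_Rintegral Pr1 (sG i.+1).1 (sG i.+1).2 (mX i.+1)
  (mX (i.+1 + n)%N) (adapted_chain_kiter_law (m := i.+1) n XP) mS mg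
  (score_integrable i (i.+1 + n)%N mg gc c0)
  (fun w => dominated_kiter mV V1 lambda01 b0 QV n (XE i.+1 w) dg).
pose F (wy : g_sigma_algebraType (sigma_fam `I_i.+1 XE) * T) :=
  s (XE i wy.1) wy.2 * Pn Q n g wy.2.
have mF : measurable_fun setT F.
  apply: measurable_funM; last exact: (measurableT_comp mPg measurable_snd).
  apply: (measurableT_comp (f := fun xy : T * T => s xy.1 xy.2) ms
    (g := fun wy : g_sigma_algebraType (sigma_fam `I_i.+1 XE) * T =>
      (XE i wy.1, wy.2))).
  apply/measurable_fun_pair => //.
  exact: (measurableT_comp (adapted_chain_adapted XP (leqnn i)) measurable_fst).
have iS y := score_operator_integrable mV V1 lambda01 b0 QV ms k1 young sV
  mPg c'0 gc' y.
have [_ e2] := cond_law_integral_adapted Pr1 (sG i).1 (sG i).2 (mX i) (mX i.+1)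
  (QX i) mF (score_integrable i i.+1 mPg gc' c'0) (fun w => iS (XE i w)).
have XE0 A : measurable A -> E x (XE 0%N @^-1` A) = \d_x A.
  by have [[_ h _] _] := BE x; exact: h.
have dV : (\int[\d_x]_y (V y)%:E <= (V x)%:E)%E.
  by rewrite integral_dirac// diracT mul1e.
have dS := dominated_score_operator mV V1 lambda01 b0 QV ms k1 young sV
  mPg c'0 gc'.
transitivity (\int[E x]_w score_operator Q s (Pn Q n g) (XE i w)).
  rewrite /Rintegral [X in fine X]e2; congr fine; apply: eq_integral => w _.
  by rewrite Rintegral_EFin//; exact: iS.
rewrite (chain_mean mV V1 lambda01 b0 QV XP XE0 dV)// /Rintegral.
rewrite integral_dirac ?diracT ?mul1e//.
by apply/measurable_EFinP; apply: measurable_Pn; case: dS.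
Qed.

(** The auxiliary pair, fresh given [XE L], is integrated out first and turns [Gval] into
    [g (XE L)]; the i-th score then sees [g] at distance [L - i.+1]. *)
Lemma block_meanE : block_mean x =
  \sum_(0 <= i < L) Pn Q i (score_operator Q s (Pn Q (L - i.+1) g)) x.
Proof.
have [Pr1 _ _ _ _] := XP; have [[_ _ _] FR] := BE x; have [mW _ _] := FR.
have sXE : sigma_algebra setT (sigma_fam setT XE) by exact: smallest_sigma_algebra.
have Gm : sigma_fam setT XE `<=` measurable.
  apply: generated_sub_measurable.
  by move=> _ [i _ [A mA <-]]; exact: mX.
have mU : measurable_fun setT (fun w => (XE L w, z)).
  exact/measurable_fun_pair.
have mXG : measurable_fun setT
    (fun w : g_sigma_algebraType (sigma_fam setT XE) => XE ^~ w : PT).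
  apply: measurable_path => n _ D mD.
  rewrite setTI (measurable_g_measurableTypeE sXE).
  by apply: sub_sigma_algebra; exists n => //; exists D => //; rewrite setTI.
have [i1 e1] := cond_law_Rintegral Pr1 sXE Gm mU (measurable_path mW)
  (fresh_run_law CP Pr1 Gm FR) (measurableT_comp measurable_score_sum mXG)
  (measurable_Gval L mf mdiag) (block_integrable x) (fun w => (Gmean_law (XE L w)).1).
rewrite /block_mean [LHS]e1.
under eq_Rintegral => w _ do rewrite (Gmean_law (XE L w)).2.
transitivity (\sum_(0 <= i < L)
    \int[E x]_w (s (XE i w) (XE i.+1 w) * g (XE (i.+1 + (L - i.+1))%N w))).
  have [c c0 gc] := gpow.
  transitivity (\sum_(0 <= i < L)
      \int[E x]_w (s (XE i w) (XE i.+1 w) * g (XE L w))); last first.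
    by apply: eq_big_nat => i /andP[_ iL]; rewrite subnKC.
  rewrite -Rintegral_sum; last by move=> i; exact: score_integrable gc c0.
  by apply: eq_Rintegral => w _; rewrite big_distrl.
by apply: eq_bigr => i _; exact: block_mean_term.
Qed.

End mean_of_one_block.

(** Invariance strips off the outer [Pn Q i], and reversing the order of summation turns the inner
    iterates into [Poisson_sum]. The right-hand side is the form in which the derivative of the
    invariant mean appears. *)
Lemma invariant_block_mean (pi0 : probability T R) : invariant Q pi0 ->
  \int[pi0]_x block_mean x = \int[pi0]_x score_operator Q s (Poisson_sum Q g L) x.
Proof.
move=> invpi; have [c c0 gc] := gpow.
have piV := piV_lty mV V1 lambda01 b0 QV invpi.
have dS n : dominated V (score_operator Q s (Pn Q n g)).
  have [c' c'0 gc'] := Pn_powR mV V1 lambda01 b0 QV n m1 mg c0 gc.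
  apply: (dominated_score_operator mV V1 lambda01 b0 QV ms k1 young sV _ c'0 gc').
  exact: measurable_Pn.
have dPS i n : dominated V (Pn Q i (score_operator Q s (Pn Q n g))).
  exact: (dominated_Pn mV V1 lambda01 b0 QV).
have ipi phi : dominated V phi -> pi0.-integrable setT (EFin \o phi).
  by move=> dphi; exact: (dominated_integrable mV V1 piV dphi).
transitivity (\sum_(0 <= i < L) \int[pi0]_x
    Pn Q i (score_operator Q s (Pn Q (L - i.+1) g)) x).
  rewrite -Rintegral_sum; last by move=> i; exact: ipi.
  by apply: eq_Rintegral => x _; exact: block_meanE.
transitivity (\sum_(0 <= i < L) \int[pi0]_x score_operator Q s (Pn Q i g) x);
  last first.
  rewrite -Rintegral_sum; last by move=> i; exact: ipi.
  apply: eq_Rintegral => x _; symmetry.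
  exact: (score_operator_Poisson_sum mV V1 lambda01 b0 QV ms m1 k1 young sV mg c0 gc).
rewrite [RHS] big_nat_rev/=; apply: eq_big_nat => i /andP[_ iL].
rewrite (invariant_Pn mV V1 lambda01 b0 QV invpi)//.
Qed.

End block_moments.

(** * The lagged pair and the estimator *)

Section lagged_pairs.
Local Open Scope ereal_scope.
Context d dO (T : measurableType d) (O : measurableType dO) (R : realType)
  (Pr : probability O R).
Variables (Q : R.-pker T ~> T) (Qb : R.-pker (T * T)%type ~> (T * T)%type).
Variables (L : nat) (X Y : nat -> O -> T) (mu0 : probability T R).
Hypotheses (cQ : coupling Q Qb) (LP : lagged_pair Pr Q Qb L X Y mu0).

Local Notation H := (pair_hist X Y).

Lemma pair_hist_sigma n m : sigma_algebra setT (H n m) /\ H n m `<=` measurable.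
Proof.
have [mXY _ _ _ _] := LP; split; first exact: smallest_sigma_algebra.
apply: generated_sub_measurable.
rewrite subUset; split; apply: smallest_sub;
  try exact: sigma_algebra_measurable.
  by move=> _ [i _ [B mB <-]]; exact: (mXY i).1.
by move=> _ [i _ [B mB <-]]; exact: (mXY i).2.
Qed.

Lemma pair_hist_sub n n' m m' : (n <= n')%N -> (m <= m')%N -> H n m `<=` H n' m'.
Proof.
move=> nn mm; apply: sub_sigma_algebra2; apply: setUSS;
  apply: sub_sigma_algebra2 => _ [i /= im [B mB <-]]; exists i; try by exists B.
  exact: leq_trans im _.
exact: leq_trans im _.
Qed.

Lemma pair_hist_X i n m B : (i <= n)%N -> measurable B -> H n m (X i @^-1` B).
Proof.
move=> ni mB; apply: sub_sigma_algebra; left; apply: sub_sigma_algebra.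
by exists i => //; exists B => //; rewrite setTI.
Qed.

Lemma pair_hist_Y i n m B : (i <= m)%N -> measurable B -> H n m (Y i @^-1` B).
Proof.
move=> ni mB; apply: sub_sigma_algebra; right; apply: sub_sigma_algebra.
by exists i => //; exists B => //; rewrite setTI.
Qed.

Lemma lagged_pair_adapted : adapted_chain Pr (fun n => H (n + L)%N n) Qb
  (fun n w => (X (n + L)%N w, Y n w)).
Proof.
have [_ _ _ _ QZ] := LP; split.
- exact: probability_setT.
- by move=> n; exact: pair_hist_sigma.
- by move=> n; apply: pair_hist_sub.
- move=> n B mB; have sH := (pair_hist_sigma (n + L) n).1.
  have mZ : measurable_fun setT (fun w : g_sigma_algebraType (H (n + L)%N n) =>
      (X (n + L)%N w, Y n w)).
    apply/measurable_fun_pair => D mD'; move=> mD;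
      rewrite setTI (measurable_g_measurableTypeE sH).
      exact: pair_hist_X.
    exact: pair_hist_Y.
  have := mZ measurableT B mB.
  by rewrite setTI (measurable_g_measurableTypeE sH).
- exact: QZ.
Qed.

Lemma lagged_snd_adapted : adapted_chain Pr (fun n => H (n + L)%N n) Q Y.
Proof.
have [_ _ Qs _] := cQ.
apply: (adapted_chain_image lagged_pair_adapted (h := snd)) => // -[x y] B mB.
by rewrite -(Qs x y)//; congr (Qb _ _); apply/seteqP; split => -[] //= ? ? [].
Qed.

(** During the first [L] steps the truncated [n - L] is 0, matching the phase in which [X] runs
    alone given [Y 0]; afterwards [X] moves as the first coordinate of the pair. *)
Lemma lagged_fst_adapted : adapted_chain Pr (fun n => H n (n - L)%N) Q X.
Proof.
have [_ Qf _ _] := cQ; have [_ _ _ Q0 QZ] := LP; split.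
- exact: probability_setT.
- by move=> n; exact: pair_hist_sigma.
- by move=> n; apply: pair_hist_sub => //; rewrite leq_sub2r.
- by move=> n B mB; exact: pair_hist_X.
- move=> n; have [nL|Ln] := ltnP n L.
    by rewrite (eqP (ltnW nL : (n - L == 0)%N)); exact: Q0.
  move=> A B HA mB.
  have e : (n - L + L = n)%N by rewrite subnK.
  have := QZ (n - L)%N A (B `*` setT); rewrite e.
  move=> /(_ HA (measurableX mB measurableT)) h.
  transitivity (\int[Pr]_(w in A) Qb (X n w, Y (n - L)%N w) (B `*` setT)).
    rewrite -h; congr (Pr (A `&` _)); apply/seteqP; split => w //=; last by case.
  by apply: eq_integral => w _; exact: Qf.
Qed.

End lagged_pairs.

(** Moved back by [L], the lagged meeting is that of a coupled path, to which the tail estimates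
    apply. *)
Lemma lagged_meetingE (T : Type) L (x y : nat -> T) :
  lagged_meeting L x y =
  if meeting (fun n => (x (n + L)%N, y n)) is Some t then Some (t + L)%N else None.
Proof.
rewrite /lagged_meeting; case e : (meeting _) => [t|]; rewrite /meeting in e.
  have [/= et lt] := (first_time_Some _ _).1 e; apply/first_time_Some; split.
    by rewrite leq_addl addnK.
  move=> i it [Li xy]; apply: (lt (i - L)%N); last by rewrite subnK.
  by rewrite ltn_subLR// addnC.
have /= nm := (first_time_None _).1 e; apply/first_time_None => i [Li xy].
by apply: (nm (i - L)%N); rewrite subnK.
Qed.

Lemma indic_mul_integrable d (T : measurableType d) (R : realType)
    (mu : {measure set T -> \bar R}) (A : set T) (g : T -> R) :
  measurable A -> mu.-integrable setT (EFin \o g) ->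
  mu.-integrable setT (fun x => (\1_A x * g x)%:E).
Proof.
move=> mA ig; have mg : measurable_fun setT g.
  by apply/measurable_EFinP; exact: measurable_int ig.
apply: le_integrable ig => //.
  by apply/measurable_EFinP; exact: measurable_funM.
move=> x _; rewrite /= lee_fin normrM ler_piMl// indicE.
by case: (x \in A); rewrite ?normr1 ?normr0.
Qed.

Section along_the_pair.
Context d (T : measurableType d) (R : realType).
Variables (Q : R.-pker T ~> T) (Qb : R.-pker (T * T)%type ~> (T * T)%type).
Variables (V : T -> R) (lambda b : R).
Hypotheses (mV : measurable_fun setT V) (V1 : forall x, 1 <= V x).
Hypotheses (lambda01 : 0 < lambda < 1) (b0 : 0 <= b).
Hypothesis QV : forall x, (\int[Q x]_y (V y)%:E <= (lambda * V x + b)%:E)%E.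
Hypothesis cQ : coupling Q Qb.
Context dC (OC : measurableType dC) (C : R.-pker (T * T)%type ~> OC)
  (WC : nat -> OC -> T * T).
Hypothesis CP : forall xz, markov_chain (C xz) Qb \d_xz WC.
Variables (M rho : R).
Hypotheses (M0 : 0 <= M) (rho01 : 0 < rho < 1).
Hypothesis Ctail : forall (x z : T) (t : nat),
  (C (x, z) [set w | time_gt (meeting (WC ^~ w)) t]
  <= (M * (V x + V z) * rho ^+ t)%:E)%E.
Variables (f : T -> R) (L : nat) (e Cf m : R) (z : T).
Hypotheses (mf : measurable_fun setT f) (L1 : (1 <= L)%N).
Hypotheses (m1 : 1 <= m) (me : m < e) (Cf0 : 0 <= Cf).
Hypothesis fV : forall x, `|f x| `^ e <= Cf * V x.
Variables (s : T -> T -> R) (a k Cs : R).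
Hypothesis ms : measurable_fun setT (fun xy : T * T => s xy.1 xy.2).
Hypotheses (a1 : 1 <= a) (k2 : 2 < k) (Cs0 : 0 <= Cs).
Hypothesis young : forall u v : R, 0 <= u -> 0 <= v ->
  (u * v) `^ k <= u `^ a + v `^ m.
Hypothesis sV : forall x, (\int[Q x]_y (`|s x y| `^ a)%:E <= (Cs * V x)%:E)%E.
Context dE (OE : measurableType dE) (E : R.-pker T ~> OE) (XE : nat -> OE -> T)
  (WE : nat -> OE -> T * T).
Hypothesis BE : block_family Q Qb z L E XE WE.
Context dO (O : measurableType dO) (Pr : probability O R).
Variables (X Y : nat -> O -> T) (W : bool * nat -> nat -> O -> T * T)
  (mu0 : probability T R) (v0 : R).
Hypothesis muV : (\int[mu0]_x (V x)%:E <= v0%:E)%E.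
Hypotheses (LP : lagged_pair Pr Q Qb L X Y mu0)
  (FP : fresh_pairs Pr Qb z L X Y W).

Local Notation PT := (path_space T).
Local Notation PTT := (path_space (T * T)%type).
Local Notation H := (pair_hist X Y).
Local Notation bH := (blockH f L s).

Let B := b / (1 - lambda).

Let B0 : 0 <= B.
Proof. by case/andP: lambda01 => l0 l1; rewrite divr_ge0// subr_ge0 ltW. Qed.

Let k1 : 1 <= k. Proof. by rewrite (le_trans _ (ltW k2))// ler1n. Qed.

Let V0 x : 0 <= V x.
Proof. exact: le_trans (V1 x). Qed.

Let mVE : measurable_fun setT (EFin \o V).
Proof. exact/measurable_EFinP. Qed.

Let VE0 x : (0 <= (V x)%:E)%E.
Proof. by rewrite lee_fin. Qed.

Let Pr1 : Pr setT = 1%E. Proof. exact: probability_setT. Qed.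

Let v00 : 0 <= v0.
Proof. by rewrite -lee_fin (le_trans _ muV)// integral_ge0. Qed.

Definition copy c : nat -> O -> T := if c then X else Y.

(** Indexed so that [copy_hist true (j + L)] and [copy_hist false j] are both [H (j + L) j]: the two
    blocks compared in [increment j] start from one history, and it contains the event
    [not_met j]. *)
Definition copy_hist c n : set (set O) := if c then H n (n - L)%N else H (n + L)%N n.

Lemma copy_adapted c : adapted_chain Pr (copy_hist c) Q (copy c).
Proof. by case: c; [exact: (lagged_fst_adapted cQ LP)|exact: (lagged_snd_adapted cQ LP)]. Qed.

Lemma copy_initial c A : measurable A -> Pr (copy c 0%N @^-1` A) = mu0 A.
Proof. by have [_ hX hY _ _] := LP; case: c; [exact: hX|exact: hY]. Qed.

Definition others c : set (set O) :=
  <<s sigma_fam setT X `|` sigma_fam setT Y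
          `|` sigma_fam [set bn : (bool * nat) * nat | bn.1 <> c]
                        (fun bn => W bn.1 bn.2) >>.

Let mXY n : measurable_fun setT (X n) /\ measurable_fun setT (Y n).
Proof. by have [h _ _ _ _] := LP; exact: h. Qed.

Lemma others_sigma c : sigma_algebra setT (others c) /\ others c `<=` measurable.
Proof.
split; first exact: smallest_sigma_algebra.
apply: generated_sub_measurable.
rewrite !subUset; split; [split|]; apply: smallest_sub;
  try exact: sigma_algebra_measurable.
- by move=> _ [i _ [A mA <-]]; exact: (mXY i).1.
- by move=> _ [i _ [A mA <-]]; exact: (mXY i).2.
- by move=> _ [i _ [A mA <-]]; have [mW _ _] := FP i.1; exact: mW.
Qed.

Lemma hist_others n n' c : H n n' `<=` others c.
Proof.
apply: sub_sigma_algebra2; apply: subset_trans; last exact: subsetUl.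
by apply: setUSS; apply: sub_sigma_algebra2 => A [i _ h]; exists i.
Qed.

Lemma copy_others c n c' D : measurable D -> others c' (copy c n @^-1` D).
Proof.
move=> mD; case: c; apply: sub_sigma_algebra; left.
  by left; apply: sub_sigma_algebra; exists n => //; exists D => //; rewrite setTI.
by right; apply: sub_sigma_algebra; exists n => //; exists D => //; rewrite setTI.
Qed.

Definition block_of c j (w : O) : PT * PTT :=
  (fun n => copy c (j + n)%N w, W (c, j) ^~ w).

Lemma copy_block_law c j :
  cond_law Pr (copy_hist c j) (copy c j) (kernel_law E (measurable_block BE))
    (block_of c j).
Proof.
have WP := adapted_chain_shift j (copy_adapted c).
have [sG Gm] := others_sigma (c, j).
have GX n D : measurable D -> others (c, j) (copy c (j + n)%N @^-1` D).
  exact: copy_others.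
have FR := FP (c, j).
have := block_law CP BE WP sG Gm GX _ _.
rewrite addn0; apply.
  by case: (c); exact: hist_others.
by move: FR; rewrite /copy; case: (c).
Qed.

Let mW c n : measurable_fun setT (W c n).
Proof. by have [h _ _] := FP c; exact: h. Qed.

Lemma measurable_block_of c j : measurable_fun setT (block_of c j).
Proof.
apply/measurable_fun_pair; last exact: measurable_path.
by apply: measurable_path => n; case: (c); [exact: (mXY _).1|exact: (mXY _).2].
Qed.

Let mdiag : measurable (@diag d T). Proof. by case: cQ. Qed.

Let mbH : measurable_fun setT bH.
Proof. exact: (measurable_blockH cQ L mf ms). Qed.

Lemma copy_drift c n : (\int[Pr]_w (V (copy c n w))%:E <= (v0 + B)%:E)%E.
Proof.
exact: (chain_drift mV V1 lambda01 b0 QV (copy_adapted c) (@copy_initial c) muV).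
Qed.

(** A bound linear in [V] at the starting state of a block becomes a constant on averaging, by
    [copy_drift]. *)
Lemma block_of_bound (F : PT * PTT -> \bar R) K c j : 0 <= K ->
  measurable_fun setT F -> (forall y, 0 <= F y)%E ->
  (forall x, \int[E x]_w F (XE ^~ w, WE ^~ w) <= (K * V x)%:E)%E ->
  (\int[Pr]_w F (block_of c j w) <= (K * (v0 + B))%:E)%E.
Proof.
move=> K0 mF F0 FK; have WP := copy_adapted c; have [_ sG _ _ _] := WP.
have GT : copy_hist c j setT.
  by exact: sigma_algebra_setT (sG j).1.
have -> := cond_law_integral_set Pr1 (sG j).1 (sG j).2
  (adapted_chain_measurable WP j) (measurable_block_of c j) (@copy_block_law c j)
  GT mF F0.
apply: (@le_trans _ _ (\int[Pr]_w (K%:E * (V (copy c j w))%:E))%E).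
  apply: ge0_le_integral_nonmeas => w; first exact: integral_ge0.
  rewrite ge0_integral_pushforward//; last exact: measurable_block.
rewrite ge0_integralZl_EFin//; last first.
  by apply: (measurableT_comp mVE); exact: adapted_chain_measurable WP j.
by rewrite EFinM lee_wpmul2l ?lee_fin//; exact: copy_drift.
Qed.

Let bmom := block_moment mV V1 lambda01 b0 QV cQ CP M0 rho01 Ctail mf L1 m1 me
  Cf0 fV ms a1 Cs0 young sV BE.

Let mpow (g : PT * PTT -> R) q : measurable_fun setT g ->
  measurable_fun setT (fun y => (`|g y| `^ q)%:E).
Proof.
move=> mg; apply/measurable_EFinP; apply: (measurableT_comp (measurable_powR q)).
exact: measurableT_comp.
Qed.

Lemma block_of_moment : exists2 K, 0 <= K & forall c j,
  (\int[Pr]_w (`|bH (block_of c j w)| `^ k)%:E <= K%:E)%E.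
Proof.
have [K K0 bK] := bmom.
exists (K * (v0 + B)) => [|c j]; first by rewrite mulr_ge0// addr_ge0.
apply: (block_of_bound (F := fun y => (`|bH y| `^ k)%:E)) => //.
exact: mpow.
Qed.

Lemma block_of_integrable c j :
  Pr.-integrable setT (fun w => (bH (block_of c j w))%:E).
Proof.
have [K K0 bK] := block_of_moment.
have l1 : (Pr setT <= 1)%E by rewrite Pr1.
have mb : measurable_fun setT (fun w => bH (block_of c j w)).
  exact: (measurableT_comp mbH (measurable_block_of c j)).
by have [] := powR_integrable l1 mb k1 (bK c j).
Qed.

Local Notation bmean := (block_mean f L s E XE WE).

Let law_integrable x :
  (kernel_law E (measurable_block BE) x).-integrable setT (EFin \o bH) /\
  \int[kernel_law E (measurable_block BE) x]_y bH y = bmean x.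
Proof.
have mblock := measurable_block BE.
split.
  have [K K0 bK] := bmom.
  have l1 : (kernel_law E mblock x setT <= 1)%E by rewrite prob_kernel.
  have [] := powR_integrable l1 mbH k1 (K := K * V x) _ => //.
  rewrite ge0_integral_pushforward//.
  exact: mpow.
congr fine; apply: (integral_transfer (h1 := id)
  (h2 := fun w => (XE ^~ w, WE ^~ w) : PT * PTT)) => //.
by move=> F mF F0; rewrite ge0_integral_pushforward.
Qed.

Lemma block_of_mean c j A : copy_hist c j A ->
  \int[Pr]_w (\1_A w * bH (block_of c j w)) =
  \int[Pr]_w (\1_A w * bmean (copy c j w)) /\
  Pr.-integrable setT (fun w => (\1_A w * bmean (copy c j w))%:E).
Proof.
move=> GA; have WP := copy_adapted c; have [_ sG _ _ _] := WP.
have mA : (copy_hist c j).-sigma.-measurable A.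
  by rewrite (measurable_g_measurableTypeE (sG j).1).
have iA : Pr.-integrable setT (fun w => (\1_A w * bH (block_of c j w))%:E).
  exact: (indic_mul_integrable ((sG j).2 _ GA) (block_of_integrable c j)).
have [i1 e1] := cond_law_Rintegral Pr1 (sG j).1 (sG j).2
  (adapted_chain_measurable WP j) (measurable_block_of c j) (@copy_block_law c j)
  (measurable_indic mA) mbH iA (fun w => (law_integrable (copy c j w)).1).
split.
  rewrite [LHS]e1; apply: eq_Rintegral => w _.
  by rewrite (law_integrable (copy c j w)).2.
move: i1; apply: eq_integrable => // w _.
by rewrite (law_integrable (copy c j w)).2.
Qed.

(** * The lagged pair and the auxiliary pairs as coupled paths *)

Definition lagged w : PTT := fun n => (X (n + L)%N w, Y n w).

Let ZP := lagged_pair_adapted LP.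

Let mlagged : measurable_fun setT lagged.
Proof. by apply: measurable_path; exact: adapted_chain_measurable ZP. Qed.

Section law_of_a_coupled_path.
Variables (G : set (set O)) (U : O -> T * T) (xi : O -> PTT).
Hypotheses (sG : sigma_algebra setT G) (Gm : G `<=` measurable).
Hypotheses (mU : measurable_fun setT U) (mxi : measurable_fun setT xi).
Hypothesis xiC : cond_law Pr G U (kernel_law C (measurable_WC CP)) xi.

Let GT : G setT. Proof. exact: sigma_algebra_setT. Qed.

Lemma path_law_integral (F : PTT -> \bar R) : measurable_fun setT F ->
  (forall y, 0 <= F y)%E ->
  (\int[Pr]_w F (xi w) = \int[Pr]_w \int[C (U w)]_w' F (WC ^~ w'))%E.
Proof.
move=> mF F0; have := cond_law_integral_set Pr1 sG Gm mU mxi xiC GT mF F0.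
move=> ->; apply: eq_integral => w _.
by rewrite ge0_integral_pushforward//; exact: measurable_WC.
Qed.

Lemma path_law_prob (D : set PTT) : measurable D ->
  (Pr (xi @^-1` D) = \int[Pr]_w C (U w) ((fun w' => WC ^~ w' : PTT) @^-1` D))%E.
Proof. by move=> mD; rewrite -[X in Pr X]setTI xiC. Qed.

Lemma path_law_meeting : {ae Pr, forall w, meeting (xi w) <> None}.
Proof.
have mD : measurable [set w : PTT | forall n, meeting_ge w n].
  rewrite (_ : [set _ | _] = \bigcap_n [set w : PTT | meeting_ge w n]).
    by apply: bigcapT_measurable => n; exact: measurable_meeting_ge.
  by apply/seteqP; split=> w /= h n => [_|]; exact: h.
exists (xi @^-1` [set w : PTT | forall n, meeting_ge w n]); split.
- by rewrite -[X in measurable X]setTI; exact: mxi.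
- rewrite path_law_prob//; apply: integral0_eq => w _.
  case: (U w) => x y.
  have [N [mN N0 CN]] := meeting_finite V1 cQ CP M0 rho01 Ctail x y.
  apply/eqP; rewrite eq_le measure_ge0 andbT -N0; apply: le_measure.
  + rewrite inE -[X in measurable X]setTI; apply: (measurable_WC CP) => //.
  + by rewrite inE.
  + move=> w' /= h; apply: CN => /=; apply; apply/first_time_None => i.
    by apply: (h i.+1).
- move=> w /= /contrapT /first_time_None h n i _; exact: h.
Qed.

End law_of_a_coupled_path.

Let sZ n := pair_hist_sigma LP (0 + L) n.
Let ZC : cond_law Pr (H (0 + L) 0) (fun w => (X (0 + L)%N w, Y 0%N w))
  (kernel_law C (measurable_WC CP)) lagged.
Proof. exact: (adapted_chain_law ZP CP (measurable_WC CP)). Qed.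

Lemma lagged_finite : {ae Pr, forall w, meeting (lagged w) <> None}.
Proof. by apply: path_law_meeting ZC => //; exact: (sZ 0).1. Qed.

Lemma lagged_tail : exists2 K, 0 <= K & forall n,
  (Pr [set w | meeting_ge (lagged w) n] <= (K * rho ^+ n)%:E)%E.
Proof.
have /andP[r0 r1] := rho01.
have M10 : 0 <= 1 + M / rho by rewrite addr_ge0// divr_ge0// ltW.
have S0 : 0 <= v0 + B + (v0 + B) by rewrite !addr_ge0.
exists ((1 + M / rho) * (v0 + B + (v0 + B))) => [|n]; first by rewrite mulr_ge0.
have mge := measurable_meeting_ge mdiag n.
rewrite (path_law_prob (sZ 0).1 ZC mge).
have c0 : 0 <= (1 + M / rho) * rho ^+ n by rewrite mulr_ge0// exprn_ge0// ltW.
have mVX c j : measurable_fun setT (fun w => (V (copy c j w))%:E).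
  by apply: (measurableT_comp mVE); case: c; [exact: (mXY _).1|exact: (mXY _).2].
apply: (@le_trans _ _ (\int[Pr]_w (((1 + M / rho) * rho ^+ n)%:E *
    ((V (copy true L w))%:E + (V (copy false 0 w))%:E)))%E).
  apply: ge0_le_integral_nonmeas => w; first exact: measure_ge0.
  rewrite (le_trans (meeting_ge_tail V1 M0 rho01 Ctail _ _ n))//.
  by rewrite -EFinD -EFinM lee_fin mulrAC.
rewrite ge0_integralZl_EFin//; [|by move=> w _; rewrite adde_ge0|exact: emeasurable_funD].
rewrite ge0_integralD//.
rewrite [leRHS](_ : _ = ((1 + M / rho) * rho ^+ n)%:E *
  ((v0 + B)%:E + (v0 + B)%:E))%E; last by rewrite -EFinD -EFinM mulrAC.
by rewrite lee_wpmul2l ?lee_fin// leeD// copy_drift.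
Qed.

Let mcopy c n : measurable_fun setT (copy c n).
Proof. by case: c; [exact: (mXY _).1|exact: (mXY _).2]. Qed.

Let mWp c : measurable_fun setT (fun w => W c ^~ w : PTT).
Proof. exact: measurable_path. Qed.

Let mUc (c : bool * nat) : measurable_fun setT (fun w => (copy c.1 (c.2 + L)%N w, z)).
Proof. exact/measurable_fun_pair. Qed.

Let WcC (c : bool * nat) : cond_law Pr (others c)
  (fun w => (copy c.1 (c.2 + L)%N w, z)) (kernel_law C (measurable_WC CP))
  (fun w => W c ^~ w : PTT).
Proof.
move=> A D; apply: fresh_run_law => //; first exact: (others_sigma c).2.
by have := FP c; rewrite /copy; case: (c.1).
Qed.

Lemma fresh_finite : {ae Pr, forall w c, meeting (W c ^~ w) <> None}.
Proof.
have fin c : {ae Pr, forall w, meeting (W c ^~ w) <> None}.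
  by apply: path_law_meeting (@WcC c) => //; exact: (others_sigma c).1.
have := ae_foralln (fun j => fin (true, j)); have := ae_foralln (fun j => fin (false, j)).
by apply: filterS2 => w hY hX [[] j]; [exact: hX|exact: hY].
Qed.

Lemma fresh_meeting_moment : exists2 K, 0 <= K & forall c,
  (\int[Pr]_w (meeting_value R (W c ^~ w) `^ 2)%:E <= K%:E)%E.
Proof.
have [K K0 mK] := meeting_value_moment V1 cQ CP M0 rho01 Ctail.
exists (K * (v0 + B + V z)) => [|c]; first by rewrite mulr_ge0// !addr_ge0.
have mF : measurable_fun setT (fun w : PTT => (meeting_value R w `^ 2)%:E).
  apply/measurable_EFinP; apply: (measurableT_comp (measurable_powR 2)).
  exact: measurable_meeting_value.
rewrite (path_law_integral (others_sigma c).1 (others_sigma c).2 (mUc c) (mWp c)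
  (@WcC c) mF); last by move=> y; rewrite lee_fin powR_ge0.
have mVc : measurable_fun setT (fun w => (V (copy c.1 (c.2 + L)%N w))%:E).
  exact: (measurableT_comp mVE).
apply: (@le_trans _ _ (\int[Pr]_w (K%:E *
    ((V (copy c.1 (c.2 + L)%N w))%:E + (V z)%:E)))%E).
  apply: ge0_le_integral_nonmeas => w.
    by apply: integral_ge0 => y _; rewrite lee_fin powR_ge0.
  by rewrite -EFinD -EFinM; exact: mK.
rewrite ge0_integralZl_EFin//; [|by move=> w _; rewrite adde_ge0|exact: emeasurable_funD].
rewrite ge0_integralD//.
rewrite EFinM EFinD lee_wpmul2l ?lee_fin// leeD// ?copy_drift//.
by rewrite integral_cst// [X in (_ * X)%E]Pr1 mule1.
Qed.

(** * The bias term as a series of block increments *)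

Definition bias k w : R := BC f s L k (X ^~ w) (Y ^~ w)
  (fun j i => W (true, j) i w) (fun j i => W (false, j) i w).

Definition increment n w : R :=
  bH (block_of true (n + L) w) - bH (block_of false n w).

Definition not_met n : set O := [set w | meeting_ge (lagged w) n].

Lemma Hval_block c j w :
  Hval f s L (copy c ^~ w) j (fun i => W (c, j) i w) = bH (block_of c j w).
Proof.
by rewrite /bH /Hval; congr (_ * _); apply: eq_bigr => i _ /=; rewrite !add0n addnS.
Qed.

Lemma meeting_ge_Some (w : nat -> T * T) t n : meeting w = Some t ->
  meeting_ge w n <-> (n <= t)%N.
Proof.
rewrite /meeting => h; have [/= et lt] := (first_time_Some _ _).1 h; split.
  by move=> nt; rewrite leqNgt; apply/negP => /nt; exact.
by move=> nt i it; apply: lt; exact: leq_trans nt.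
Qed.

Lemma indic_not_met w t n : meeting (lagged w) = Some t ->
  \1_(not_met n) w = (n <= t)%:R :> R.
Proof.
move=> wt; rewrite indicE; congr (_%:R); congr nat_of_bool.
apply/idP/idP; first by rewrite inE => /(meeting_ge_Some _ wt).
by move=> h; rewrite inE; apply/(meeting_ge_Some _ wt).
Qed.

(** With [tau = t + L], the term [i] of [BC], counted from 0, is present exactly when the pair has
    not met before [j + i * L]. The case distinctions come from the truncated subtraction. *)
Let block_nblocks i j t : (i < nblocks L j (t + L))%N = (j + i * L <= t)%N.
Proof.
rewrite /nblocks leq_divRL// mulSn.
case: (leqP j t) => jt.
  by rewrite addnC -addnBAC// leq_add2r leq_subRL.
rewrite [RHS](_ : _ = false); last first.
  by apply/negbTE; rewrite -ltnNge ltn_addr.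
apply/negbTE; rewrite -ltnNge.
case: (leqP j (t + L)) => jtL.
  by rewrite ltn_subLR// addnA ltn_addr// ltn_add2r.
rewrite (eqP (ltnW jtL : (t + L - j == 0)%N)).
by rewrite addn_gt0 L1.
Qed.

(** The indicators make the length [N] arbitrary beyond the number of blocks, so that sums of
    different random lengths can be compared. *)
Lemma bias_sum j w t N : meeting (lagged w) = Some t ->
  (nblocks L j (t + L) <= N)%N ->
  bias j w = \sum_(0 <= i < N) \1_(not_met (j + i * L)) w * increment (j + i * L) w.
Proof.
move=> wt nN; rewrite /bias /BC lagged_meetingE -/(lagged w) wt big_add1/=.
rewrite (big_cat_nat (leq0n _) nN)/= [X in _ = _ + X]big1_seq ?addr0; last first.
  move=> i /andP[_]; rewrite mem_index_iota => /andP[ni _].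
  by rewrite (indic_not_met _ wt) -block_nblocks ltnNge ni mul0r.
apply: eq_big_nat => i /andP[_ ib].
rewrite (indic_not_met _ wt) -block_nblocks ib mul1r /increment -!Hval_block.
have -> // : (j + i.+1 * L = j + i * L + L)%N by rewrite mulSn (addnC L) addnA.
Qed.

Lemma bias_le j w : exists n, `|bias j w| <= \sum_(0 <= i < n)
  `|increment (j + i * L) w| * \1_(not_met (j + i * L)) w.
Proof.
case wt : (meeting (lagged w)) => [t|].
  exists (nblocks L j (t + L)); rewrite (bias_sum wt (leqnn _)).
  rewrite (le_trans (ler_norm_sum _ _ _))//; apply: ler_sum => i _.
  by rewrite normrM mulrC ler_pM// indicE ger0_norm.
exists 0%N; rewrite /bias /BC lagged_meetingE -/(lagged w) wt normr0.
by rewrite big_geq.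
Qed.

(** Starting [L] steps later drops the first term. Where the pair never meets the identity may fail:
    both biases are 0 by convention, while the first increment need not be. *)
Lemma bias_rec j w : meeting (lagged w) <> None ->
  bias j w = \1_(not_met j) w * increment j w + bias (j + L) w.
Proof.
case wt : (meeting (lagged w)) => [t|]// _.
have h : (nblocks L (j + L) (t + L) <= nblocks L j (t + L))%N.
  by rewrite leq_div2r// leq_sub2l// leq_addr.
(* One term more than the number of blocks, so that a first term can be split off even from an empty
   sum. *)
rewrite (bias_sum wt (leqnSn _)) big_nat_recl//= mul0n addn0; congr (_ + _).
rewrite (bias_sum wt h); apply: eq_bigr => i _.
by rewrite mulSn addnA.
Qed.

Lemma measurable_increment n : measurable_fun setT (increment n).
Proof.
by apply: measurable_funB; exact: (measurableT_comp mbH (measurable_block_of _ _)).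
Qed.

Lemma measurable_not_met n : measurable (not_met n).
Proof.
have := mlagged measurableT (measurable_meeting_ge mdiag n).
by rewrite setTI.
Qed.

Lemma measurable_bias j : measurable_fun setT (bias j).
Proof.
have -> : bias j = fun w => if meeting (lagged w) is Some t then
    \sum_(0 <= i < nblocks L j (t + L))
      \1_(not_met (j + i * L)) w * increment (j + i * L) w else 0.
  apply/funext => w; case wt : (meeting (lagged w)) => [t|].
    exact: (bias_sum wt (leqnn _)).
  by rewrite /bias /BC lagged_meetingE -/(lagged w) wt.
apply: (measurable_option_case (tau := fun w => meeting (lagged w))
  (g := fun t w => \sum_(0 <= i < nblocks L j (t + L))
      \1_(not_met (j + i * L)) w * increment (j + i * L) w)) => // [t|t].
- apply: (measurable_first_time (A := fun i => [set w | diag (lagged w i)])) => i.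
  rewrite -[X in measurable X]setTI.
  exact: (adapted_chain_measurable ZP i measurableT mdiag).
- apply: measurable_sum => i; apply: measurable_funM.
    exact/measurable_indic/measurable_not_met.
  exact: measurable_increment.
Qed.

Lemma increment_moment : exists2 K, 0 <= K & forall n,
  (\int[Pr]_w (`|increment n w| `^ k)%:E <= K%:E)%E.
Proof.
have [K K0 bK] := block_of_moment.
have c0 : 0 <= 2 `^ k :> R by exact: powR_ge0.
exists (2 `^ k * (K + K)) => [|n]; first by rewrite mulr_ge0// addr_ge0.
have mb c j : measurable_fun setT (fun w => (`|bH (block_of c j w)| `^ k)%:E).
  exact: (measurableT_comp (mpow k mbH) (measurable_block_of c j)).
apply: (@le_trans _ _ (\int[Pr]_w ((2 `^ k)%:E *
    ((`|bH (block_of true (n + L) w)| `^ k)%:E +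
     (`|bH (block_of false n w)| `^ k)%:E)))%E).
  apply: ge0_le_integral_nonmeas => w; first by rewrite lee_fin powR_ge0.
  by rewrite -EFinD -EFinM lee_fin powRB_le2.
have pow0 c j w : (0 <= (`|bH (block_of c j w)| `^ k)%:E)%E.
  by rewrite lee_fin powR_ge0.
rewrite ge0_integralZl_EFin//; [|by move=> w _; rewrite adde_ge0|exact: emeasurable_funD].
rewrite ge0_integralD// EFinM lee_wpmul2l ?lee_fin//.
by rewrite EFinD leeD.
Qed.

(** As [L >= 1], the probability of [not_met (j + i * L)] is at most a multiple of [rho ^+ (j + i)],
    which gives the decay in [j]. The order [q = 1] serves the mean, [q = 2] the second moment. *)
Lemma bias_moment q : 1 <= q -> q < k -> exists C0 s0, [/\ 0 <= C0, 0 < s0 < 1 &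
  forall j, (\int[Pr]_w (`|bias j w| `^ q)%:E <= (C0 * s0 ^+ j)%:E)%E].
Proof.
move=> q1 qk; have [C0 [s0 [C00 s01 gsm]]] := @geometric_sum_moment _ O R q k rho q1 qk rho01.
have [Ki Ki0 incK] := increment_moment; have [Kt Kt0 tailK] := lagged_tail.
have /andP[r0 r1] := rho01.
exists (C0 * (Ki + Kt)), s0; split => // [|j]; first by rewrite mulr_ge0// addr_ge0.
apply: (gsm Pr (Ki + Kt) j (fun i w => `|increment (j + i * L) w|)
  (fun i => not_met (j + i * L)) (fun w => `|bias j w|)).
- exact: addr_ge0.
- by move=> i; apply: measurableT_comp => //; exact: measurable_increment.
- by [].
- by move=> i; exact: measurable_not_met.
- by move=> i; rewrite (le_trans (incK _))// lee_fin lerDl.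
- move=> i; rewrite (le_trans (tailK _))// lee_fin ler_pM ?exprn_ge0 ?(ltW r0)//.
    by rewrite lerDr.
  by rewrite ler_wiXn2l ?(ltW r0) ?(ltW r1)// leq_add2l leq_pmulr.
- by [].
- by move=> w; exact: bias_le.
Qed.

Lemma bias_integrable j : Pr.-integrable setT (EFin \o bias j) /\
  exists C0 s0, [/\ 0 <= C0, 0 < s0 < 1 & forall j, \int[Pr]_w `|bias j w| <= C0 * s0 ^+ j].
Proof.
have k1' : 1 < k by rewrite (lt_trans _ k2)// ltr1n.
have [C0 [s0 [C00 s01 bC]]] := bias_moment (lexx 1) k1'.
have l1 : (Pr setT <= 1)%E by rewrite Pr1.
have ib i := (powR_integrable l1 (measurable_bias i) (lexx 1) (bC i)).1.
split; first exact: ib.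
exists C0, s0; split => // i; rewrite -lee_fin -Rintegral_EFin; last first.
  exact: (integrable_norm (ib i)).
rewrite (le_trans _ (bC i))//; apply: ge0_le_integral_nonmeas => w.
  by rewrite lee_fin.
by rewrite powRr1.
Qed.

Let dbm : dominated V bmean.
Proof.
exact: (dominated_block_mean mV V1 lambda01 b0 QV cQ CP M0 rho01 Ctail mf L1 m1 me
  Cf0 fV ms a1 k1 Cs0 young sV BE).
Qed.

Let ibm c j : Pr.-integrable setT (fun w => (bmean (copy c j w))%:E).
Proof.
exact: (chain_integrable mV V1 lambda01 b0 QV (copy_adapted c) (@copy_initial c) muV).
Qed.

Lemma block_of_meanT c j :
  \int[Pr]_w bH (block_of c j w) = \int[mu0]_x Pn Q j bmean x.
Proof.
have [_ sG _ _ _] := copy_adapted c.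
have GT : copy_hist c j setT by exact: sigma_algebra_setT (sG j).1.
have [] := block_of_mean GT.
rewrite indicT; under eq_Rintegral do rewrite mul1r.
move=> ->; under eq_Rintegral do rewrite mul1r.
by rewrite (chain_mean mV V1 lambda01 b0 QV (copy_adapted c) (@copy_initial c) muV).
Qed.

Lemma not_met_hist j : H (j + L) j (not_met j).
Proof.
have [sH _] := pair_hist_sigma LP (j + L) j.
have -> : not_met j = \bigcap_(i in `I_j) [set w | ~ diag (lagged w i)].
  by apply/seteqP; split => w h i; exact: h.
rewrite -(measurable_g_measurableTypeE sH).
apply: bigcap_measurableType => // i /= ij.
have := adapted_chain_adapted ZP (ltnW ij) measurableT (measurableC mdiag).
by rewrite setTI.
Qed.

(* Off [not_met j] the two blocks start at the same state, almost surely, so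
   that the indicator can be dropped once both are averaged. *)
Lemma increment_mean j : \int[Pr]_w (\1_(not_met j) w * increment j w) =
  \int[mu0]_x Pn Q (j + L) bmean x - \int[mu0]_x Pn Q j bmean x.
Proof.
have hX : copy_hist true (j + L) (not_met j).
  by rewrite /copy_hist addnK; exact: not_met_hist.
have hY : copy_hist false j (not_met j) by exact: not_met_hist.
have [eX iX] := block_of_mean hX; have [eY iY] := block_of_mean hY.
have mN := measurable_not_met j.
transitivity (\int[Pr]_w (\1_(not_met j) w * bH (block_of true (j + L) w)
    - \1_(not_met j) w * bH (block_of false j w))).
  by apply: eq_Rintegral => w _; rewrite /increment mulrBr.
rewrite RintegralB//; [|exact: (indic_mul_integrable mN (block_of_integrable _ _))..].
rewrite eX eY -RintegralB//.
rewrite -(chain_mean mV V1 lambda01 b0 QV (copy_adapted true) (@copy_initial true) muV)//.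
rewrite -(chain_mean mV V1 lambda01 b0 QV (copy_adapted false) (@copy_initial false) muV)//.
rewrite -RintegralB//; [|exact: ibm..].
congr fine; apply: ae_eq_integral => //.
- by apply/measurable_EFinP; apply: measurable_funB; apply: measurable_funM => //;
    apply: (measurableT_comp dbm.1).
- by apply/measurable_EFinP; apply: measurable_funB;
    apply: (measurableT_comp dbm.1).
have := diag_absorbing cQ ZP; apply: filterS => w dw _.
rewrite -mulrBr; have [wN|wN] := pselect (not_met j w).
  by rewrite indicE mem_set// mul1r.
rewrite indicE memNset// mul0r.
have [i [ij di]] : exists i, (i < j)%N /\ diag (lagged w i).
  by apply: contrapT => h; apply: wN => i ij di; apply: h; exists i.
have := dw i j (ltnW ij) di; rewrite /diag/= /copy => ->.
by rewrite subrr.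
Qed.

(** [bias_rec] in the mean: its exceptional event is null. *)
Lemma bias_mean_rec j : \int[Pr]_w bias j w = \int[Pr]_w bias (j + L) w +
  (\int[mu0]_x Pn Q (j + L) bmean x - \int[mu0]_x Pn Q j bmean x).
Proof.
have mN := measurable_not_met j.
have ii : Pr.-integrable setT (EFin \o increment j).
  have [K K0 iK] := increment_moment.
  have l1 : (Pr setT <= 1)%E by rewrite Pr1.
  by have [] := powR_integrable l1 (measurable_increment j) k1 (iK j).
rewrite addrC -increment_mean -RintegralD//; last 2 first.
- exact: (indic_mul_integrable mN ii).
- exact: (bias_integrable _).1.
congr fine; apply: ae_eq_integral => //.
- exact/measurable_EFinP/measurable_bias.
- apply/measurable_EFinP; apply: measurable_funD; last exact: measurable_bias.
  by apply: measurable_funM => //; exact: measurable_increment.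
by have := lagged_finite; apply: filterS => w wN _; rewrite (bias_rec j wN).
Qed.

Variables (pi0 : probability T R) (R1 s1 : R).
Hypothesis invpi : invariant Q pi0.
Hypothesis s101 : 0 < s1 < 1.
Hypothesis ergV : forall g : T -> R, measurable_fun setT g ->
  (forall y, `|g y| <= V y) -> forall x n, (0 < n)%N ->
  `|Pn Q n g x - \int[pi0]_y g y| <= R1 * V x * s1 ^+ n.

Lemma estimator_mean j :
  \int[Pr]_w bH (block_of true j w) + \int[Pr]_w bias j w = \int[pi0]_x bmean x.
Proof.
pose h n := \int[mu0]_x Pn Q n bmean x.
pose u n := h n + \int[Pr]_w bias n w.
rewrite block_of_meanT -/(u j).
have uL n : u (j + n * L)%N = u j.
  elim: n => [|n IH]; first by rewrite mul0n addn0.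
  rewrite -IH mulSn (addnC L) addnA /u (bias_mean_rec (j + n * L)).
  by rewrite -/(h _) -/(h _) addrCA subrKC addrC.
have hcvg : h n @[n --> \oo] --> \int[pi0]_x bmean x.
  have := chain_mean_cvg mV V1 lambda01 b0 QV (copy_adapted true)
    (@copy_initial true) muV invpi s101 ergV dbm.
  under eq_fun do rewrite (chain_mean mV V1 lambda01 b0 QV (copy_adapted true)
    (@copy_initial true) muV)//.
  exact.
have bcvg : (\int[Pr]_w bias n w) @[n --> \oo] --> (0 : R).
  have [_ [C0 [s0 [C00 /andP[s00 s01] bC]]]] := bias_integrable 0.
  apply/norm_cvg0P; apply: (squeeze_cvgr (f := cst 0) (h := fun n => C0 * s0 ^+ n)).
  - apply: nearW => n; rewrite normr_ge0/=.
    exact: le_trans (le_normr_Rintegral measurableT (bias_integrable n).1) (bC n).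
  - exact: cvg_cst.
  - by apply: cvg_geometric; rewrite gtr0_norm.
have ucvg : u n @[n --> \oo] --> \int[pi0]_x bmean x.
  by rewrite -[X in _ --> X]addr0; apply: cvgD.
have uj : u (j + n * L)%N @[n --> \oo] --> \int[pi0]_x bmean x.
  apply: cvg_comp ucvg; apply/cvgnyPge => A; near=> n.
  rewrite (leq_trans _ (leq_addl _ _))// (leq_trans _ (leq_pmulr _ L1))//.
  by near: n; exact: nbhs_infty_ge.
rewrite (_ : (fun n => u (j + n * L)%N) = cst (u j)) in uj; last exact/funext.
by rewrite -(cvg_lim (@Rhausdorff R) uj) lim_cst.
Unshelve. all: by end_near.
Qed.

(** * Computation time *)

Definition total_cost j w : \bar R := cost R L j (X ^~ w) (Y ^~ w)
  (fun j i => W (true, j) i w) (fun j i => W (false, j) i w).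

Local Notation mv c w := (meeting_value R (W c ^~ w)).

(** One more block takes [L] steps of each of [X] and [Y], and two auxiliary pairs, whose steps
    count twice. *)
Let pair_cost j i w : R :=
  2 * L%:R + 2 * mv (true, (j + i.+1 * L)%N) w + 2 * mv (false, (j + i * L)%N) w.

Let blocks_cost j w : R := if meeting (lagged w) is Some t then
  \sum_(0 <= i < nblocks L j (t + L)) pair_cost j i w else 0.

Let mv0 c w : 0 <= mv c w. Proof. exact: meeting_value_ge0. Qed.

Let pair_cost0 j i w : 0 <= pair_cost j i w.
Proof. by rewrite /pair_cost !addr_ge0 ?mulr_ge0. Qed.

Let run_cost_value c w : meeting (W c ^~ w) <> None ->
  run_cost R (W c ^~ w) = (2 * mv c w)%:E.
Proof.
by rewrite /run_cost /meeting_value; case: (meeting _) => // t _; rewrite natrM.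
Qed.

Let total_costE j w : meeting (lagged w) <> None ->
  (forall c, meeting (W c ^~ w) <> None) ->
  total_cost j w = ((j + L + j)%:R + 2 * mv (true, j) w + blocks_cost j w)%:E.
Proof.
rewrite /total_cost /blocks_cost /cost lagged_meetingE -/(lagged w).
case: (meeting (lagged w)) => // t _ fin.
set q := nblocks L j (t + L).
rewrite (run_cost_value (fin (true, j))) big_add1/=.
under eq_bigr => i _ do rewrite (run_cost_value (fin (true, (j + i.+1 * L)%N)))
  (run_cost_value (fin (false, (j + i * L)%N))) -EFinD.
rewrite sumEFin -!EFinD; congr EFin; rewrite /pair_cost.
under [in RHS]eq_bigr do rewrite -addrA.
rewrite [in RHS]big_split/= sumr_const_nat subn0.
have -> : (j + q.+1 * L + (j + q * L) = j + L + j + 2 * (q * L))%N.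
  by ring.
rewrite natrD !natrM -mulr_natr; ring.
Qed.

Lemma measurable_mv c : measurable_fun setT (fun w => mv c w).
Proof. exact: (measurableT_comp (measurable_meeting_value mdiag) (mWp c)). Qed.

Let measurable_pair_cost j i : measurable_fun setT (pair_cost j i).
Proof.
apply: measurable_funD; last by apply: measurable_funM => //; exact: measurable_mv.
apply: measurable_funD => //.
by apply: measurable_funM => //; exact: measurable_mv.
Qed.

Let lagged_meeting_measurable t : measurable [set w | meeting (lagged w) = Some t].
Proof.
apply: (measurable_first_time (A := fun i => [set w | diag (lagged w i)])) => i.
rewrite -[X in measurable X]setTI.
exact: (adapted_chain_measurable ZP i measurableT mdiag).
Qed.

Let measurable_blocks_cost j : measurable_fun setT (blocks_cost j).
Proof.
apply: (measurable_option_case (tau := fun w => meeting (lagged w))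
  (g := fun t w => \sum_(0 <= i < nblocks L j (t + L)) pair_cost j i w)) => //.
by move=> t; exact: measurable_sum.
Qed.

Lemma measurable_total_cost j : measurable_fun setT (total_cost j).
Proof.
have mrun c : measurable_fun setT (fun w => run_cost R (W c ^~ w)).
  exact: (measurableT_comp (measurable_run_cost mdiag) (mWp c)).
pose g t w : \bar R := let q := nblocks L j (t + L) in
  (((j + q.+1 * L) + (j + q * L))%N%:R%:E + run_cost R (W (true, j) ^~ w)
    + \sum_(1 <= t < q.+1)
        (run_cost R (W (true, (j + t * L)%N) ^~ w) +
         run_cost R (W (false, (j + t.-1 * L)%N) ^~ w)))%E.
have -> : total_cost j = fun w => if meeting (lagged w) is Some t then g t w else +oo%E.
  apply/funext => w; rewrite /total_cost /cost lagged_meetingE -/(lagged w).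
  by case: (meeting (lagged w)).
apply: (measurable_option_case (tau := fun w => meeting (lagged w)) (g := g)) => // t.
apply: emeasurable_funD; first exact: emeasurable_funD.
by apply: emeasurable_sum => i; exact: emeasurable_funD.
Qed.

Let pair_cost_moment : exists2 K, 0 <= K & forall j i,
  (\int[Pr]_w (`|pair_cost j i w| `^ 2)%:E <= K%:E)%E.
Proof.
have [K K0 mK] := fresh_meeting_moment.
(* [12 = 4 * 3], from [(2x + 2y + 2v)^2 <= 12 (x^2 + y^2 + v^2)], which is checked below with the
   squares of the three differences. *)
exists (12 * (L%:R ^+ 2 + K + K)) => [|j i].
  by rewrite mulr_ge0// !addr_ge0// exprn_ge0.
have mm c : measurable_fun setT (fun w => (mv c w `^ 2)%:E).
  apply/measurable_EFinP; apply: (measurableT_comp (measurable_powR 2)).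
  exact: measurable_mv.
have mm0 c w : (0 <= (mv c w `^ 2)%:E)%E by rewrite lee_fin powR_ge0.
have L0 : (0 <= (L%:R ^+ 2)%:E :> \bar R)%E by rewrite lee_fin exprn_ge0.
apply: (@le_trans _ _ (\int[Pr]_w (12%:E * ((L%:R ^+ 2)%:E +
    (mv (true, (j + i.+1 * L)%N) w `^ 2)%:E + (mv (false, (j + i * L)%N) w `^ 2)%:E)))%E).
  apply: ge0_le_integral_nonmeas => w; first by rewrite lee_fin powR_ge0.
  rewrite -!EFinD -EFinM lee_fin (ger0_norm (pair_cost0 _ _ _)) !powR_mulrn//.
  rewrite /pair_cost; set x := L%:R; set y := meeting_value _ _; set v := meeting_value _ _.
  have := sqr_ge0 (x - y); have := sqr_ge0 (y - v); have := sqr_ge0 (x - v).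
  by rewrite !sqrrB; nra.
rewrite ge0_integralZl_EFin//; first last.
- by apply: emeasurable_funD => //; exact: emeasurable_funD.
- by move=> w _; rewrite !adde_ge0.
rewrite ge0_integralD//; last 2 first.
- by move=> w _; rewrite !adde_ge0.
- exact: emeasurable_funD.
rewrite ge0_integralD// [leRHS]EFinM lee_wpmul2l ?lee_fin// !EFinD.
rewrite !leeD//.
by rewrite integral_cst// [X in (_ * X)%E]Pr1 mule1.
Qed.

Let blocks_cost0 j w : 0 <= blocks_cost j w.
Proof. by rewrite /blocks_cost; case: (meeting _) => // t; rewrite sumr_ge0. Qed.

Let blocks_cost_le j w : exists n, blocks_cost j w <=
  \sum_(0 <= i < n) pair_cost j i w * \1_(not_met (j + i * L)) w.
Proof.
rewrite /blocks_cost; case wt : (meeting (lagged w)) => [t|].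
  exists (nblocks L j (t + L)); rewrite le_eqVlt; apply/orP; left; apply/eqP.
  apply: eq_big_nat => i /andP[_ ib].
  by rewrite (indic_not_met _ wt) -block_nblocks ib mulr1.
by exists 0%N; rewrite big_geq.
Qed.

Lemma total_cost_integrable j : Pr.-integrable setT (total_cost j).
Proof.
have /andP[r0 r1] := rho01; have l1 : (Pr setT <= 1)%E by rewrite Pr1.
have [Kp Kp0 pK] := pair_cost_moment; have [Kt Kt0 tailK] := lagged_tail.
have one_lt2 : 1 < 2 :> R by rewrite ltr1n.
(* The expected cost is a first moment; the second moment of [pair_cost] leaves the room that a
   random number of terms requires. *)
have [C0 [s0 [C00 s01 gsm]]] := @geometric_sum_moment _ O R 1 2 rho (lexx 1) one_lt2 rho01.
have bK : (\int[Pr]_w (`|blocks_cost j w| `^ 1)%:E <= (C0 * (Kp + Kt) * s0 ^+ j)%:E)%E.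
  under eq_integral do rewrite ger0_norm//.
  apply: (gsm Pr (Kp + Kt) j (pair_cost j) (fun i => not_met (j + i * L))) => //.
  - exact: addr_ge0.
  - by move=> i; exact: measurable_not_met.
  - move=> i; under eq_integral do rewrite -(ger0_norm (pair_cost0 _ _ _)).
    by rewrite (le_trans (pK _ _))// lee_fin lerDl.
  - move=> i; rewrite (le_trans (tailK _))// lee_fin ler_pM ?exprn_ge0 ?(ltW r0)//.
      by rewrite lerDr.
    by rewrite ler_wiXn2l ?(ltW r0) ?(ltW r1)// leq_add2l leq_pmulr.
have ib := (powR_integrable l1 (measurable_blocks_cost j) (lexx 1) bK).1.
have [K K0 mK] := fresh_meeting_moment.
have im : Pr.-integrable setT (EFin \o (fun w => mv (true, j) w)).
  have [] := powR_integrable l1 (measurable_mv (true, j)) (ltW one_lt2) (K := K) _ => //.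
  by under eq_integral do rewrite ger0_norm//.
(* [total_cost] may be infinite on the null event that some pair never meets; [c] is its real
   version. *)
pose c w := (j + L + j)%:R + 2 * mv (true, j) w + blocks_cost j w.
have ic : Pr.-integrable setT (EFin \o c).
  have icst := finite_measure_integrable_cst Pr (j + L + j)%:R (measurableT : measurable [set: O]).
  exact: (integrableD measurableT
    (integrableD measurableT icst (integrableZl measurableT 2 im)) ib).
have /integrableP[mc clty] := ic.
apply/integrableP; split; first exact: measurable_total_cost.
rewrite (_ : (\int[Pr]_w _ = \int[Pr]_w `|(c w)%:E|)%E)//.
apply: ae_eq_integral => //.
- exact: measurableT_comp (measurable_total_cost j).
- exact: measurableT_comp mc.
have := lagged_finite; have := fresh_finite; apply: filterS2 => w hW hZ _.
by rewrite (total_costE j hZ hW).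
Qed.

(** * Second moment of one block *)

Definition Gamma_mean x : R := \int[E x]_w (bH (XE ^~ w, WE ^~ w) ^+ 2).

Let sqr_le (y : R) : y ^+ 2 <= 1 + `|y| `^ k.
Proof.
rewrite -real_normK ?num_real// -powR_mulrn//.
by apply: powR_le1D => //; rewrite ltW.
Qed.

Let Gamma_integrable : exists2 K, 0 <= K & forall x,
  (E x).-integrable setT (fun w => (bH (XE ^~ w, WE ^~ w) ^+ 2)%:E) /\
  Gamma_mean x <= K * V x.
Proof.
have [K K0 bK] := bmom; exists (1 + K) => [|x]; first exact: addr_ge0.
have mblock := measurable_block BE.
have mb2 : measurable_fun setT (fun w => bH (XE ^~ w, WE ^~ w) ^+ 2).
  by apply: measurable_funX; exact: (measurableT_comp mbH mblock).
have le1 : (\int[E x]_w (bH (XE ^~ w, WE ^~ w) ^+ 2)%:E <= ((1 + K) * V x)%:E)%E.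
  apply: (@le_trans _ _ (\int[E x]_w (1 + (`|bH (XE ^~ w, WE ^~ w)| `^ k)%:E))%E).
    apply: ge0_le_integral_nonmeas => w; first by rewrite lee_fin sqr_ge0.
    by rewrite -EFinD lee_fin.
  rewrite ge0_integralD//; last exact: (measurableT_comp (mpow k mbH) mblock).
  rewrite integral_cst// [X in (_ * X + _)%E]prob_kernel mule1.
  by rewrite mulrDl mul1r EFinD leeD// lee_fin.
have i2 : (E x).-integrable setT (fun w => (bH (XE ^~ w, WE ^~ w) ^+ 2)%:E).
  apply/integrableP; split; first exact/measurable_EFinP.
  under eq_integral do rewrite gee0_abs ?lee_fin ?sqr_ge0//.
  exact: le_lt_trans le1 (ltry _).
by split => //; rewrite -lee_fin -Rintegral_EFin.
Qed.

Lemma Gamma1E x : Gamma1 L f s E XE WE x = (Gamma_mean x)%:E.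
Proof.
have [K _ /(_ x) [i2 _]] := Gamma_integrable.
by rewrite -Rintegral_EFin.
Qed.

Lemma dominated_Gamma_mean : dominated V Gamma_mean.
Proof.
have [K _ GK] := Gamma_integrable; split.
  apply: measurable_Rintegral_kernel; apply: measurable_funX.
  exact: (measurableT_comp mbH (measurable_block BE)).
exists K => x; rewrite ger0_norm ?(GK x).2// Rintegral_ge0// => w _.
exact: sqr_ge0.
Qed.

Lemma block_of_sqr c j : (\int[Pr]_w (bH (block_of c j w) ^+ 2)%:E =
  (\int[Pr]_w Gamma_mean (copy c j w))%:E)%E.
Proof.
have WP := copy_adapted c; have [_ sG _ _ _] := WP.
have GT : copy_hist c j setT by exact: sigma_algebra_setT (sG j).1.
have mF : measurable_fun setT (fun y => (bH y ^+ 2)%:E).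
  by apply/measurable_EFinP; exact: measurable_funX.
have F0 y : (0 <= (bH y ^+ 2)%:E)%E by rewrite lee_fin sqr_ge0.
rewrite (cond_law_integral_set Pr1 (sG j).1 (sG j).2
  (adapted_chain_measurable WP j) (measurable_block_of c j) (@copy_block_law c j)
  GT mF F0).
rewrite -Rintegral_EFin; last first.
  exact: (chain_integrable mV V1 lambda01 b0 QV WP (@copy_initial c) muV _
    dominated_Gamma_mean).
apply: eq_integral => w _; rewrite ge0_integral_pushforward//.
  by rewrite -Gamma1E.
exact: measurable_block.
Qed.

Lemma block_of_sqr_cvg : \int[Pr]_w Gamma_mean (X j w) @[j --> \oo] -->
  \int[pi0]_x Gamma_mean x.
Proof.
exact: (chain_mean_cvg mV V1 lambda01 b0 QV (copy_adapted true)
  (@copy_initial true) muV invpi s101 ergV dominated_Gamma_mean).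
Qed.

End along_the_pair.

(** * Rates and exponents *)

(* For negative [q] the hypothesis at [n = 1] and [n = 2] forces [c = 0]. *)
Lemma geometric_rate (R : realType) (A : nat -> R) (c v q : R) : 0 < v ->
  (forall n, (0 < n)%N -> 0 <= A n <= c * v * q ^+ n) ->
  forall n, (0 < n)%N -> A n <= `|c| * v * Num.max q 2^-1 ^+ n.
Proof.
move=> v0 Ac n n0; have [A0 An] := andP (Ac n n0).
have q0 : 0 <= Num.max q 2^-1 by rewrite le_max invr_ge0 ler0n orbT.
have [q_ge0|q_lt0] := leP 0 q.
  rewrite (le_trans An)// (@le_trans _ _ (`|c| * v * q ^+ n))//.
    by rewrite ler_wpM2r ?exprn_ge0// ler_wpM2r ?(ltW v0)// ler_norm.
  rewrite ler_wpM2l ?mulr_ge0 ?(ltW v0)//.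
  by rewrite lerXn2r ?nnegrE// le_max lexx.
have c0 : c = 0.
  apply/eqP; rewrite eq_le; apply/andP; split.
    have /andP[A10 A1] := Ac 1%N isT.
    have := le_trans A10 A1; rewrite expr1 nmulr_lge0//.
    by rewrite pmulr_lle0.
  have /andP[A20 A2] := Ac 2%N isT.
  have := le_trans A20 A2; rewrite pmulr_lge0 ?pmulr_lge0//.
  by rewrite exprn_even_gt0//= lt_eqF.
by move: An; rewrite c0 normr0 !mul0r.
Qed.

Lemma Vnorm_le d (T : measurableType d) (R : realType) (V : T -> R)
    (h : T -> \bar R) : (forall x, 1 <= V x) -> (Vnorm V h < +oo)%E ->
  exists2 c, 0 <= c & forall x, (`|h x| <= (c * V x)%:E)%E.
Proof.
move=> V1 hV.
have ub x : (`|h x| * ((V x)^-1)%:E <= Vnorm V h)%E by apply: ereal_sup_ubound; exists x.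
have V0 x : 0 < V x by rewrite (lt_le_trans ltr01).
have S0 : (0 <= Vnorm V h)%E.
  by rewrite (le_trans _ (ub point))// mule_ge0// lee_fin invr_ge0 ltW.
have SE : Vnorm V h = (fine (Vnorm V h))%:E by rewrite fineK// ge0_fin_numE.
exists (fine (Vnorm V h)) => [|x]; first exact: fine_ge0.
by rewrite EFinM -SE -lee_pdivrMr.
Qed.

Section conjugate_exponents.
Context (R : realType) (q kappa : R).
Hypotheses (q1 : 1 < q) (kappa1 : 1 < kappa).

Local Notation m := (2 * kappa * q).
Local Notation a := (2 * kappa * q / (q - 1)).
Local Notation k := (2 * kappa).

Let q0 : 0 < q. Proof. exact: lt_trans ltr01 q1. Qed.
Let q10 : 0 < q - 1. Proof. by rewrite subr_gt0. Qed.
Let k2 : 2 < k. Proof. by rewrite ltr_pMr. Qed.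

(** Young's inequality with the conjugate exponents [q / (q - 1)] and [q], applied to the powers [k]
    of [u] and [v]; its two coefficients are at most 1 and are dropped. *)
Lemma conjugate_young (u v : R) : 0 <= u -> 0 <= v ->
  (u * v) `^ k <= u `^ a + v `^ m.
Proof.
move=> u0 v0; rewrite powRM//.
have q'0 : 0 < q / (q - 1) by rewrite divr_gt0.
have conj : (q / (q - 1))^-1 + q^-1 = 1.
  by rewrite invf_div; field; rewrite gt_eqF.
have := conjugate_powR (powR_ge0 u k) (powR_ge0 v k) q'0 q0 conj.
rewrite -!powRrM (_ : k * (q / (q - 1)) = a); last by rewrite mulrA.
move=> h; rewrite (le_trans h)// lerD// ler_piMr ?powR_ge0//.
  by rewrite invf_le1// ler_pdivlMr// mul1r lerBlDr lerDl.
by rewrite invf_le1// ltW.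
Qed.

Lemma left_exponent : 2 <= a.
Proof.
rewrite ler_pdivlMr// (le_trans (_ : _ <= 2 * q))//.
  by rewrite ler_pM2l// lerBlDr lerDl.
by rewrite ler_pM2r// ltW.
Qed.

Lemma right_exponent : 2 <= m.
Proof. by rewrite (le_trans (ltW k2))// ler_peMr ?(ltW q1)// (le_trans _ (ltW k2)). Qed.

Lemma sqr_le1D (e u : R) : 2 <= e -> 0 <= u -> u ^+ 2 <= 1 + u `^ e.
Proof. by move=> e2 u0; rewrite -powR_mulrn// powR_le1D. Qed.

Lemma sqrM_le (u v : R) : 0 <= u -> 0 <= v -> (u * v) ^+ 2 <= 2 + u `^ a + v `^ m.
Proof.
move=> u0 v0; rewrite (le_trans (sqr_le1D (ltW k2) (mulr_ge0 u0 v0)))//.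
by rewrite -addrA lerD ?conjugate_young// ler1n.
Qed.

End conjugate_exponents.

(** * Normalization of the assumptions and conclusion *)

Local Open Scope ereal_scope.

Theorem theorem3p2 (R : realType) (d : measure_display) (T : measurableType d)
    (Theta : set R) (theta0 : R)
    (P : R -> R.-pker T ~> T) (pi : R -> probability T R) (f : T -> R)
    (Pbar : R -> R.-pker (T * T)%type ~> (T * T)%type)
    (p dp : R -> T -> T -> R) (eps : R) (V : T -> R) (Rc r : R)
    (mu0 : probability T R) (z : T) (L : nat)
    (* the coupled pair from all its starting states *)
    (dC : measure_display) (OC : measurableType dC)
    (C : R.-pker (T * T)%type ~> OC) (WC : nat -> OC -> T * T)
    (* the experiment that produces the estimators *)
    (dO : measure_display) (O : measurableType dO) (Pr : probability O R)
    (X Y : nat -> O -> T) (W : bool * nat -> nat -> O -> T * T)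
    (* the one-block experiment from all its starting states *)
    (dE : measure_display) (OE : measurableType dE)
    (E : R.-pker T ~> OE) (XE : nat -> OE -> T) (WE : nat -> OE -> T * T) :
  let gamma := fun theta => Rintegral (pi theta) setT f in
  let SEk := fun k w => SE f (dp theta0) L k (X ^~ w)
                          (fun j i => W (true, j) i w) in
  let BCk := fun k w => BC f (dp theta0) L k (X ^~ w) (Y ^~ w)
                          (fun j i => W (true, j) i w)
                          (fun j i => W (false, j) i w) in
  let H2k := fun k w => H2 f (dp theta0) L k (X ^~ w) (Y ^~ w)
                          (fun j i => W (true, j) i w)
                          (fun j i => W (false, j) i w) in
  let costk := fun k w => cost R L k (X ^~ w) (Y ^~ w)
                          (fun j i => W (true, j) i w)
                          (fun j i => W (false, j) i w) in
  let Gamma := Gamma1 L f (dp theta0) E XE WE in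
  Theta theta0 ->
  (forall theta, Theta theta -> unique_invariant (P theta) (pi theta)) ->
  measurable_fun setT f ->
  (forall theta, Theta theta -> (pi theta).-integrable setT (EFin \o f)) ->
  (forall theta, Theta theta -> coupling (P theta) (Pbar theta)) ->
  A1 Theta theta0 P p dp eps ->
  A2 theta0 P pi eps V Rc r ->
  A3 V mu0 ->
  (forall xz, markov_chain (C xz) (Pbar theta0) \d_xz WC) ->
  A4 V Rc r C WC ->
  A5 theta0 P f dp eps V ->
  (1 <= L)%N ->
  lagged_pair Pr (P theta0) (Pbar theta0) L X Y mu0 ->
  fresh_pairs Pr (Pbar theta0) z L X Y W ->
  block_family (P theta0) (Pbar theta0) z L E XE WE ->
  [/\ derivable gamma theta0 1,
      forall k : nat,
        [/\ Pr.-integrable setT (EFin \o H2k k),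
            'E_Pr[H2k k] = (gamma^`()%classic theta0)%:E,
            'E_Pr[fun w => (H2k k w ^+ 2)%R] < +oo &
            Pr.-integrable setT (costk k)],
      'E_Pr[fun w => (BCk k w ^+ 2)%R] @[k --> \oo] --> 0 &
      `| 'E_Pr[fun w => (SEk k w ^+ 2)%R] - \int[pi theta0]_x Gamma x |
        @[k --> \oo] --> 0].
Proof.
move=> gamma SEk BCk H2k costk Gamma Th0 UI mf fint cpl HA1 HA2 muVlty CP HA4 HA5
  L1 LP FP BE.
have [dens eps0 subTheta C1 _] := HA1.
have [mV V1 [K [lambda [b [l01 smallK drift]]]] _ [r1 erg]] := HA2.
have [q [kappa [delta [q1 kappa1 delta0 fVn wVn]]]] := HA5.
have [M [rho [RcM /andP[rrho rho1] tail]]] := HA4.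
pose Q := P theta0; pose s := dp theta0.
(* [m], [a] and [k] are the orders of the moments of [G], of the scores and of [H]; [e], above [m]
   by [delta], is that of [f]. *)
pose m := (2 * kappa * q)%R; pose a := (2 * kappa * q / (q - 1))%R.
pose k := (2 * kappa)%R; pose e := (m + delta)%R.
have k2 : (2 < k)%R by rewrite ltr_pMr.
have young u v : (0 <= u)%R -> (0 <= v)%R -> ((u * v) `^ k <= u `^ a + v `^ m)%R.
  exact: conjugate_young.
have a2 : (2 <= a)%R by exact: left_exponent.
have m2 : (2 <= m)%R by exact: right_exponent.
have a1 : (1 <= a)%R by rewrite (le_trans _ a2)// ler1n.
have m1 : (1 <= m)%R by rewrite (le_trans _ m2)// ler1n.
have me : (m < e)%R by rewrite ltrDl.
have V0 x : (0 < V x)%R by rewrite (lt_le_trans ltr01).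
have closeTheta theta : (`|theta - theta0| < eps)%R -> Theta theta.
  by move=> ct; apply: subTheta; rewrite /= ltW.
have close0 : (`|theta0 - theta0| < eps)%R by rewrite subrr normr0.
have [Cf Cf0 fV'] := Vnorm_le V1 fVn.
have fV x : (`|f x| `^ e <= Cf * V x)%R.
  by have := fV' x; rewrite lee_fin ger0_norm// powR_ge0.
have [Cw Cw0 wV'] := Vnorm_le V1 wVn.
have wV x : Omega theta0 P dp eps a x <= (Cw * V x)%:E.
  exact: le_trans (lee_abs _) (wV' x).
(* The sign of [b] is not given; its positive part dominates the term with the indicator of [K]. *)
pose b' := Num.max b 0%R : R.
have b'0 : (0 <= b')%R by rewrite le_max lexx orbT.
have QV theta : (`|theta - theta0| < eps)%R -> forall x,
    \int[P theta x]_y (V y)%:E <= (lambda * V x + b')%:E.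
  move=> ct x; rewrite (le_trans (drift theta ct x))// lee_fin lerD2l indicE.
  by case: (x \in K); rewrite ?mulr1 ?mulr0// le_max lexx.
have invpi theta : (`|theta - theta0| < eps)%R -> invariant (P theta) (pi theta).
  by move=> ct; have [] := UI theta (closeTheta theta ct).
have cQ := cpl theta0 Th0.
have piV := piV_lty mV V1 l01 b'0 (QV theta0 close0) (invpi theta0 close0).
(* [r] may be zero or negative. The maximum with 1/2 gives a rate in (0, 1), with [|Rc|] for [Rc],
   through [geometric_rate]; the same is done for [rho] and [M] below. *)
pose s1 := Num.max r (2^-1)%R : R.
have s101 : (0 < s1 < 1)%R.
  rewrite lt_max invr_gt0 ltr0n orbT/= gt_max r1 invf_lt1// ltr1n//.
(* One passage from the extended integrals of (A2) to real ones at the new rate, used for [V] and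
   for [sqrt V]. *)
have gap (v : T -> R) : (forall x, 0 < v x)%R -> (forall x, v x <= V x)%R ->
    (forall g : T -> R, measurable_fun setT g -> (forall y, `|g y| <= v y)%R ->
     forall x n, (0 < n)%N ->
     `| \int[kiter Q n x]_y (g y)%:E - \int[pi theta0]_y (g y)%:E |
       <= (Rc * v x * r ^+ n)%:E) ->
    forall g : T -> R, measurable_fun setT g -> (forall y, `|g y| <= v y)%R ->
    forall x n, (0 < n)%N ->
    (`|Pn Q n g x - \int[pi theta0]_y g y| <= `|Rc| * v x * s1 ^+ n)%R.
  move=> v0 vV ev g mg gv x.
  apply: (geometric_rate (A := fun n => `|Pn Q n g x - \int[pi theta0]_y g y|%R)) => // n n0.
  have dg : dominated V g.
    by split => //; exists 1%R => y; rewrite mul1r (le_trans (gv y)).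
  rewrite normr_ge0/= -lee_fin; have := ev g mg gv x n n0.
  rewrite (Pn_EFin mV V1 l01 b'0 (QV theta0 close0))// Rintegral_EFin//.
  exact: (dominated_integrable mV V1).
have ergV := gap V V0 (fun x => lexx (V x)) (fun g mg gv x n n0 => (erg x n n0).1 g mg gv).
have sV0 x : (0 < Num.sqrt (V x))%R by rewrite sqrtr_gt0.
have sVV x : (Num.sqrt (V x) <= V x)%R by exact: sqrtr_le.
have ergS := gap _ sV0 sVV (fun g mg gv x n n0 => (erg x n n0).2 g mg gv).
pose rho' := Num.max rho (2^-1)%R : R.
have rho'01 : (0 < rho' < 1)%R.
  by rewrite lt_max invr_gt0 ltr0n orbT/= gt_max rho1 invf_lt1// ltr1n.
have M'0 : (0 <= `|M|)%R by [].
have Ctail x y t : C (x, y) [set w | time_gt (meeting (WC ^~ w)) t] <=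
    (`|M| * (V x + V y) * rho' ^+ t)%:E.
  pose D n := [set w | time_gt (meeting (WC ^~ w)) n].
  have DE n : C (x, y) (D n) = (fine (C (x, y) (D n)))%:E.
    by rewrite fineK// ge0_fin_numE// (le_lt_trans (tail x y n))// ltry.
  have Dn n : (0 <= fine (C (x, y) (D n)) <= M * (V x + V y) * rho ^+ n)%R.
    by rewrite fine_ge0//= -lee_fin -DE tail.
  have VV0 : (0 < V x + V y)%R by rewrite addr_gt0.
  (* [geometric_rate] starts at time 1; at [t = 0] both powers are 1 and only the constants are
     compared. *)
  rewrite -/(D t) DE lee_fin; case: t => [|t]; last first.
    exact: (geometric_rate (A := fun n => fine (C (x, y) (D n))) VV0 (fun n _ => Dn n)).
  have /andP[_ D0] := Dn 0%N; rewrite (le_trans D0)// !expr0 !mulr1.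
  by rewrite ler_wpM2r ?(ltW VV0)// ler_norm.
have v0E : \int[mu0]_x (V x)%:E = (fine (\int[mu0]_x (V x)%:E))%:E.
  rewrite fineK// ge0_fin_numE//; apply: integral_ge0 => x _.
  by rewrite lee_fin ltW.
have muV : \int[mu0]_x (V x)%:E <= (fine (\int[mu0]_x (V x)%:E))%:E.
  by rewrite -v0E.
have mp theta : (`|theta - theta0| < eps)%R ->
    measurable_fun setT (fun xy : T * T => p theta xy.1 xy.2).
  by move=> /closeTheta/dens[].
have p_ge0 theta : (`|theta - theta0| < eps)%R -> forall x y, (0 <= p theta x y)%R.
  by move=> /closeTheta/dens[].
have pP theta : (`|theta - theta0| < eps)%R -> forall x A, measurable A ->
    P theta x A = \int[P theta0 x]_(y in A) (p theta x y)%:E.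
  by move=> /closeTheta/dens[].
have qs x y : quotient theta0 p dp theta0 x y = s x y by rewrite /quotient eqxx.
have ms : measurable_fun setT (fun xy : T * T => s xy.1 xy.2).
  have := measurable_quotient eps0 mp C1 close0.
  by under eq_fun do rewrite qs.
have sV x : \int[Q x]_y (`|s x y| `^ a)%:E <= (Cw * V x)%:E.
  apply: le_trans (wV x); apply: ge0_le_integral_nonmeas => y.
    by rewrite lee_fin powR_ge0.
  rewrite lee_fin ge0_ler_powR ?nnegrE ?(le_trans ler01 a1)//.
    by rewrite (le_trans _ (quotient_le_omega eps0 C1 x y close0)).
  by have := quotient_le_omega eps0 C1 x y close0; rewrite qs.
pose g := Gmean C WC f L z; pose h := Poisson_sum Q g L.
have mg : measurable_fun setT g by exact: (measurable_Gmean cQ CP L z mf).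
have QV0 := QV theta0 close0; have invpi0 := invpi theta0 close0.
have [Cg Cg0 gV] := Gmean_powR mV V1 l01 b'0 QV0 cQ CP M'0 rho'01 Ctail z mf L1
  m1 me Cf0 fV.
have [Ch Ch0 hV] := Poisson_sum_powR mV V1 l01 b'0 QV0 m1 mg Cg0 gV L.
have dh := dominated_Poisson_sum mV V1 l01 b'0 QV0 m1 mg gV L.
have df := f_dominated V1 mf m1 me fV.
have hP x : (h x - Pn (P theta0) 1 h x = f x - \int[pi theta0]_y f y)%R.
  rewrite /h (Poisson_sumE mV V1 l01 b'0 QV0 m1 mg gV).
  exact: (Gmean_Poisson mV V1 l01 b'0 QV0 cQ CP M'0 rho'01 Ctail invpi0 s101 ergV
    z mf L1 m1 me Cf0 fV).
have R10 : (0 <= `|Rc|)%R by [].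
have dgamma := is_derive_invariant_mean mV V1 l01 b'0 QV invpi eps0 mp p_ge0 pP C1
  R10 s101 ergV ergS (le_trans ler01 a1) Cw0 m1 wV
  (fun u => sqr_le1D a2) (sqrM_le q1 kappa1) df dh.1 Ch0 hV hP.
have k1 : (1 <= k)%R by rewrite (le_trans _ (ltW k2))// ler1n.
pose bH := blockH f L s; pose blk := block_of X Y W true.
have SEE j w : SEk j w = bH (blk j w) by exact: (Hval_block f L s X Y W true j w).
have H2E j : H2k j = fun w => (bH (blk j w) + BCk j w)%R.
  by apply/funext => w; rewrite -SEE.
have est := estimator_mean mV V1 l01 b'0 QV0 cQ CP M'0 rho'01 Ctail mf L1 m1 me Cf0
  fV ms a1 k2 Cw0 young sV BE muV LP FP invpi0 s101 ergV.
have statE := invariant_block_mean mV V1 l01 b'0 QV0 cQ CP M'0 rho'01 Ctail mf L1 m1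
  me Cf0 fV ms a1 k1 Cw0 young sV BE invpi0.
have iS j : Pr.-integrable setT (fun w => (bH (blk j w))%:E).
  exact: (block_of_integrable mV V1 l01 b'0 QV0 cQ CP M'0 rho'01 Ctail mf L1 m1 me Cf0
  fV ms a1 k2 Cw0 young sV BE muV LP FP true j).
have iB j : Pr.-integrable setT (EFin \o BCk j).
  exact: (bias_integrable mV V1 l01 b'0 QV0 cQ CP M'0 rho'01 Ctail mf L1 m1 me Cf0
  fV ms a1 k2 Cw0 young sV BE muV LP FP j).1.
have sqrS j : \int[Pr]_w (bH (blk j w) ^+ 2)%:E =
    (\int[Pr]_w Gamma_mean f L s E XE WE (X j w))%:E.
  exact: (block_of_sqr mV V1 l01 b'0 QV0 cQ CP M'0 rho'01 Ctail mf L1 m1 me Cf0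
  fV ms a1 k2 Cw0 young sV BE muV LP FP true j).
have [C0 [s0 [C00 /andP[s00 s01] bC]]] := bias_moment mV V1 l01 b'0 QV0 cQ CP M'0
  rho'01 Ctail mf L1 m1 me Cf0 fV ms a1 k2 Cw0 young sV BE muV LP FP
  (ler1n R 2) k2.
have sqrB j : \int[Pr]_w (BCk j w ^+ 2)%:E <= (C0 * s0 ^+ j)%:E.
  apply: le_trans (bC j); apply: ge0_le_integral_nonmeas => w.
    by rewrite lee_fin sqr_ge0.
  by rewrite lee_fin powR_mulrn// real_normK ?num_real.
have EE (Z : O -> R) : 'E_Pr[Z] = \int[Pr]_w (Z w)%:E by rewrite unlock.
(* Here the two halves of the argument meet: the slope from the perturbation of the invariant law is
   the stationary mean of a block, which [est] equates with the mean of the estimator. *)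
have slopeE : (\int[pi theta0]_x dP theta0 P p dp theta0 h x =
    \int[pi theta0]_x block_mean f L s E XE WE x)%R.
  rewrite statE; apply: eq_Rintegral => x _; apply: eq_Rintegral => y _.
  by rewrite qs.
have GammaE x : Gamma x = (Gamma_mean f L s E XE WE x)%:E.
  exact: (Gamma1E mV V1 l01 b'0 QV0 cQ CP M'0 rho'01 Ctail mf L1 m1 me Cf0
  fV ms a1 k2 Cw0 young sV BE).
have dG := dominated_Gamma_mean mV V1 l01 b'0 QV0 cQ CP M'0 rho'01 Ctail mf L1 m1
  me Cf0 fV ms a1 k2 Cw0 young sV BE.
have Gcvg := block_of_sqr_cvg mV V1 l01 b'0 QV0 cQ CP M'0 rho'01 Ctail mf L1 m1 me Cf0
  fV ms a1 k2 Cw0 young sV BE muV LP invpi0 s101 ergV.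
split.
- exact: (@ex_derive _ _ _ _ _ _ _ dgamma).
- move=> j; rewrite !EE H2E; split.
  + exact: (integrableD measurableT (iS j) (iB j)).
  + rewrite derive1E (@derive_val _ _ _ _ _ _ _ dgamma) slopeE -(est j).
    rewrite Rintegral_EFin; last exact: (integrableD measurableT (iS j) (iB j)).
    by rewrite RintegralD//; exact: iS.
  + have mS : measurable_fun setT (fun w => (bH (blk j w) ^+ 2)%:E).
      apply/measurable_EFinP; apply: measurable_funX.
      by apply/measurable_EFinP; exact: measurable_int (iS j).
    have mB : measurable_fun setT (fun w => (BCk j w ^+ 2)%:E).
      apply/measurable_EFinP; apply: measurable_funX.
      by apply/measurable_EFinP; exact: measurable_int (iB j).
    have sqr0 (y : R) : 0 <= (y ^+ 2)%:E by rewrite lee_fin sqr_ge0.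
    (* The square of the sum is at most twice the sum of the squares. *)
    apply: (@le_lt_trans _ _ (\int[Pr]_w (2%:E *
        ((bH (blk j w) ^+ 2)%:E + (BCk j w ^+ 2)%:E)))%E).
      apply: ge0_le_integral_nonmeas => w; first exact: sqr0.
      rewrite -EFinD -EFinM lee_fin.
      by have := sqr_ge0 (bH (blk j w) - BCk j w); rewrite !(sqrrB, sqrrD); lra.
    rewrite ge0_integralZl_EFin//; [|by move=> w _; rewrite adde_ge0|exact: emeasurable_funD].
    rewrite ge0_integralD// sqrS lte_mul_pinfty// lte_add_pinfty ?ltry//.
    exact: le_lt_trans (sqrB j) (ltry _).
  + exact: (total_cost_integrable mV V1 l01 b'0 QV0 cQ CP M'0 rho'01 Ctail L1 muV LP FP j).
- under eq_fun do rewrite EE.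
  apply: (squeeze_cvge (f := cst 0) (h := fun j => (C0 * s0 ^+ j)%:E)).
  + apply: nearW => j; rewrite sqrB andbT; apply: integral_ge0 => w _.
    by rewrite lee_fin sqr_ge0.
  + exact: cvg_cst.
  + apply: cvg_EFin; first exact: nearW.
    by apply: cvg_geometric; rewrite gtr0_norm.
- have GEj j : `| 'E_Pr[fun w => (SEk j w ^+ 2)%R] - \int[pi theta0]_x Gamma x | =
      (`|\int[Pr]_w Gamma_mean f L s E XE WE (X j w) -
        \int[pi theta0]_x Gamma_mean f L s E XE WE x|)%R%:E.
    rewrite EE; under eq_integral do rewrite SEE.
    rewrite sqrS; under [X in _ - X]eq_integral do rewrite GammaE.
    by rewrite Rintegral_EFin//; exact: (dominated_integrable mV V1 piV dG).
  under eq_fun do rewrite GEj.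
  apply: cvg_EFin; first exact: nearW.
  apply/norm_cvg0P.
  rewrite -(subrr (\int[pi theta0]_x Gamma_mean f L s E XE WE x)%R).
  by apply: (@cvgB _ R^o) => //; exact: cvg_cst.
Qed.
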